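(* Let $p>1$ and $\mu>0$. Let $f\in C^3(\mathbb{R})$ satisfy $f(0)=f'(0)=0$ and $f''(u)>0$ for all $u\in\mathbb{R}$, and let $u_-=u_+=\tilde u\in\mathbb{R}$. Assume that $u_0-\tilde u\in L^2$ and $\partial_x u_0\in L^{p+1}$. Let $u$ be the unique global weak solution of the Cauchy problem $$\partial_t u+\partial_x(f(u))=\mu\,\partial_x\left(|\partial_x u|^{p-1}\partial_x u\right)\ (t>0,\ x\in\mathbb{R}),\qquad u(0,x)=u_0(x)\ (x\in\mathbb{R}),\qquad \lim_{x\to\pm\infty}u(t,x)=\tilde u\ (t\ge 0)$$ satisfying $$u-\tilde u\in C^0([0,\infty);L^2)\cap L^\infty(\mathbb{R}^+;L^2),$$ $$\partial_x u\in L^\infty(\mathbb{R}^+;L^{p+1})\cap L^{p+1}(\mathbb{R}^+_t\times\mathbb{R}_x)\cap L^{p+2}(\mathbb{R}^+_t\times\mathbb{R}_x),\qquad \partial_x\left(|\partial_x u|^{p-1}\partial_x u\right)\in L^2(\mathbb{R}^+_t\times\mathbb{R}_x).$$ Then for every $q\in[2,\infty)$ and every $\epsilon>0$ there exist constants $C(p,q,u_0)$ and $C(\epsilon,p,q,u_0,\partial_x u_0)$ such that for all $t\ge 0$ $$\|u(t)-\tilde u\|_{L^q}\le C(p,q,u_0)\,(1+t)^{-\frac{1}{3p+1}\left(1-\frac{2}{q}\right)},$$ $$\|u(t)-\tilde u\|_{L^\infty}\le C(\epsilon,p,q,u_0,\partial_x u_0)\,(1+t)^{-\frac{1}{3p+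1}+\epsilon}.$$
   Context: $L^q=L^q(\mathbb{R})$ and $\mathbb{R}^+=(0,\infty)$. The notation $C(\alpha,\beta,\dots)$ is used for positive constants to emphasize their dependence on $\alpha,\beta,\dots$; the fixed data $\mu$, $f$ and the far field state are not listed. Weak solution has its usual meaning (the equation holds in the sense of distributions and the initial datum is attained). It is a known result of Matsumura and Nishihara that, under the stated hypotheses, a unique global weak solution in the stated class exists (and $\sup_x|u(t,x)-\tilde u|\to0$ as $t\to\infty$). *)

(* Defs.v *)
From HB Require Import structures.
From mathcomp Require Import all_boot all_order all_algebra.
From mathcomp Require Import all_classical all_reals all_analysis.
Set Implicit Arguments.
Unset Strict Implicit.
Unset Printing Implicit Defensive.
Import Order.TTheory GRing.Theory Num.Theory.
Import numFieldNormedType.Exports.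
Local Open Scope classical_set_scope.
Local Open Scope ring_scope.

Notation leb R := (@lebesgue_measure R).

Definition leb2 (R : realType) :
    {measure set (measurableTypeR R * measurableTypeR R) -> \bar R} :=
  (leb R \x leb R)%E.

Definition Lq_norm (R : realType) (q : \bar R) (h : R -> R) : \bar R :=
  'N[leb R]_q[EFin \o h]%E.

(** [\partial_x] of a function of [(t, x)] lives on the open half-plane
    [t > 0]; functions of time and space are curried, [u t x]. *)
Definition half_plane (R : realType) : set (R * R) := [set z | 0 < z.1].

(** [derivable] and ['D_v] are directional.  In finite dimension, continuity
    of all iterated directional derivatives of order at most [k] is the usual
    C^k regularity. *)
Fixpoint Ck (R : realType) (V : normedModType R) (k : nat) (phi : V -> R) :
    Prop :=
  continuous phi /\
  if k is k'.+1 then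
    forall v : V, (forall x : V, derivable phi x v) /\ Ck k' ('D_v phi)
  else True.

Definition test_function (R : realType) (V : normedModType R) (D : set V)
    (phi : V -> R) : Prop :=
  [/\ forall k, Ck k phi,
      compact (closure [set x | phi x != 0]) &
      closure [set x | phi x != 0] `<=` D].

Definition weak_derivative (R : realType) (h g : R -> R) : Prop :=
  [/\ locally_integrable [set: R] h,
      locally_integrable [set: R] g &
      forall phi : R -> R, test_function [set: R] phi ->
        \int[leb R]_x (h x * derive1 phi x) = - (\int[leb R]_x (g x * phi x))].

(** The library's [locally_integrable] is only available on the line. *)
Definition locally_integrable2 (R : realType) (D : set (R * R))
    (h : R -> R -> R) : Prop :=
  [/\ measurable_fun D (fun z => h z.1 z.2), open D &
      forall K : set (R * R), K `<=` D -> compact K ->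
        (\int[leb2 R]_(z in K) `|h z.1 z.2|%:E < +oo)%E].

Definition dt (R : realType) (phi : R * R -> R) : R * R -> R :=
  'D_((1, 0) : R * R) phi.

Definition dx (R : realType) (phi : R * R -> R) : R * R -> R :=
  'D_((0, 1) : R * R) phi.

Definition weak_dx (R : realType) (h g : R -> R -> R) : Prop :=
  [/\ locally_integrable2 (@half_plane R) h,
      locally_integrable2 (@half_plane R) g &
      forall phi : R * R -> R, test_function (@half_plane R) phi ->
        \int[leb2 R]_(z in @half_plane R) (h z.1 z.2 * dx phi z) =
        - (\int[leb2 R]_(z in @half_plane R) (g z.1 z.2 * phi z))].

(** [|v|^(p-1) v]; for [p > 1] the value at [v = 0] is [0]. *)
Definition flux (R : realType) (p : R) (v : R -> R -> R) : R -> R -> R :=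
  fun t x => `|v t x| `^ (p - 1) * v t x.

Definition weak_equation (R : realType) (p mu : R) (f : R -> R)
    (u v : R -> R -> R) : Prop :=
  [/\ locally_integrable2 (@half_plane R) u,
      locally_integrable2 (@half_plane R) (fun t x => f (u t x)),
      locally_integrable2 (@half_plane R) (flux p v) &
      forall phi : R * R -> R, test_function (@half_plane R) phi ->
        - (\int[leb2 R]_(z in @half_plane R)
             (u z.1 z.2 * dt phi z + f (u z.1 z.2) * dx phi z)) =
        - (mu * \int[leb2 R]_(z in @half_plane R)
                  (flux p v z.1 z.2 * dx phi z))].

(** [u(t)] is an element of a Lebesgue space, so its limits at infinity are
    those of a representative. *)
Definition far_field (R : realType) (ut : R) (u : R -> R -> R) : Prop :=
  forall t : R, 0 <= t ->
    exists g : R -> R,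
      [/\ {ae leb R, forall x, u t x = g x},
          g x @[x --> +oo] --> ut &
          g x @[x --> -oo] --> ut].

Definition C0_L2 (R : realType) (h : R -> R -> R) : Prop :=
  (forall t : R, 0 <= t -> h t \in Lfun (leb R) 2%:E) /\
  (forall s : R, 0 <= s ->
     Lq_norm 2%:E (h t \- h s)
       @[t --> within `[0, +oo[ (nbhs s)] --> 0%E).

Definition Linfty_Lq (R : realType) (q : R) (h : R -> R -> R) : Prop :=
  exists M : R, {ae leb R, forall t, 0 < t ->
    h t \in Lfun (leb R) q%:E /\ (Lq_norm q%:E (h t) <= M%:E)%E}.

Definition Lq_space_time (R : realType) (q : R) (h : R -> R -> R) : Prop :=
  ((fun z : measurableTypeR R * measurableTypeR R => h z.1 z.2) \_ (@half_plane R))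
    \in Lfun (leb2 R) q%:E.

Definition global_weak_solution (R : realType) (p mu : R) (f : R -> R) (ut : R)
    (u0 : R -> R) (u : R -> R -> R) : Prop :=
  let w t x := u t x - ut in
  exists v a : R -> R -> R,
    [/\ weak_dx u v, weak_dx (flux p v) a &
    [/\ weak_equation p mu f u v,
        {ae leb R, forall x, u 0 x = u0 x} &
        far_field ut u] /\
    [/\ C0_L2 w, Linfty_Lq 2 w, Linfty_Lq (p + 1) v,
        Lq_space_time (p + 1) v /\ Lq_space_time (p + 2) v &
        Lq_space_time 2 a]].

(* Main.v *)
(* Write w = u - ut and v = u_x, and let eta be convex with eta(0) = eta'(0) = 0
   and eta'' bounded.  Multiplying the equation by eta'(w) gives
     int eta(w(T)) + mu int_s^T int eta''(w) |v|^(p+1) <= int eta(w(s)).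
   The choice eta(y) = y^2 bounds the L^2 norm of w and the total dissipation;
   an eta vanishing exactly on ]-oo, k], and its reflection, give the maximum
   principle |w(s)| <= k ==> |w(T)| <= k.  At almost every time
     |w|_oo^(3p+1) <= C |w|_2^(2p) |v|_(p+1)^(p+1),
   and some s in [t/2, t] has |v(s)|_(p+1)^(p+1) <= C/t since the dissipation is
   integrable in time.  By the maximum principle |w(t)|_oo <= C t^(-1/(3p+1)),
   and the L^q rates follow by interpolation with the L^2 bound.

   The equation only holds in the sense of distributions.  It is integrated in
   time at almost every x, giving w(T) - w(s) = int_s^T (mu (|v|^(p-1) v)_x - f'(u) v);
   convexity then turns these increments into an inequality for the entropy,
   and the integration by parts in x is done on almost every time slice, where
   u and |v|^(p-1) v are absolutely continuous. *)

Require Import Defs.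
From HB Require Import structures.
From mathcomp Require Import all_boot all_order all_algebra.
From mathcomp Require Import all_classical all_reals all_analysis.
From mathcomp Require Import measurable_realfun ess_sup_inf ring lra.
Set Implicit Arguments.
Unset Strict Implicit.
Unset Printing Implicit Defensive.
Import Order.TTheory GRing.Theory Num.Theory.
Import numFieldNormedType.Exports.
Local Open Scope classical_set_scope.
Local Open Scope ring_scope.

(** * Smooth bumps *)

(** The chain rule for f(u) and for the entropies needs f' bounded along the solution, but no
    pointwise bound is part of the solution class. A crude bound [M] is therefore obtained first,
    from the mass and the energy of almost every slice. It depends on the solution, and the
    constants it enters are all multiplied by 1 / N and disappear.

    Space is unbounded, so entropies are weighted on [-N, N] by 1 - (x/N)^2, which vanishes at the
    ends and has slope at most 2 / N. Convection leaves nothing but a cut-off error, because eta'(w)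
    f'(u) v is the exact x-derivative of some Phi(w), with Phi quadratic on [-M, M].

    Time 0 lies outside the domain of the equation. The entropy inequality is proved from positive
    times s, and the L^2 continuity of w lets s approach 0; this costs the non-sharp mass bound 2 B1
    + 2 in terms of the initial mass B1. The final constants depend only on p, mu, q and on the mass
    and supremum of the initial datum, so they are chosen before the solution. *)

Fixpoint Dk (R : realType) (k : nat) (a : R -> R) : Prop :=
  if k is k'.+1 then
    exists2 a' : R -> R, (forall x : R, is_derive x 1 a (a' x)) & Dk k' a'
  else continuous a.

Lemma is_derive_continuous (R : realType) (a : R -> R) a' (x : R) :
  is_derive x 1 a a' -> {for x, continuous a}.
Proof.
move=> h; apply: differentiable_continuous.
exact/derivable1_diffP/ex_derive.
Qed.

Lemma Dk_continuous (R : realType) k (a : R -> R) : Dk k a -> continuous a.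
Proof.
case: k => [//|k [a' h _] x]; exact: (@is_derive_continuous _ _ (a' x)).
Qed.

Lemma DkW (R : realType) k (a : R -> R) : Dk k.+1 a -> Dk k a.
Proof.
elim: k a => [a /Dk_continuous//|k IH a [a' h h']].
by exists a' => //; exact: IH.
Qed.

Lemma Dk_cst (R : realType) k (c : R) : Dk k (fun=> c).
Proof.
elim: k c => [c x|k IH c]; first exact: cst_continuous.
by exists (fun=> 0) => // x; exact: is_derive_cst.
Qed.

Lemma DkD (R : realType) k (a b : R -> R) :
  Dk k a -> Dk k b -> Dk k (fun x => a x + b x).
Proof.
elim: k a b => [a b ca cb x|k IH a b [a' ha ka] [b' hb kb]].
  by apply: continuousD; [exact: ca|exact: cb].
exists (fun x => a' x + b' x); last exact: IH.
by move=> x; exact: is_deriveD.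
Qed.

Lemma DkM (R : realType) k (a b : R -> R) :
  Dk k a -> Dk k b -> Dk k (fun x => a x * b x).
Proof.
elim: k a b => [a b ca cb x|k IH a b].
  by apply: continuousM; [exact: ca|exact: cb].
move=> ka1 kb1; have [ka kb] := (DkW ka1, DkW kb1).
case: ka1 kb1 => [a' ha ka'] [b' hb kb'].
exists (fun x => a x * b' x + b x * a' x).
  by move=> x; exact: is_deriveM.
by apply: DkD; apply: IH.
Qed.

Lemma Dk_affine (R : realType) k (a : R -> R) (s c : R) :
  Dk k a -> Dk k (fun x => a (s * x + c)).
Proof.
have haff (x : R) : is_derive x 1 (fun x => s * x + c) s.
  have := is_deriveD (is_deriveZ s (is_derive_id x (1 : R)))
    (is_derive_cst c x (1 : R)).
  by rewrite addr0 /GRing.scale/= mulr1.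
elim: k a => [a ca x|k IH a [a' ha ka']].
  apply: (@continuous_comp _ _ _ (fun x => s * x + c) a); last exact: ca.
  exact: is_derive_continuous.
exists (fun x => s * a' (s * x + c)).
  by move=> x; rewrite mulrC; exact: (is_derive1_comp (ha _) (haff x)).
by apply: DkM; [exact: Dk_cst|exact: IH].
Qed.

Lemma Dk_expR (R : realType) k (c : R -> R) : Dk k c -> Dk k (expR \o c).
Proof.
elim: k c => [c cc x|k IH c kc].
  by apply: continuous_comp; [exact: cc|exact: continuous_expR].
have kc' := DkW kc; case: kc => c' hc kc.
exists (fun x => expR (c x) * c' x).
  by move=> x; exact: (is_derive1_comp (is_derive_expR _) (hc x)).
by apply: DkM => //; exact: IH.
Qed.

(** [flat 0] is the classical e^(-1/x) extended by 0. The factor [x ^- n] closes the family under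
    differentiation up to linear combinations, so smoothness is an induction on the order with [n]
    left free. *)
Definition flat (R : realType) (n : nat) (x : R) : R :=
  if 0 < x then x ^- n * expR (- x^-1) else 0.

(** The exponential series bounds e^(1/x) below by (1/x)^(n+2) / (n+2)!, which leaves two powers of
    x once [x ^- n] is absorbed. This quadratic bound makes the difference quotient at 0 vanish, the
    delicate point of [is_derive_flat]. *)
Lemma flat_le (R : realType) n : exists C : R,
  forall x, `|@flat R n x| <= C * x ^+ 2.
Proof.
exists n.+2`!%:R => x; rewrite /flat; case: ifPn => [x0|_]; last first.
  by rewrite normr0 mulr_ge0// sqr_ge0.
rewrite ger0_norm ?mulr_ge0 ?invr_ge0 ?exprn_ge0 ?expR_ge0 ?(ltW x0)//.
rewrite expRN.
have := expR_ge1Dxn n.+1 (ltW (eqbRL (invr_gt0 x) x0)).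
set e := expR _ => he.
have e0 : 0 < e by exact: expR_gt0.
have f0 : (0 : R) < n.+2`!%:R by rewrite ltr0n fact_gt0.
have {}he : x^-1 ^+ n.+2 <= e * n.+2`!%:R.
  by rewrite -ler_pdivrMr//; apply: le_trans he; rewrite lerDr.
rewrite ler_pdivrMr//.
have -> : x ^- n = x ^+ 2 * x^-1 ^+ n.+2.
  rewrite exprVn -[n.+2]addn2 exprD invfM mulrCA divff ?mulr1// expf_neq0//.
  by rewrite gt_eqF.
rewrite [leRHS](_ : _ = x ^+ 2 * (e * n.+2`!%:R)); last by ring.
by rewrite ler_wpM2l// sqr_ge0.
Qed.

Lemma is_derive_flat (R : realType) n (x : R) :
  is_derive x 1 (@flat R n) (flat n.+2 x - n%:R * flat n.+1 x).
Proof.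
have [x0|x0|->] := ltgtP x 0.
- rewrite {2 3}/flat ltNge (ltW x0)/= mulr0 subr0.
  apply: (@near_eq_is_derive _ _ _ (cst 0)).
    near=> y; rewrite /flat ifF//; apply/negbTE; rewrite -leNgt.
    by apply: ltW; near: y; exact: lt_nbhsl.
- rewrite {2 3}/flat x0.
apply: (@near_eq_is_derive R R R (fun y : R => y ^- n * expR (- y^-1))).
    near=> y; rewrite /flat ifT//.
    by near: y; exact: lt_nbhsr.
  have xn0 : x != 0 by rewrite gt_eqF.
  have hi : is_derive x 1 (fun y : R => y^-1) (- x ^- 2).
    have := @is_deriveV _ id x 1 1 xn0 (is_derive_id _ _).
    by rewrite /GRing.scale/= mulr1.
  have hX := is_deriveX n hi.
  have hE := @is_derive1_comp R expR (- (fun y : R => y^-1)) x _ _ (is_derive_expR _) (is_deriveN hi).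
  have := is_deriveM hX hE.
  have -> : (fun y : R => y^-1) ^+ n * (expR \o - (fun y : R => y^-1)) =
     (fun y => y ^- n * expR (- y^-1)).
    by apply/funext => y; rewrite /= -[in RHS]exprVn; congr (_ * _); rewrite fctE.
  move=> h; apply: (is_derive_eq h); rewrite /GRing.scale/= !fctE.
  rewrite -!exprVn; case: n {hX hE h} => [|n]/=.
    by rewrite !mul0r !mulr0 subr0 expr0 opprK mul1r addr0 mulrC.
  rewrite !exprS; ring.
- rewrite /flat ltxx mulr0 subr0.
  have [C hC] := @flat_le R n.
  have C0 : 0 <= C by have := hC 1; rewrite expr1n mulr1; exact: le_trans.
  have h0 : (fun h : R => h^-1 *: (flat n (h *: 1 + 0) - flat n 0)) @ 0^' --> (0 : R).
    apply/cvgr0Pnorm_le => e e0; near=> h.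
    have hn0 : h != 0 by near: h; exact: nbhs_dnbhs_neq.
    rewrite /= addr0 [_ *: 1]mulr1 {2}/flat ltxx subr0 normrZ normfV.
    rewrite ler_pdivrMl ?normr_gt0// (le_trans (hC _))//.
    rewrite -[h ^+ 2]real_normK ?num_real// expr2 mulrCA ler_wpM2l//.
    have : `|h| <= e / (C + 1).
      near: h; apply: dnbhs0_le; rewrite divr_gt0//; lra.
    rewrite ler_pdivlMr; last lra.
    by apply: le_trans; rewrite mulrC ler_wpM2l//; lra.
  constructor; first by apply/cvg_ex; exists 0.
  exact/cvg_lim.
Unshelve. all: by end_near. 
Qed.

Lemma Dk_flat (R : realType) k n : Dk k (@flat R n).
Proof.
elim: k n => [n x|k IH n]; first exact: (is_derive_continuous (is_derive_flat n x)).
exists (fun x => flat n.+2 x - n%:R * flat n.+1 x); first exact: is_derive_flat.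
rewrite (_ : (fun _ => _) = fun x => flat n.+2 x + (- n%:R) * flat n.+1 x).
  by apply: DkD => //; apply: DkM => //; exact: Dk_cst.
by apply/funext => x; rewrite mulNr.
Qed.

Lemma flat_gt0 (R : realType) n (x : R) : (0 < flat n x) = (0 < x).
Proof.
rewrite /flat; case: ifPn => [x0|_]; last by rewrite ltxx.
by rewrite mulr_gt0 ?expR_gt0// invr_gt0 exprn_gt0.
Qed.

Lemma flat_ge0 (R : realType) n (x : R) : 0 <= flat n x.
Proof.
rewrite /flat; case: ifPn => [x0|//].
by rewrite mulr_ge0 ?expR_ge0// invr_ge0 exprn_ge0// ltW.
Qed.

(* [1 - expR (- n * b)] with [b > 0] exactly on [`]c, d[]: these bumps increase
   to the indicator as [n] grows. *)
Definition bump (R : realType) (n : nat) (c d x : R) : R :=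
  1 - expR (- (n%:R * (flat 0 (x - c) * flat 0 (d - x)))).

Lemma Dk_bump (R : realType) k n (c d : R) : Dk k (bump n c d).
Proof.
have h1 : forall k, Dk k (fun x => - (n%:R * (flat 0 (x - c) * flat 0 (d - x)))).
  move=> {}k.
  rewrite (_ : (fun _ => _) = (fun x => - n%:R *
    (flat 0 (1 * x + - c) * flat 0 (-1 * x + d)))).
    by apply: DkM; [exact: Dk_cst|apply: DkM; apply: Dk_affine; exact: Dk_flat].
  by apply/funext => x; rewrite mulNr mul1r mulN1r [- x + _]addrC.
rewrite (_ : bump n c d = fun x => 1 + (-1) * (expR \o
    (fun x => - (n%:R * (flat 0 (x - c) * flat 0 (d - x))))) x).
  apply: DkD; first exact: Dk_cst.
  by apply: DkM; [exact: Dk_cst|exact: Dk_expR].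
by apply/funext => x; rewrite mulN1r.
Qed.

Lemma bump_itv (R : realType) n (c d x : R) : 0 <= bump n c d x <= 1.
Proof.
rewrite /bump subr_ge0 gerBl expR_ge0 andbT -expR0 ler_expR oppr_le0.
by rewrite !mulr_ge0 ?flat_ge0.
Qed.

Lemma bump_out (R : realType) n (c d x : R) : x \notin `]c, d[ -> bump n c d x = 0.
Proof.
rewrite in_itv/= negb_and -!leNgt => /orP[] h; rewrite /bump.
  by rewrite {1}/flat subr_gt0 ltNge h/= mul0r mulr0 oppr0 expR0 subrr.
by rewrite {2}/flat subr_gt0 ltNge h/= !mulr0 oppr0 expR0 subrr.
Qed.

Lemma cvg_bump (R : realType) (c d x : R) :
  bump n c d x @[n --> \oo] --> (\1_`]c, d[ x : R).
Proof.
rewrite indicE; have [xcd|xcd] := boolP (x \in `]c, d[%classic); last first.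
  rewrite (_ : (fun _ => _) = cst 0); first exact: cvg_cst.
  apply/funext => n; rewrite bump_out//.
  by apply: contra xcd => ?; rewrite inE.
move: xcd; rewrite inE/= in_itv/= => /andP[cx xd].
set b := flat 0 (x - c) * flat 0 (d - x).
have b0 : 0 < b by rewrite mulr_gt0// flat_gt0 subr_gt0.
rewrite /bump -[X in _ --> X]subr0; apply: cvgB; first exact: cvg_cst.
have -> : (fun n : nat => expR (- (n%:R * b))) = (fun n => expR (- b) ^+ n).
  by apply/funext => n; rewrite -mulrN expRM_natl.
apply: cvg_expr; rewrite ger0_norm ?expR_ge0//.
by rewrite -expR0 ltr_expR oppr_lt0.
Qed.

Lemma CkW (R : realType) (V : normedModType R) k (phi : V -> R) : Ck k.+1 phi -> Ck k phi.
Proof.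
elim: k phi => [phi []//|k IH phi [c h]]; split => // v.
by have [h1 h2] := h v; split => //; exact: IH.
Qed.

Lemma CkD (R : realType) (V : normedModType R) k (a b : V -> R) :
  Ck k a -> Ck k b -> Ck k (fun x => a x + b x).
Proof.
elim: k a b => [a b [ca _] [cb _]|k IH a b [ca ka] [cb kb]].
  by split => // x; apply: cvgD; [exact: ca|exact: cb].
split; first by move=> x; apply: cvgD; [exact: ca|exact: cb].
move=> v; have [da k'a] := ka v; have [db k'b] := kb v.
split; first by move=> x; apply: derivableD.
rewrite (_ : 'D_v _ = fun x => 'D_v a x + 'D_v b x); first exact: IH.
by apply/funext => x; apply: deriveD.
Qed.

Lemma CkM (R : realType) (V : normedModType R) k (a b : V -> R) :
  Ck k a -> Ck k b -> Ck k (fun x => a x * b x).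
Proof.
elim: k a b => [a b [ca _] [cb _]|k IH a b ka1 kb1].
  by split => // x; apply: cvgM; [exact: ca|exact: cb].
have [ka' kb'] := (CkW ka1, CkW kb1).
case: ka1 kb1 => [ca ka] [cb kb].
split; first by move=> x; apply: cvgM; [exact: ca|exact: cb].
move=> v; have [da k'a] := ka v; have [db k'b] := kb v.
split; first by move=> x; apply: derivableM.
rewrite (_ : 'D_v _ = fun x => a x * 'D_v b x + b x * 'D_v a x).
  by apply: CkD; exact: IH.
by apply/funext => x; apply: deriveM.
Qed.

Lemma Ck_cst (R : realType) (V : normedModType R) k (c : R) : Ck k (fun _ : V => c).
Proof.
elim: k c => [c|k IH c]; first by split => // x; exact: cst_continuous.
split; first by move=> x; exact: cst_continuous.
move=> v; split; first by move=> x; exact: derivable_cst.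
rewrite (_ : 'D_v _ = fun _ => 0); first exact: IH.
by apply/funext => x; rewrite derive_cst.
Qed.

Lemma is_derive_lin (R : realType) (V : normedModType R) (L : V -> R)
   (a : R -> R) (a' : R) (x v : V) :
  (forall r v x, L (r *: v + x) = r * L v + L x) ->
  is_derive (L x) 1 a a' -> is_derive x v (a \o L) (L v * a').
Proof.
move=> hL h.
have h1 : is_derive (L x) (L v) a (L v * a').
  have da : differentiable a (L x) by apply/derivable1_diffP; exact: ex_derive.
  apply: DeriveDef; first exact: diff_derivable.
  by rewrite deriveE// diff1E//= derive1E derive_val.
have E : (fun h : R => h^-1 *: ((a \o L) (h *: v + x) - (a \o L) x)) =
       (fun h => h^-1 *: (a (h *: L v + L x) - a (L x))).
  by apply/funext => r; rewrite /= hL.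
case: h1 => h1 h2; constructor.
  by move: h1; rewrite /derivable E.
by rewrite -h2 /derive E.
Qed.

(** Along [v] the derivative of [a \o L] is the constant [L v] times [a' \o L], so [Ck] follows from
    the one-variable predicate [Dk], whose derivatives are explicit witnesses. It serves for the
    identity and for the two projections of the plane. *)
Lemma Ck_lin (R : realType) (V : normedModType R) (L : V -> R) k (a : R -> R) :
  (forall r v x, L (r *: v + x) = r * L v + L x) -> continuous L -> Dk k a -> Ck k (a \o L).
Proof.
move=> hL cL; elim: k a => [a ca|k IH a ka].
  by split => // x; apply: continuous_comp; [exact: cL|exact: ca].
split.
  by move=> x; apply: continuous_comp; [exact: cL|exact: Dk_continuous ka _].
case: ka => a' ha ka v; split.
  by move=> x; apply: ex_derive; apply: is_derive_lin => //; exact: ha.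
rewrite (_ : 'D_v _ = fun x => L v * (a' \o L) x).
  by apply: CkM; [exact: Ck_cst|exact: IH].
by apply/funext => x; have := @is_derive_lin _ _ L a (a' (L x)) x v hL (ha _) => /@derive_val.
Qed.

Lemma continuous_fst2 (R : realType) : continuous (fst : R * R -> R).
Proof. by move=> x; exact: cvg_fst. Qed.

Lemma continuous_snd2 (R : realType) : continuous (snd : R * R -> R).
Proof. by move=> x; exact: cvg_snd. Qed.

Definition bump_supp (R : realType) (c d : R) (b : R -> R) :=
  (forall k, Dk k b) /\ (forall x, x \notin `[c, d] -> b x = 0).

Lemma test_function_bump (R : realType) (c d : R) (b : R -> R) :
  bump_supp c d b -> test_function [set: R] b.
Proof.
move=> [sb zb].
have sub : closure [set x | b x != 0] `<=` `[c, d].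
  rewrite (closure_id `[c, d]).1; last exact: itv_closed.
  by apply: closureS => x /=; apply: contraNP => /negP /zb ->.
split => //.
- move=> k; apply: (@Ck_lin R R id k b) => // x; exact: cvg_id.
- apply: (subclosed_compact _ (@segment_compact R c d) sub); exact: closed_closure.
Qed.

(** The space-time weak formulations are only ever tested on such products. The time support starts
    at [al > 0], which keeps it inside the open half-plane. *)
Lemma test_function_prod (R : realType) (al be c d : R) (a b : R -> R) :
  0 < al -> bump_supp al be a -> bump_supp c d b ->
  test_function (@half_plane R) (fun z => a z.1 * b z.2).
Proof.
move=> al0 [sa za] [sb zb].
set K := `[al, be] `*` `[c, d] : set (R * R).
have cK : compact K by apply: compact_setX; exact: segment_compact.
have sub : closure [set x | a x.1 * b x.2 != 0] `<=` K.
  rewrite (closure_id K).1; last by apply: compact_closed => //; exact: Rhausdorff.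
  apply: closureS => x /=; rewrite mulf_eq0 negb_or => /andP[ax bx].
  by split => /=; [move: ax|move: bx]; apply: contraNP => /negP; [move/za|move/zb] => ->.
split.
- move=> k; apply: CkM.
  + apply: (@Ck_lin R _ fst k a) => //; exact: continuous_fst2.
  + apply: (@Ck_lin R _ snd k b) => //; exact: continuous_snd2.
- apply: (subclosed_compact _ cK sub); exact: closed_closure.
- by move=> z /sub [/= + _]; rewrite in_itv/= => /andP[/(lt_le_trans al0)].
Qed.

Lemma dt_prod (R : realType) (a b : R -> R) (a' : R) (z : R * R) :
  is_derive z.1 1 a a' -> derivable b z.2 1 ->
  dt (fun z => a z.1 * b z.2) z = a' * b z.2.
Proof.
move=> ha /derivableP hb; rewrite /dt.
have h1 := @is_derive_lin R _ fst a _ z (1, 0) (fun _ _ _ => erefl) ha.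
have h2 := @is_derive_lin R _ snd b _ z (1, 0) (fun _ _ _ => erefl) hb.
have := is_deriveM h1 h2 => /@derive_val; rewrite fctE/= => ->.
by rewrite mul0r scaler0 add0r mul1r mulrC.
Qed.

Lemma dx_prod (R : realType) (a b : R -> R) (b' : R) (z : R * R) :
  derivable a z.1 1 -> is_derive z.2 1 b b' ->
  dx (fun z => a z.1 * b z.2) z = a z.1 * b'.
Proof.
move=> /derivableP ha hb; rewrite /dx.
have h1 := @is_derive_lin R _ fst a _ z (0, 1) (fun _ _ _ => erefl) ha.
have h2 := @is_derive_lin R _ snd b _ z (0, 1) (fun _ _ _ => erefl) hb.
have := is_deriveM h1 h2 => /@derive_val; rewrite fctE/= => ->.
by rewrite mul0r scaler0 addr0 mul1r.
Qed.

(** * Real-valued integrable functions *)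

Definition L1 d (T : measurableType d) (R : realType)
    (mu : {measure set T -> \bar R}) (D : set T) (f : T -> R) : Prop :=
  mu.-integrable D (EFin \o f).

Section L1_theory.
Context d (T : measurableType d) (R : realType) (mu : {measure set T -> \bar R}).
Implicit Types (D : set T) (f g : T -> R).

Lemma L1_measurable D f : L1 mu D f -> measurable_fun D f.
Proof. by move=> h; apply/measurable_EFinP; exact: (measurable_int mu). Qed.

Lemma L1D D f g : measurable D -> L1 mu D f -> L1 mu D g -> L1 mu D (fun x => f x + g x).
Proof. by move=> mD hf hg; exact: (integrableD mD hf hg). Qed.

Lemma L1B D f g : measurable D -> L1 mu D f -> L1 mu D g -> L1 mu D (fun x => f x - g x).
Proof. by move=> mD hf hg; exact: (integrableB mD hf hg). Qed.

Lemma L1Z D r f : measurable D -> L1 mu D f -> L1 mu D (fun x => r * f x).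
Proof. by move=> mD hf; exact: (integrableZl mD r hf). Qed.

Lemma eq_L1 D f g : measurable D -> {in D, f =1 g} -> L1 mu D f -> L1 mu D g.
Proof. by move=> mD fg; apply: eq_integrable => // x xD; rewrite /= fg. Qed.

Lemma le_L1 D f g : measurable D -> measurable_fun D f ->
  (forall x, D x -> `|f x| <= `|g x|) -> L1 mu D g -> L1 mu D f.
Proof.
move=> mD mf fg; apply: le_integrable => //; first exact/measurable_EFinP.
Qed.

Lemma L1_norm D f : measurable D -> L1 mu D f -> L1 mu D (fun x => `|f x|).
Proof. by move=> mD h; have := integrable_norm h. Qed.

Lemma L1M D (K : R) f g : measurable D -> L1 mu D f -> measurable_fun D g ->
  (forall x, D x -> `|g x| <= K) -> L1 mu D (fun x => f x * g x).
Proof.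
move=> mD hf mg gK.
apply: (@le_L1 _ _ (fun x => K * f x)) => //.
- by apply: measurable_funM => //; exact: L1_measurable hf.
- move=> x Dx; rewrite !normrM mulrC ler_wpM2r// (le_trans (gK _ Dx))//.
  exact: ler_norm.
- exact: L1Z.
Qed.

Lemma L1S E D f : measurable E -> measurable D -> D `<=` E -> L1 mu E f -> L1 mu D f.
Proof. exact: integrableS. Qed.

Lemma L1_cst D r : measurable D -> (mu D < +oo)%E -> L1 mu D (fun=> r).
Proof.
move=> mD fD; apply: measurable_bounded_integrable => //.
by exists `|r|; split => // M rM x Dx /=; exact: ltW.
Qed.

Lemma L1_bounded D K f : measurable D -> (mu D < +oo)%E -> measurable_fun D f ->
  (forall x, D x -> `|f x| <= K) -> L1 mu D f.
Proof.
move=> mD fD mf fK; apply: (@le_L1 _ _ (fun=> K)) => //; last exact: L1_cst.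
by move=> x Dx; rewrite (le_trans (fK _ Dx))// ler_norm.
Qed.

Lemma L1_fin_num D f : measurable D -> L1 mu D f ->
  (\int[mu]_(x in D) (f x)%:E)%E = (\int[mu]_(x in D) f x)%:E.
Proof. by move=> mD h; rewrite /Rintegral fineK//; exact: integrable_fin_num. Qed.

Lemma ae_eq_L1 D f g : measurable D -> measurable_fun D g ->
  {ae mu, forall x, D x -> f x = g x} -> L1 mu D f -> L1 mu D g.
Proof.
move=> mD mg fg hf; apply/integrableP; split; first exact/measurable_EFinP.
move/integrableP : hf => [mf]; apply: le_lt_trans.
rewrite le_eqVlt; apply/orP; left; apply/eqP; apply: ae_eq_integral => //.
- by apply: measurableT_comp => //; exact/measurable_EFinP.
- by apply: measurableT_comp => //; exact/measurable_EFinP.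
- apply: filterS fg.
  by move=> x /= h Dx; rewrite h.
Qed.

Lemma ae_eq_Rint D f g : measurable D -> measurable_fun D f -> measurable_fun D g ->
  {ae mu, forall x, D x -> f x = g x} -> \int[mu]_(x in D) f x = \int[mu]_(x in D) g x.
Proof.
move=> mD mf mg fg; congr fine; apply: ae_eq_integral => //; try exact/measurable_EFinP.
apply: filterS fg.
by move=> x /= h Dx; rewrite h.
Qed.

Lemma Rint_eq0_ae D f : measurable D -> L1 mu D f -> (forall x, D x -> 0 <= f x) ->
  \int[mu]_(x in D) f x <= 0 -> {ae mu, forall x, D x -> f x = 0}.
Proof.
move=> mD hf f0 If.
have {}If : (\int[mu]_(x in D) `|(f x)%:E|)%E = 0%E.
  rewrite (eq_integral (fun x => (f x)%:E)).
    rewrite L1_fin_num//; congr EFin; apply/eqP; rewrite eq_le If/=.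
    exact: Rintegral_ge0.
  by move=> x; rewrite inE => Dx; rewrite gee0_abs// lee_fin f0.
have := (ae_eq_integral_abs mu mD (measurable_int mu hf)).1 If.
apply: filterS.
by move=> x /= h Dx; have [] := h Dx.
Qed.

Lemma Rint_supp (D E : set T) (f : T -> R) : (forall x, D x -> ~ E x -> f x = 0) ->
  (forall x, E x -> ~ D x -> f x = 0) ->
  \int[mu]_(x in D) f x = \int[mu]_(x in E) f x.
Proof.
move=> h1 h2; rewrite Rintegral_mkcond [RHS]Rintegral_mkcond; congr Rintegral.
apply/funext => x; rewrite !patchE.
have [xD|xD] := boolP (x \in D); have [xE|xE] := boolP (x \in E) => //.
  by apply: h1; [move/set_mem : xD|rewrite notin_setE in xE].
by apply/esym/h2; [move/set_mem : xE|rewrite notin_setE in xD].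
Qed.

Lemma Rint_subset_le (D E : set T) (f : T -> R) : measurable D -> measurable E ->
  D `<=` E -> L1 mu E f -> (forall x, E x -> 0 <= f x) ->
  \int[mu]_(x in D) f x <= \int[mu]_(x in E) f x.
Proof.
move=> mD mE DE fE f0; rewrite -lee_fin -!L1_fin_num//; last exact: (L1S _ _ _ fE).
apply: ge0_subset_integral => //; first exact: (measurable_int _ fE).
Qed.

Lemma ae_le_Rint D f g : measurable D -> L1 mu D f -> L1 mu D g ->
  {ae mu, forall x, D x -> f x <= g x} ->
  \int[mu]_(x in D) f x <= \int[mu]_(x in D) g x.
Proof.
move=> mD fi gi fg; rewrite -subr_ge0 -RintegralB//.
have iB := L1B mD gi fi.
rewrite (ae_eq_Rint mD (L1_measurable iB) (L1_measurable (L1_norm mD iB))).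
  exact: Rintegral_ge0.
by apply: filterS fg => x h Dx; rewrite ger0_norm// subr_ge0 h.
Qed.

Lemma Rint_dominated D (f_ : nat -> T -> R) f g : measurable D ->
  (forall n, measurable_fun D (f_ n)) -> measurable_fun D f ->
  {ae mu, forall x, D x -> f_ n x @[n --> \oo] --> f x} ->
  L1 mu D g -> {ae mu, forall x n, D x -> `|f_ n x| <= g x} ->
  \int[mu]_(x in D) f_ n x @[n --> \oo] --> \int[mu]_(x in D) f x.
Proof.
move=> mD mf_ mf hf hg fg.
have [hfi _ cI] : [/\ mu.-integrable D (EFin \o f),
    [sequence (\int[mu]_(x in D) `|(f_ n x)%:E - (f x)%:E|)%E]_n @ \oo --> 0%E &
    [sequence (\int[mu]_(x in D) (f_ n x)%:E)%E]_n @ \oo -->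
      (\int[mu]_(x in D) (f x)%:E)%E].
  apply: (@dominated_convergence _ _ _ mu D mD (fun n => EFin \o f_ n)
     (EFin \o f) _ _ _ _ hg).
  - by move=> n; exact/measurable_EFinP.
  - exact/measurable_EFinP.
  - apply: filterS hf.
    by move=> x h Dx; apply/fine_cvgP; split; [exact: nearW|exact: h].
  - by apply: filterS fg => x h n Dx; rewrite lee_fin; exact: h.
by apply: fine_cvg; rewrite -L1_fin_num.
Qed.
End L1_theory.

Lemma ae_forall_count d (T : measurableType d) (R : realType) (mu : {measure set T -> \bar R})
    (I : countType) (P : I -> T -> Prop) :
  (forall i, {ae mu, forall x, P i x}) -> {ae mu, forall x, forall i, P i x}.
Proof.
move=> h.
have : {ae mu, forall x, forall n, if unpickle n is Some i then P i x else True}.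
  by apply: ae_foralln => n; case: unpickle => [i|]; [exact: h|exact: aeW].
apply: filterS => x hx i; have := hx (pickle i); by rewrite pickleK.
Qed.

#[global] Instance leb_ae_filter (R : realType) :
  Filter (nbhs (almost_everywhere (leb R))) := ae_filter_ringOfSetsType (leb R).

(** * Absolutely continuous functions on a segment *)

(** A continuous induction: for fixed [e], the supremum of the points [t] with D t - D a <= e (m t -
    m a) must be [b]. The local bound is asked on intervals around [x] because the points already
    reached lie to the left of the supremum. Letting [e] tend to 0 removes the control function
    [m]. *)
Lemma local_to_global (R : realType) (a b : R) (D m : R -> R) : a <= b ->
  (forall e, 0 < e -> forall x, a <= x -> x <= b -> exists2 r, 0 < r &
    forall z y, a <= z -> z <= x -> x <= y -> y <= b -> y - z < r ->
    D y - D z <= e * (m y - m z)) ->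
  D b <= D a.
Proof.
move=> ab loc.
have key e : 0 < e -> D b - D a <= e * (m b - m a).
  move=> e0; pose S := [set t | [/\ a <= t, t <= b & D t - D a <= e * (m t - m a)]].
  have Sa : S a by split; rewrite ?lexx// !subrr mulr0.
  have ubS : ubound S b by move=> t [].
  have hS : has_sup S by split; [exists a|exists b].
  have ac : a <= sup S by apply: ub_le_sup => //; exists b.
  have cb : sup S <= b by apply: ge_sup => //; exists a.
  have [r r0 hr] := loc e e0 _ ac cb.
  have r20 : 0 < r / 2 by lra.
  have [t [at_ tb ht] ct] := sup_adherent r20 hS.
  have tc : t <= sup S by apply: ub_le_sup; [exists b|split].
  (* The interval from [t] to [y] contains the supremum and is shorter than r/2 + r/3 < r. So [y] is
     reached as well, which is only possible if [y = b]. *)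
  pose y := Num.min b (sup S + r / 3).
  have cy : sup S <= y by rewrite le_min cb/=; lra.
  have yr : y <= sup S + r / 3 by rewrite ge_min lexx orbT.
  have yb : y <= b by rewrite ge_min lexx.
  have hy := hr t y at_ tc cy yb _.
  have {}hy : D y - D t <= e * (m y - m t) by apply: hy; lra.
  have Sy : S y by split => //; [lra|lra].
  have yc : y <= sup S by apply: ub_le_sup => //; exists b.
  have yE : y = b.
    rewrite /y; apply/min_idPl; rewrite leNgt; apply/negP => h.
    have : y = sup S + r / 3 by rewrite /y; apply/min_idPr/ltW.
    by move=> yE; move: yc; rewrite yE; lra.
  by move: Sy => []; rewrite yE.
rewrite leNgt; apply/negP => Dab.
have K0 : 0 < `|m b - m a| + 1 by rewrite ltr_wpDl.
have e0 : 0 < (D b - D a) / 2 / (`|m b - m a| + 1).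
  by rewrite divr_gt0// divr_gt0// subr_gt0.
have := key _ e0; apply/negP; rewrite -ltNge.
apply: (@le_lt_trans _ _ ((D b - D a) / 2 / (`|m b - m a| + 1) * (`|m b - m a| + 1))).
  rewrite ler_wpM2l ?(ltW e0)// (le_trans (ler_norm _))//; lra.
rewrite divfK ?gt_eqF//; lra.
Qed.

(** Absolute continuity in the form of the fundamental theorem of calculus, with an explicit density
    [k]. The identity holds at every point of the segment, so [W] can serve as the continuous
    representative of a function known only almost everywhere. *)
Definition AC (R : realType) (a b : R) (W k : R -> R) : Prop :=
  L1 (leb R) `[a, b] k /\
  forall x, a <= x -> x <= b -> W x = W a + \int[leb R]_(t in `[a, x]) k t.

Lemma subset_cc (R : realType) (a b c d : R) : c <= a -> b <= d ->
  `[a, b] `<=` (`[c, d] : set R).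
Proof. by move=> ca bd; apply: subset_itv; rewrite bnd_simp. Qed.

Section AC_theory.
Context (R : realType).
Notation mu := (leb R).

Lemma Rint_cc_split (a b c : R) (k : R -> R) : a <= c -> c <= b ->
  L1 mu `[a, b] k ->
  \int[mu]_(t in `[a, b]) k t =
  \int[mu]_(t in `[a, c]) k t + \int[mu]_(t in `[c, b]) k t.
Proof.
move=> ac cb ik; apply/eqP; rewrite addrC -subr_eq; apply/eqP.
rewrite (@Rintegral_itvB _ _ _ _ c ik) ?bnd_simp//.
rewrite Rintegral_itv_obnd_cbnd//.
by apply: (L1S _ _ _ ik) => //; apply: subset_itvr; rewrite bnd_simp.
Qed.

Lemma AC_sub (a b : R) (W k : R -> R) z y : AC a b W k ->
  a <= z -> z <= y -> y <= b -> W y - W z = \int[mu]_(t in `[z, y]) k t.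
Proof.
move=> [ik hW] az zy yb; rewrite (hW y) ?(hW z)//; try lra.
rewrite (@Rint_cc_split a y z k)//; first by lra.
by apply: (L1S _ _ _ ik) => //; apply: subset_cc.
Qed.

Lemma AC_within (a b : R) (W k : R -> R) : a <= b -> AC a b W k ->
  {within `[a, b], continuous W}.
Proof.
move=> ab [ik hW].
have := parameterized_integral_continuous ab ik => h.
apply: (@subspace_eq_continuous _ _ _ (fun x => W a + \int[mu]_(t in `[a, x]) k t)).
  by move=> x; rewrite inE => /itvP xab; rewrite [RHS]hW ?xab.
by move=> x; apply: cvgD; [exact: cvg_cst|exact: h].
Qed.

Lemma AC_cont (a b : R) (W k : R -> R) x e : a <= b -> AC a b W k ->
  a <= x -> x <= b -> 0 < e -> exists2 r, 0 < r &
  forall y, a <= y -> y <= b -> `|y - x| < r -> `|W y - W x| < e.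
Proof.
move=> ab hAC ax xb e0; have := AC_within ab hAC.
rewrite subspace_continuousP => /(_ x).
rewrite /= in_itv/= ax xb => /(_ isT) /cvgrPdist_lt /(_ _ e0).
move=> /nbhs_ballP [r/= r0 hr].
exists r => // y ay yb yr; rewrite distrC; apply: (hr y) => /=.
  by rewrite /ball/= distrC.
by rewrite in_itv/= ay yb.
Qed.

Lemma AC_bounded (a b : R) (W k g : R -> R) : a <= b -> AC a b W k ->
  continuous g -> exists K, forall x, a <= x -> x <= b -> `|g (W x)| <= K.
Proof.
move=> ab hAC cg.
have hc : {within `[a, b], continuous (fun x => `|g (W x)|)}.
  move=> x; apply: (@continuous_comp _ _ _ (W : subspace `[a, b] -> R) (fun y => `|g y|)).
    exact: (AC_within ab hAC).
  by apply: continuous_comp; [exact: cg|exact: norm_continuous].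
have [c _ hm] := EVT_max ab hc.
by exists (`|g (W c)|) => x ax xb; apply: hm; rewrite in_itv/= ax.
Qed.

Lemma AC_measurable (a b : R) (W k g : R -> R) : a <= b -> AC a b W k ->
  continuous g -> measurable_fun `[a, b] (fun x => g (W x)).
Proof.
move=> ab hAC cg; apply: (@measurableT_comp _ _ _ _ _ _ g).
  exact: continuous_measurable_fun.
by apply: subspace_continuous_measurable_fun => //; exact: (AC_within ab hAC).
Qed.

Lemma MVT_between (f df : R -> R) (u v : R) :
  (forall y : R, is_derive y 1 f (df y)) ->
  exists2 c, Num.min u v <= c <= Num.max u v & f v - f u = df c * (v - u).
Proof.
move=> hf.
have cf w w' : {within `[w, w'], continuous f}.
  by apply: continuous_subspaceT => x; exact: is_derive_continuous (hf x).
have [uv|vu] := leP u v.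
  have [c] := MVT_segment uv (fun x _ => hf x) (cf _ _).
  by rewrite in_itv/= => hc ->; exists c.
have [c] := MVT_segment (ltW vu) (fun x _ => hf x) (cf _ _).
by rewrite in_itv/= => hc h; exists c => //; rewrite -opprB h -mulrN opprB.
Qed.

(** By the mean value theorem an increment of phi(W) is dphi(xi) times the integral of [k], and on a
    short interval dphi(xi) and dphi(W t) differ by less than [e]. [local_to_global], controlled by
    the integral of |k|, is applied to the difference of the two sides and to its opposite. *)
Lemma AC_comp (a b : R) (W k phi dphi : R -> R) : a <= b -> AC a b W k ->
  (forall y : R, is_derive y 1 phi (dphi y)) -> continuous dphi ->
  AC a b (fun x => phi (W x)) (fun x => dphi (W x) * k x).
Proof.
move=> ab hAC hphi cdphi.
have [K hK] := AC_bounded ab hAC cdphi.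
have mphi := AC_measurable ab hAC cdphi.
have ik := hAC.1.
have iD : L1 mu `[a, b] (fun x => dphi (W x) * k x).
  rewrite (_ : (fun _ => _) = fun x => k x * dphi (W x)).
    by apply: (L1M (K := K)) => // x /=; rewrite in_itv/= => /andP[*]; exact: hK.
  by apply/funext => x; rewrite mulrC.
split => // x ax xb.
have loc s : s = 1 \/ s = -1 -> forall e, 0 < e -> forall w, a <= w -> w <= x -> exists2 r, 0 < r &
    forall z y, a <= z -> z <= w -> w <= y -> y <= x -> y - z < r ->
    s * (phi (W y) - \int[mu]_(t in `[a, y]) (dphi (W t) * k t)) -
    s * (phi (W z) - \int[mu]_(t in `[a, z]) (dphi (W t) * k t)) <=
    e * (\int[mu]_(t in `[a, y]) `|k t| - \int[mu]_(t in `[a, z]) `|k t|).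
  move=> hs e e0 w aw wx; have wb : w <= b by lra.
  have e20 : 0 < e / 2 by lra.
  have /cvgrPdist_lt/(_ _ e20)/nbhs_ballP[r1 /= r10 hr1] := cdphi (W w).
  have [r r0 hr] := AC_cont ab hAC aw wb r10.
  exists r => // z y az zw wy yx yzr.
  have yb : y <= b by lra.
  have zy : z <= y by lra.
  have szy : `[z, y] `<=` (`[a, b] : set R) by exact: subset_cc.
  have ikzy : L1 mu `[z, y] k by apply: (L1S _ _ _ ik).
  have inkzy : L1 mu `[z, y] (fun t => `|k t|) by exact: L1_norm.
  have iDzy : L1 mu `[z, y] (fun x => dphi (W x) * k x) by apply: (L1S _ _ _ iD).
  have iay : L1 mu `[a, y] (fun x => dphi (W x) * k x).
    by apply: (L1S _ _ _ iD) => //; apply: subset_cc.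
  have inay : L1 mu `[a, y] (fun x => `|k x|).
    by apply: L1_norm => //; apply: (L1S _ _ _ ik) => //; apply: subset_cc.
  rewrite (Rint_cc_split az zy inay) [X in _ <= _ * X]addrAC subrr add0r.
  rewrite (Rint_cc_split az zy iay).
  have [xi hxi hE] := MVT_between (W z) (W y) hphi.
  rewrite -mulrBr opprB addrA [X in s * (X - _)]addrAC -!addrA.
  rewrite (_ : _ + _ = phi (W y) - phi (W z) - \int[mu]_(t in `[z, y]) (dphi (W t) * k t)); last by ring.
  rewrite hE (AC_sub hAC az zy yb) -RintegralZl// -RintegralB//; last exact: L1Z.
  apply: (@le_trans _ _ `|\int[mu]_(t in `[z, y]) (dphi xi * k t - dphi (W t) * k t)|).
    by case: hs => ->; rewrite ?mul1r ?mulN1r; [exact: ler_norm|rewrite -normrN; exact: ler_norm].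
  apply: (le_trans (le_normr_Rintegral _ _)) => //; first by apply: L1B => //; exact: L1Z.
  rewrite -RintegralZl//; apply: le_Rintegral => //.
  - by apply: L1_norm => //; apply: L1B => //; exact: L1Z.
  - exact: L1Z.
  move=> t /=; rewrite in_itv/= => /andP[zt ty].
  rewrite -mulrBl normrM ler_wpM2r//.
  have hW u : z <= u -> u <= y -> `|W u - W w| < r1.
    by move=> zu uy; apply: hr; rewrite ?ltr_norml; lra.
  have h1 : `|dphi (W w) - dphi (W t)| < e / 2.
    by apply: hr1; rewrite /ball/= distrC hW.
  have h2 : `|dphi (W w) - dphi xi| < e / 2.
    apply: hr1; rewrite /ball/= distrC ltr_norml.
    have := hW z (lexx _) zy; have := hW y zy (lexx _); rewrite !ltr_norml.
    move: hxi; rewrite ge_min le_max => /andP[/orP[] + /orP[]]; lra.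
  move: h1 h2; rewrite !ltr_norml ler_norml; lra.
have h1 := local_to_global ax (loc 1 (or_introl erefl)).
have h2 := local_to_global ax (loc (-1) (or_intror erefl)).
move: h1 h2; rewrite !mul1r !mulN1r set_itv1 Rintegral_set1.
lra.
Qed.
End AC_theory.

(** * Product rule, integration by parts, and functions with vanishing integrals *)

Section AC_algebra.
Context (R : realType).
Notation mu := (leb R).

Lemma leb_cc (a b : R) : a <= b -> mu `[a, b] = (b - a)%:E.
Proof.
move=> ab; apply: (etrans (lebesgue_measure_itv `[a, b])); rewrite /= lte_fin.
by move: ab; rewrite le_eqVlt => /predU1P[->|->//]; rewrite ltxx subrr.
Qed.

Lemma leb_cc_fin (a b : R) : (mu `[a, b] < +oo)%E.
Proof.
have [ab|ba] := leP a b; first by rewrite leb_cc// ltry.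
by rewrite set_itv_ge ?measure0// bnd_simp -ltNge.
Qed.

Lemma Rint_cst_cc (a b r : R) : a <= b -> \int[mu]_(_ in `[a, b]) r = r * (b - a).
Proof.
move=> ab; rewrite Rintegral_cst//; congr (_ * _).
exact: (congr1 fine (leb_cc ab)).
Qed.

Lemma eq_AC (a b : R) (W k W' k' : R -> R) : W =1 W' -> k =1 k' ->
  AC a b W k -> AC a b W' k'.
Proof. by move=> /funext -> /funext ->. Qed.

Lemma ACD (a b : R) (W k W' k' : R -> R) : AC a b W k -> AC a b W' k' ->
  AC a b (fun x => W x + W' x) (fun x => k x + k' x).
Proof.
move=> [ik h] [ik' h']; split; first exact: L1D.
move=> x ax xb; rewrite h// h'// RintegralD//; first lra.
  by apply: (L1S _ _ _ ik) => //; apply: subset_cc.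
by apply: (L1S _ _ _ ik') => //; apply: subset_cc.
Qed.

Lemma ACZ (a b r : R) (W k : R -> R) : AC a b W k ->
  AC a b (fun x => r * W x) (fun x => r * k x).
Proof.
move=> [ik h]; split; first exact: L1Z.
move=> x ax xb; rewrite h// RintegralZl//; first lra.
by apply: (L1S _ _ _ ik) => //; apply: subset_cc.
Qed.

(** Polarization: W W' = ((W + W')^2 - W^2 - W'^2) / 2, and squares are covered by the chain
    rule. *)
Lemma ACM (a b : R) (W k W' k' : R -> R) : a <= b -> AC a b W k -> AC a b W' k' ->
  AC a b (fun x => W x * W' x) (fun x => W x * k' x + k x * W' x).
Proof.
move=> ab h h'.
have sq V l : AC a b V l -> AC a b (fun x => V x ^+ 2) (fun x => 2 * V x * l x).
  move=> hV; apply: (@AC_comp _ a b V l (fun y => y ^+ 2) (fun y => 2 * y)) => //.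
    move=> y; have := is_deriveX 2 (is_derive_id y (1 : R)).
    by rewrite expr1 /GRing.scale/= mulr1.
  by move=> y; apply: cvgM; [exact: cvg_cst|exact: cvg_id].
have := ACD (ACZ (2^-1) (sq _ _ (ACD h h'))) (ACZ (- 2^-1) (ACD (sq _ _ h) (sq _ _ h'))).
by apply: eq_AC => x; field.
Qed.

Lemma AC_id (a b : R) : AC a b id (fun=> 1).
Proof.
split; first by apply: L1_cst => //; exact: leb_cc_fin.
move=> x ax xb; by rewrite Rint_cst_cc// mul1r addrC subrK.
Qed.

Lemma AC_smooth (a b : R) (phi dphi : R -> R) : a <= b ->
  (forall y : R, is_derive y 1 phi (dphi y)) -> continuous dphi -> AC a b phi dphi.
Proof.
move=> ab h c; have := AC_comp ab (AC_id a b) h c.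
by apply: eq_AC => // x; rewrite mulr1.
Qed.

Lemma AC_ibp (a b : R) (W k W' k' : R -> R) : a <= b -> AC a b W k -> AC a b W' k' ->
  \int[mu]_(x in `[a, b]) (W x * k' x) =
  W b * W' b - W a * W' a - \int[mu]_(x in `[a, b]) (k x * W' x).
Proof.
move=> ab h h'.
have [i e] := ACM ab h h'.
have -> : W b * W' b - W a * W' a = \int[mu]_(t in `[a, b]) (W t * k' t + k t * W' t).
  by rewrite (e b ab (lexx b)) addrAC subrr add0r.
rewrite -RintegralB//.
  by apply: eq_Rintegral => x _; rewrite addrK.
rewrite (_ : EFin \o _ = EFin \o fun x => W' x * k x); last first.
  by apply/funext => x /=; rewrite mulrC.
have [K hK] := AC_bounded ab h' (fun x => cvg_id : {for x, continuous id}).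
have := @L1M _ _ _ mu `[a, b] K k W' (measurable_itv _) h.1 (AC_measurable ab h' (fun x => cvg_id)).
rewrite /L1 => hh; rewrite (_ : EFin \o _ = EFin \o fun x => k x * W' x); last first.
  by apply/funext => x /=; rewrite mulrC.
by apply: hh => x /=; rewrite in_itv/= => /andP[*]; exact: hK.
Qed.

Lemma ae_neq (a : R) : {ae mu, forall x, x != a}.
Proof.
exists [set a]; split => //; first exact: lebesgue_measure_set1.
by move=> x /= /negP; rewrite negbK => /eqP.
Qed.

(** The primitive of [f] takes a single value at the rationals of ]a, b[, hence is constant there by
    continuity, and Lebesgue differentiation recovers [f] almost everywhere. Rational endpoints keep
    the family of conditions countable. *)
Lemma fund_rat (a b : R) (f : R -> R) : a < b -> L1 mu `[a, b] f ->
  (forall c d : rat, a < ratr c -> ratr c < ratr d :> R -> ratr d < b ->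
    \int[mu]_(x in `[ratr c, ratr d]) f x = 0) ->
  {ae mu, forall x, `[a, b]%classic x -> f x = 0}.
Proof.
move=> ab fi f0; pose G x := \int[mu]_(t in `[a, x]) f t.
have hAC : AC a b G f.
  by split => // x ax xb; rewrite {2}/G set_itv1 Rintegral_set1 add0r.
have [q0] := rat_in_itvoo ab; rewrite in_itv/= => /andP[aq0 q0b].
have Gq q : a < ratr q -> ratr q < b -> G (ratr q) = G (ratr q0).
  move=> aq qb; have [qq|qq|->//] := ltgtP (ratr q : R) (ratr q0).
    by apply/esym/eqP; rewrite -subr_eq0 (AC_sub hAC) ?f0//; exact: ltW.
  by apply/eqP; rewrite -subr_eq0 (AC_sub hAC) ?f0//; exact: ltW.
have Gc x : a < x -> x < b -> G x = G (ratr q0).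
  move=> ax xb; apply/eqP; rewrite -subr_eq0; apply/negPn/negP; rewrite -normr_gt0 => e0.
  have [r r0 hr] := AC_cont (ltW ab) hAC (ltW ax) (ltW xb) e0.
  have m : x < Num.min (x + r) b by rewrite lt_min xb andbT ltrDl.
  have [q] := rat_in_itvoo m; rewrite in_itv/= lt_min => /and3P[xq qr qb].
  have := hr (ratr q) (ltW (lt_trans ax xq)) (ltW qb).
  rewrite Gq//; last exact: lt_trans xq.
  rewrite (distrC (G (ratr q0))) ltxx => /(_ _)/negP; apply => //; rewrite gtr0_norm; lra.
pose h := f \_ `[a, b].
have hi : L1 mu [set: R] h.
  by rewrite /L1 -restrict_EFin; apply/(integrable_mkcond _ _).1.
have hl : locally_integrable [set: R] h by apply: open_integrable_locally => //; exact: openT.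
have := @FTC1 R h (BLeft a) _ hl.
have hiy y : mu.-integrable [set` Interval (BLeft a) (BRight y)] (EFin \o h) by apply: (L1S _ _ _ hi).
move=> /(_ hiy)/=.
apply: filterS3 (ae_neq a) (ae_neq b) => x xa xb_.
move=> + /=; rewrite in_itv/= => + /andP[ax xb].
have ax' : a < x by rewrite lt_neqAle ax andbT eq_sym.
have xb' : x < b by rewrite lt_neqAle xb andbT.
rewrite lte_fin ax' => /(_ isT)[_].
rewrite derive1E (_ : h x = f x); last by rewrite /h patchE mem_set//= in_itv/= ax xb.
move=> <-.
rewrite (@near_eq_derive _ _ _ _ (cst (G (ratr q0)))) ?derive_cst//.
near=> y.
have yab : `]a, b[%classic y.
  near: y; apply: open_nbhs_nbhs; split; first exact: interval_open.
  by rewrite /= in_itv/= ax'.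
move: yab; rewrite /= in_itv/= => /andP[ay yb].
rewrite -(Gc y)//; apply: eq_Rintegral => t; rewrite inE/= in_itv/= => /andP[at_ ty].
by rewrite /h patchE mem_set//= in_itv/= at_ (le_trans ty (ltW yb)).
Unshelve. all: by end_near. Qed.
End AC_algebra.

(** * The du Bois-Reymond lemma *)

Section dubois_reymond.
Context (R : realType).
Notation mu := (leb R).

Lemma continuous_L1 (a b : R) (f : R -> R) : continuous f -> L1 mu `[a, b] f.
Proof.
move=> cf; apply: continuous_compact_integrable; first exact: segment_compact.
exact: continuous_subspaceT.
Qed.

Lemma bump_continuous n (c d : R) : continuous (bump n c d).
Proof. exact: (Dk_continuous (Dk_bump 0 n c d)). Qed.

Lemma L1_bump (a b : R) n c d (f : R -> R) : L1 mu `[a, b] f ->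
  L1 mu `[a, b] (fun x => f x * bump n c d x).
Proof.
move=> hf; apply: (L1M (K := 1)) => //.
  apply: measurable_funTS. apply: continuous_measurable_fun. exact: bump_continuous.
by move=> x _; have /andP[? ?] := bump_itv n c d x; rewrite ger0_norm.
Qed.

(** The bumps tend to the indicator of ]c, d[ and stay below 1, so dominated convergence reduces the
    claim to [fund_rat]. *)
Lemma fund_bump (a b : R) (f : R -> R) : a < b -> L1 mu `[a, b] f ->
  (forall n (c d : rat), a < ratr c -> ratr c < ratr d :> R -> ratr d < b ->
    \int[mu]_(x in `[a, b]) (f x * bump n (ratr c) (ratr d) x) = 0) ->
  {ae mu, forall x, `[a, b]%classic x -> f x = 0}.
Proof.
move=> ab fi f0; apply: fund_rat => // c d ac cd db.
have mf := L1_measurable fi.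
have : \int[mu]_(x in `[a, b]) (f x * bump n (ratr c) (ratr d) x) @[n --> \oo] -->
     \int[mu]_(x in `[a, b]) (f x * \1_(`]ratr c, ratr d[) x).
  apply: (@Rint_dominated _ _ R mu `[a, b] (fun n x => f x * bump n (ratr c) (ratr d) x) _
    (fun x => `|f x|)) => //.
  - by move=> n; exact: L1_measurable (L1_bump _ _ _ fi).
  - by apply: measurable_funM => //; exact: measurable_indic.
  - by apply: aeW => x _; apply: cvgM; [exact: cvg_cst|exact: cvg_bump].
  - exact: L1_norm.
  - apply: aeW => x n _; rewrite normrM ler_piMr//.
    by have /andP[? ?] := bump_itv n (ratr c) (ratr d) x; rewrite ger0_norm.
under eq_fun do rewrite f0//.
move=> /(cvg_lim (@Rhausdorff R)); rewrite lim_cst; last exact: Rhausdorff.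
rewrite (@Rint_supp _ _ R mu `[a, b] `]ratr c, ratr d[); last 2 first.
- by move=> x _ /= h; rewrite indicE memNset// mulr0.
- move=> x /=; rewrite !in_itv/= => /andP[? ?] []; apply/andP; split; lra.
move=> ->; rewrite [LHS](_ : _ = \int[mu]_(x in `]ratr c, ratr d[) f x); last first.
  have i1 : L1 mu `[ratr c, ratr d] f.
    by apply: (L1S _ _ _ fi) => //; apply: subset_cc; lra.
  rewrite -Rintegral_itv_obnd_cbnd; last first.
    by apply: (L1S _ _ _ i1) => //; apply: subset_itvr; rewrite bnd_simp.
  rewrite -Rintegral_itv_bndo_bndc//.
  by apply: (L1S _ _ _ i1) => //; apply: subset_itv; rewrite bnd_simp.
by apply: eq_Rintegral => x xcd; rewrite indicE xcd mulr1.
Qed.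

(** The zero mean brings the primitive back to 0 to the right of [be]. *)
Lemma primitive_supp (al be : R) (g : R -> R) : al <= be ->
  (forall k, Dk k g) -> (forall x, x \notin `[al, be] -> g x = 0) ->
  \int[mu]_(x in `[al, be]) g x = 0 ->
  (forall x : R, is_derive x 1 (fun x => \int[mu]_(t in `]-oo, x]) g t) (g x)) /\
  bump_supp al be (fun x => \int[mu]_(t in `]-oo, x]) g t).
Proof.
move=> albe sg zg Ig.
have cg : continuous g by exact: (Dk_continuous (sg 0)).
have ig : L1 mu [set: R] g.
  rewrite /L1 (_ : g = g \_ `[al, be]).
    by rewrite -restrict_EFin; apply/(integrable_mkcond _ _).1 => //; exact: continuous_L1.
  apply/funext => x; rewrite patchE; case: ifPn => //; rewrite notin_setE => /negP.
  exact: zg.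
have hd (x : R) : is_derive x 1 (fun x => \int[mu]_(t in `]-oo, x]) g t) (g x).
  have x1 : x < x + 1 by rewrite ltrDl.
  have := @continuous_FTC1 R g -oo%O x (x + 1) x1 _ _ (cg x).
  case; [by apply: (L1S _ _ _ ig)|by rewrite ltNyr|].
  by move=> h1; rewrite derive1E => <-; exact: DeriveDef.
split => //; split.
  by case=> [x|k]; [exact: is_derive_continuous (hd x)|exists g].
move=> x; rewrite in_itv/= negb_and -!ltNge => /orP[xa|bx].
  rewrite (@Rint_supp _ _ R mu _ set0) ?Rintegral_set0// => y; rewrite /= in_itv/= => yx _.
  by apply: zg; rewrite in_itv/= negb_and -!ltNge (le_lt_trans yx xa).
rewrite -Ig; apply: Rint_supp => y /=.
  by move=> _ /negP; exact: zg.
by rewrite !in_itv/= => /andP[_ yb] /negP; rewrite -ltNge => /(lt_trans bx); rewrite ltNge yb.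
Qed.

Lemma bump_int_gt0 (c d : R) : c < d -> 0 < \int[mu]_(x in `[c, d]) bump 1 c d x.
Proof.
move=> cd; rewrite ltNge; apply/negP => h.
have h0 x : `[c, d]%classic x -> 0 <= bump 1 c d x.
  by move=> _; have /andP[] := bump_itv 1 c d x.
have i0 : L1 mu `[c, d] (bump 1 c d) by apply: continuous_L1; exact: bump_continuous.
have /(_ _)[|N [mN N0 hN]] := @Rint_eq0_ae _ _ _ mu `[c, d] _ _ i0 h0 h.
  exact: measurable_itv.
have : (mu `]c, d[ <= mu N)%E.
  apply: le_measure; rewrite ?inE// => x /=; rewrite in_itv/= => /andP[cx xd].
  apply: hN => /= hb.
  have : 0 < bump 1 c d x.
    rewrite /bump subr_gt0 -expR0 ltr_expR oppr_lt0.
    by rewrite !mulr_gt0 ?flat_gt0 ?subr_gt0.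
  by rewrite hb ?ltxx// in_itv/= !ltW.
rewrite N0 leNgt => /negP; apply.
rewrite [X in (_ < X)%E](_ : _ = (d - c)%:E) ?lte_fin ?subr_gt0//.
by apply: (etrans (lebesgue_measure_itv `]c, d[)); rewrite /= lte_fin cd.
Qed.

Section test_family.
Variables (c0 d0 : R).

(* Zero mean, so that [dbr_prim] has compact support.  With rational [c], [d] the
   family is countable, hence one null set of times serves all of them when the
   du Bois-Reymond lemma is applied to slices. *)
Definition dbr_test n (c d x : R) : R := bump n c d x -
  (\int[mu]_(x in `[c, d]) bump n c d x) / (\int[mu]_(x in `[c0, d0]) bump 1 c0 d0 x)
  * bump 1 c0 d0 x.

Definition dbr_prim n (c d x : R) : R := \int[mu]_(t in `]-oo, x]) dbr_test n c d t.

Lemma Dk_dbr_test k n c d : Dk k (dbr_test n c d).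
Proof.
pose r := (\int[mu]_(x in `[c, d]) bump n c d x) / (\int[mu]_(x in `[c0, d0]) bump 1 c0 d0 x).
rewrite (_ : dbr_test n c d = fun x => bump n c d x + (- r) * bump 1 c0 d0 x).
  by apply: DkD; [exact: Dk_bump|apply: DkM; [exact: Dk_cst|exact: Dk_bump]].
by apply/funext => x; rewrite /dbr_test mulNr.
Qed.

Lemma Rint_bump (a b c d : R) n : a <= c -> d <= b ->
  \int[mu]_(x in `[a, b]) bump n c d x = \int[mu]_(x in `[c, d]) bump n c d x.
Proof.
move=> ac db; apply: Rint_supp => x /=; rewrite !in_itv/=.
  move=> _ /negP h; apply: bump_out; apply: contra h; rewrite in_itv/=.
  by move=> /andP[/ltW -> /ltW ->].
by move=> /andP[? ?] []; apply/andP; split; lra.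
Qed.

Lemma dbr_primP n (c d : R) : c0 < d0 -> c < d ->
  (forall x : R, is_derive x 1 (dbr_prim n c d) (dbr_test n c d x)) /\
  bump_supp (Num.min c c0) (Num.max d d0) (dbr_prim n c d).
Proof.
move=> cd0 cd; apply: primitive_supp => [|k|x|].
- by rewrite ge_min le_max !(ltW cd).
- exact: Dk_dbr_test.
- rewrite in_itv/= negb_and -!ltNge lt_min gt_max => h.
  have hc : c0 <= d0 by exact: ltW.
  rewrite /dbr_test !bump_out ?mulr0 ?subr0//.
    by rewrite in_itv/=; apply/negP => /andP[h1 h2]; move: h => /orP[|] /andP[]; lra.
  by rewrite in_itv/=; apply/negP => /andP[h1 h2]; move: h => /orP[|] /andP[]; lra.
- rewrite RintegralB//; last 2 first.
  + by apply: continuous_L1; exact: bump_continuous.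
  + by apply: L1Z => //; apply: continuous_L1; exact: bump_continuous.
  rewrite RintegralZl//; last by apply: continuous_L1; exact: bump_continuous.
  rewrite !Rint_bump ?ge_min ?le_max ?lexx ?orbT//.
  by rewrite divfK ?subrr// gt_eqF// bump_int_gt0.
Qed.

(** Let [K] be the primitive of [k]. By integration by parts [h - K] is orthogonal to every
    [dbr_test], that is, to a bump minus a multiple of the reference bump on [c0, d0]. So its
    integral against any bump is [C] times the integral of the bump, with [C] the average of [h - K]
    against the reference bump, and [fund_bump] concludes. *)
Lemma du_bois_reymond (a b : R) (h k : R -> R) : a < c0 -> c0 < d0 -> d0 < b ->
  L1 mu `[a, b] h -> L1 mu `[a, b] k ->
  (forall n (c d : rat), a < ratr c -> ratr c < ratr d :> R -> ratr d < b ->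
    \int[mu]_(x in `[a, b]) (h x * dbr_test n (ratr c) (ratr d) x) =
    - \int[mu]_(x in `[a, b]) (k x * dbr_prim n (ratr c) (ratr d) x)) ->
  exists C, {ae mu, forall x, `[a, b]%classic x -> h x = C + \int[mu]_(t in `[a, x]) k t}.
Proof.
move=> ac0 cd0 d0b ih ik H.
have ab : a <= b by lra.
pose K x := \int[mu]_(t in `[a, x]) k t.
have hK : AC a b K k.
  by split => // x ax xb; rewrite {2}/K set_itv1 Rintegral_set1 add0r.
have iK : L1 mu `[a, b] K.
  apply: continuous_compact_integrable; first exact: segment_compact.
  exact: AC_within hK.
have ihK : L1 mu `[a, b] (fun x => h x - K x) by exact: L1B.
pose J0 := \int[mu]_(x in `[c0, d0]) bump 1 c0 d0 x.
have J00 : J0 != 0 by rewrite gt_eqF// bump_int_gt0.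
pose C := (\int[mu]_(x in `[a, b]) ((h x - K x) * bump 1 c0 d0 x)) / J0.
exists C.
suff : {ae mu, forall x, `[a, b]%classic x -> h x - K x - C = 0}.
  by apply: filterS => x /= hx xab; have := hx xab; rewrite -/(K x); lra.
have iC : L1 mu `[a, b] (fun=> C) by apply: L1_cst => //; exact: leb_cc_fin.
apply: fund_bump; [lra|exact: L1B|].
move=> n c d ac cd db.
set c' : R := ratr c; set d' : R := ratr d.
have [hd [sb zb]] := @dbr_primP n c' d' cd0 cd.
have pz x : x <= a \/ b <= x -> dbr_prim n c' d' x = 0.
  move=> hx; apply: zb; rewrite in_itv/= negb_and -!ltNge lt_min gt_max.
  by apply/orP; case: hx => hx; [left|right]; apply/andP; split; rewrite /c' /d'; lra.
have hp : AC a b (dbr_prim n c' d') (dbr_test n c' d').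
  by apply: AC_smooth => //; exact: (Dk_continuous (Dk_dbr_test 0 n c' d')).
have ct : continuous (dbr_test n c' d') := Dk_continuous (Dk_dbr_test 0 n c' d').
have it f : L1 mu `[a, b] f -> L1 mu `[a, b] (fun x => f x * dbr_test n c' d' x).
  move=> hf; have [M hM] := AC_bounded ab (AC_id a b) ct.
  apply: (L1M (K := M)) => //.
    by apply: measurable_funTS; apply: continuous_measurable_fun.
  by move=> x /=; rewrite in_itv/= => /andP[*]; exact: hM.
have := AC_ibp ab hK hp.
rewrite !pz ?lexx; [|by left|by right].
rewrite !mulr0 subr0 sub0r => hibp.
have H2 : \int[mu]_(x in `[a, b]) ((h x - K x) * dbr_test n c' d' x) = 0.
  under eq_Rintegral do rewrite mulrBl.
  rewrite RintegralB//; [|exact: it|exact: it].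
  by rewrite hibp H// opprK addNr.
have ib m e e' : L1 mu `[a, b] (fun x => (h x - K x) * bump m e e' x) by exact: L1_bump.
have H3 : \int[mu]_(x in `[a, b]) ((h x - K x) * bump n c' d' x) =
  (\int[mu]_(x in `[c', d']) bump n c' d' x) * C.
  set I := (\int[mu]_(x in `[c', d']) _ : R); apply/eqP; rewrite -subr_eq0; apply/eqP.
  rewrite -[RHS]H2.
  have -> : I * C = \int[mu]_(x in `[a, b]) (I / J0 * ((h x - K x) * bump 1 c0 d0 x)).
    by rewrite RintegralZl//; [rewrite /C mulrA mulrAC|exact: ib].
  rewrite -RintegralB//; [|exact: ib|by apply: L1Z => //; exact: ib].
  by apply: eq_Rintegral => x _; rewrite /dbr_test -/I -/J0 [RHS]mulrBr mulrCA.
under eq_Rintegral do rewrite mulrBl.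
rewrite RintegralB//; [|exact: ib|exact: L1_bump].
rewrite H3 RintegralZl//; last by apply: continuous_L1; exact: bump_continuous.
rewrite (@Rint_bump a b) ?(ltW ac) ?(ltW db)//.
by rewrite [C * _]mulrC subrr.
Qed.

End test_family.
End dubois_reymond.

(** * Slices of weak derivatives *)

Section rect_fubini.
Context d1 d2 (T1 : measurableType d1) (T2 : measurableType d2) (R : realType).
Variables (m1 : {sigma_finite_measure set T1 -> \bar R})
  (m2 : {sigma_finite_measure set T2 -> \bar R}).
Local Notation m := (m1 \x m2)%E.
Variables (A : set T1) (B : set T2) (F : T1 * T2 -> R).
Hypotheses (mA : measurable A) (mB : measurable B).

(** Fubini is applied on the whole product to the extension by zero. Returning to real-valued inner
    integrals discards the slices that are not integrable, a null set. The sets stay general because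
    [B] is a segment in some uses and the whole line in others. *)
Let f : T1 * T2 -> \bar R := (EFin \o F) \_ (A `*` B).

Let fE x y : f (x, y) = if x \in A then ((fun y => (F (x, y))%:E) \_ B) y else 0%E.
Proof. by rewrite /f !patchE in_setX/=; case: (x \in A); case: (y \in B). Qed.

Hypothesis iF : L1 m (A `*` B) F.

Let ifT : m.-integrable setT f.
Proof. by apply/(integrable_mkcond _ _).1 => //; exact: measurableX. Qed.

Let f1 x : A x -> (\int[m2]_y f (x, y) = \int[m2]_(y in B) (F (x, y))%:E)%E.
Proof.
move=> Ax; rewrite [RHS]integral_mkcond; apply: eq_integral => y _.
by rewrite fE mem_set.
Qed.

Let f10 x : ~ A x -> (\int[m2]_y f (x, y) = 0)%E.
Proof. by move=> Ax; apply: integral0_eq => y _; rewrite fE memNset. Qed.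

Lemma rect_fubini_slice1 : {ae m1, forall x, A x -> L1 m2 B (fun y => F (x, y))}.
Proof.
have := ae_integrable1 ifT; apply: filterS => x h Ax.
apply/(integrable_mkcond _ mB).2.
by apply: eq_integrable h => // y _; rewrite fE mem_set.
Qed.

Let fineK1 : {ae m1, forall x, A x ->
  (\int[m2]_y f (x, y) = (\int[m2]_(y in B) F (x, y))%:E)%E}.
Proof.
have := rect_fubini_slice1; apply: filterS => x h Ax.
by rewrite f1// L1_fin_num//; exact: h.
Qed.

Let mF1 : measurable_fun A (fun x => \int[m2]_(y in B) F (x, y)).
Proof.
have mF : measurable_fun setT (fun x => fine (\int[m2]_y f (x, y))%E).
  apply: (@measurableT_comp _ _ _ _ _ _ fine) => //.
  exact: (measurable_int _ (integrable_fubini_F ifT)).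
apply: eq_measurable_fun (measurable_funTS mF) => x; rewrite inE => Ax.
by rewrite f1.
Qed.

Lemma rect_fubini_L1 : L1 m1 A (fun x => \int[m2]_(y in B) F (x, y)).
Proof.
have i1 : m1.-integrable A (fun x => \int[m2]_y f (x, y))%E.
  by apply: integrableS (integrable_fubini_F ifT).
apply/integrableP; split; first exact/measurable_EFinP.
move/integrableP : i1 => [mf1]; apply: le_lt_trans.
rewrite le_eqVlt; apply/orP; left; apply/eqP; apply: ae_eq_integral => //.
- by do 2 apply: measurableT_comp => //.
- by apply: measurableT_comp.
- by have := fineK1; apply: filterS => x h Ax; rewrite h.
Qed.

Lemma rect_fubini1 :
  \int[m]_(z in A `*` B) F z = \int[m1]_(x in A) \int[m2]_(y in B) F (x, y).
Proof.
congr fine; rewrite integral_mkcond -(integral12_prod_meas1 ifT) /fubini_F.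
transitivity (\int[m1]_(x in A) \int[m2]_y f (x, y))%E.
  rewrite [RHS]integral_mkcond; apply: eq_integral => x _; rewrite patchE.
  by case: ifPn => //; rewrite notin_setE => /f10.
apply: ae_eq_integral => //.
- by apply: measurable_funTS; exact: (measurable_int _ (integrable_fubini_F ifT)).
- exact/measurable_EFinP.
Qed.
End rect_fubini.

Section rect_fubini_swap.
Context d1 d2 (T1 : measurableType d1) (T2 : measurableType d2) (R : realType).
Variables (m1 : {sigma_finite_measure set T1 -> \bar R})
  (m2 : {sigma_finite_measure set T2 -> \bar R}).
Local Notation m := (m1 \x m2)%E.
Variables (A : set T1) (B : set T2) (F : T1 * T2 -> R).
Hypotheses (mA : measurable A) (mB : measurable B).

Let f : T1 * T2 -> \bar R := (EFin \o F) \_ (A `*` B).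

Let fE x y : f (x, y) = if y \in B then ((fun x => (F (x, y))%:E) \_ A) x else 0%E.
Proof. by rewrite /f !patchE in_setX/=; case: (x \in A); case: (y \in B). Qed.

Hypothesis iF : L1 m (A `*` B) F.

Let ifT : m.-integrable setT f.
Proof. by apply/(integrable_mkcond _ _).1 => //; exact: measurableX. Qed.

Let iG : m2.-integrable setT (fun y => \int[m1]_x f (x, y))%E.
Proof.
have mf := measurable_int _ ifT.
apply/integrableP; split; first exact: (measurable_fubini_G ifT).
apply: le_lt_trans ((integrable21ltyP m1 m2 mf).1 ifT).
apply: ge0_le_integral => //.
- by apply: measurableT_comp => //; exact: (measurable_fubini_G ifT).
- apply: (measurable_fun_fubini_tonelli_G (abse \o f)) => //=.
  exact: measurableT_comp.
- by move=> y _; apply: le_abse_integral => //; exact: measurableT_comp.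
Qed.

Let f1 y : B y -> (\int[m1]_x f (x, y) = \int[m1]_(x in A) (F (x, y))%:E)%E.
Proof.
move=> By; rewrite [RHS]integral_mkcond; apply: eq_integral => x _.
by rewrite fE mem_set.
Qed.

Let f10 y : ~ B y -> (\int[m1]_x f (x, y) = 0)%E.
Proof. by move=> By; apply: integral0_eq => x _; rewrite fE memNset. Qed.

Lemma rect_fubini_slice2 : {ae m2, forall y, B y -> L1 m1 A (fun x => F (x, y))}.
Proof.
have := ae_integrable2 ifT; apply: filterS => y h By.
apply/(integrable_mkcond _ mA).2.
by apply: eq_integrable h => // x _; rewrite fE mem_set.
Qed.

Let fineK1 : {ae m2, forall y, B y ->
  (\int[m1]_x f (x, y) = (\int[m1]_(x in A) F (x, y))%:E)%E}.
Proof.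
have := rect_fubini_slice2; apply: filterS => y h By.
by rewrite f1// L1_fin_num//; exact: h.
Qed.

Let mF1 : measurable_fun B (fun y => \int[m1]_(x in A) F (x, y)).
Proof.
have mF : measurable_fun setT (fun y => fine (\int[m1]_x f (x, y))%E).
  apply: (@measurableT_comp _ _ _ _ _ _ fine) => //.
  exact: (measurable_fubini_G ifT).
apply: eq_measurable_fun (measurable_funTS mF) => y; rewrite inE => By.
by rewrite f1.
Qed.

Lemma rect_fubini_L2 : L1 m2 B (fun y => \int[m1]_(x in A) F (x, y)).
Proof.
have i1 : m2.-integrable B (fun y => \int[m1]_x f (x, y))%E.
  by apply: integrableS (iG).
apply/integrableP; split; first exact/measurable_EFinP.
move/integrableP : i1 => [mf1]; apply: le_lt_trans.
rewrite le_eqVlt; apply/orP; left; apply/eqP; apply: ae_eq_integral => //.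
- by do 2 apply: measurableT_comp => //.
- by apply: measurableT_comp.
- by have := fineK1; apply: filterS => x h Ax; rewrite h.
Qed.

Lemma rect_fubini2 :
  \int[m]_(z in A `*` B) F z = \int[m2]_(y in B) \int[m1]_(x in A) F (x, y).
Proof.
congr fine; rewrite integral_mkcond -(integral21_prod_meas1 ifT) /fubini_G.
transitivity (\int[m2]_(y in B) \int[m1]_x f (x, y))%E.
  rewrite [RHS]integral_mkcond; apply: eq_integral => x _; rewrite patchE.
  by case: ifPn => //; rewrite notin_setE => /f10.
apply: ae_eq_integral => //.
- by apply: measurable_funTS; exact: (measurable_fubini_G ifT).
- exact/measurable_EFinP.
Qed.
End rect_fubini_swap.

Section rect.
Context (R : realType).
Notation mu := (leb R).
Notation mu2 := (leb2 R).

Definition rect (a b c d : R) : set (measurableTypeR R * measurableTypeR R) :=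
  `[a, b] `*` `[c, d].

Lemma measurable_rect a b c d : measurable (rect a b c d).
Proof. exact: measurableX. Qed.

Lemma rect_fin a b c d : (mu2 (rect a b c d) < +oo)%E.
Proof.
have -> : mu2 (rect a b c d) = (mu `[a, b] * mu `[c, d])%E by exact: product_measure1E.
by rewrite lte_mul_pinfty ?measure_ge0// ?leb_cc_fin// ge0_fin_numE ?leb_cc_fin.
Qed.

Section leb2_fubini.
Variables (F : measurableTypeR R * measurableTypeR R -> R) (a b c d : R).
Hypothesis iF : L1 mu2 (rect a b c d) F.

Lemma leb2_slice1 : {ae mu, forall t, `[a, b]%classic t -> L1 mu `[c, d] (fun x => F (t, x))}.
Proof. exact: rect_fubini_slice1 iF. Qed.

Lemma leb2_slice2 : {ae mu, forall x, `[c, d]%classic x -> L1 mu `[a, b] (fun t => F (t, x))}.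
Proof. exact: rect_fubini_slice2 iF. Qed.

Lemma leb2_L1 : L1 mu `[a, b] (fun t => \int[mu]_(x in `[c, d]) F (t, x)).
Proof. exact: rect_fubini_L1 iF. Qed.

Lemma leb2_L2 : L1 mu `[c, d] (fun x => \int[mu]_(t in `[a, b]) F (t, x)).
Proof. exact: rect_fubini_L2 iF. Qed.

Lemma leb2_fubini1 : \int[mu2]_(z in rect a b c d) F z =
  \int[mu]_(t in `[a, b]) \int[mu]_(x in `[c, d]) F (t, x).
Proof. exact: rect_fubini1 iF. Qed.

Lemma leb2_fubini2 : \int[mu2]_(z in rect a b c d) F z =
  \int[mu]_(x in `[c, d]) \int[mu]_(t in `[a, b]) F (t, x).
Proof. exact: rect_fubini2 iF. Qed.
End leb2_fubini.

Lemma locally_integrable2_rect (h : R -> R -> R) (al be c d : R) : 0 < al ->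
  locally_integrable2 (@half_plane R) h -> L1 mu2 (rect al be c d) (fun z => h z.1 z.2).
Proof.
move=> al0 [mh _ hK].
have sub : rect al be c d `<=` (@half_plane R).
  by move=> z [/= + _]; rewrite in_itv/= => /andP[/(lt_le_trans al0)].
apply/integrableP; split; last first.
  by apply: (hK _ sub); apply: compact_setX; exact: segment_compact.
apply/measurable_EFinP; apply: measurable_funS mh => //.
have -> : @half_plane R = `]0, +oo[ `*` setT.
  by apply/seteqP; split => z; rewrite /half_plane/= in_itv/= andbT; tauto.
exact: measurableX.
Qed.

Definition tst (a b : R) (phi dphi : R -> R) :=
  [/\ bump_supp a b phi, forall x : R, is_derive x 1 phi (dphi x), continuous dphi &
      forall x, x \notin `[a, b] -> dphi x = 0].

Lemma bump_supp_tst (a b : R) phi : bump_supp a b phi -> exists dphi, tst a b phi dphi.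
Proof.
move=> [sp zp]; have [dphi hd cd] := sp 1%N.
exists dphi; split => // x xab.
rewrite -(@derive_val _ _ _ _ _ _ _ (hd x)).
rewrite (@near_eq_derive _ _ _ _ (cst 0)) ?derive_cst//.
have oA : open (~` `[a, b] : set R) by apply: closed_openC; exact: itv_closed.
have : nbhs x (~` `[a, b] : set R).
  by apply: open_nbhs_nbhs; split => //; apply/negP.
by apply: filterS => y /= /negP /zp.
Qed.

Lemma tst_bump n (c d : R) : exists dphi, tst c d (bump n c d) dphi.
Proof.
apply: bump_supp_tst; split; first by move=> k; exact: Dk_bump.
move=> x h; apply: bump_out; apply: contra h; rewrite !in_itv/=.
by move=> /andP[/ltW -> /ltW ->].
Qed.

Lemma tst_dbr (c0 d0 c d : R) n : c0 < d0 -> c < d ->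
  tst (Num.min c c0) (Num.max d d0) (dbr_prim c0 d0 n c d) (dbr_test c0 d0 n c d).
Proof.
move=> h0 h; have [h1 h2] := dbr_primP n h0 h.
split => //; first exact: (Dk_continuous (Dk_dbr_test c0 d0 0 n c d)).
have [dphi [_ h3 _ h4]] := bump_supp_tst h2.
move=> x xn; rewrite -(h4 x xn).
by rewrite -(@derive_val _ _ _ _ _ _ _ (h1 x)) -(@derive_val _ _ _ _ _ _ _ (h3 x)).
Qed.

Lemma continuous_bounded_itv (a b : R) (phi : R -> R) : continuous phi ->
  exists M, forall x, `[a, b]%classic x -> `|phi x| <= M.
Proof.
move=> cp; have [ab|ba] := leP a b; last first.
  by exists 0 => x /=; rewrite in_itv/= => /andP[h1 h2]; lra.
have [M hM] := AC_bounded ab (AC_id a b) cp.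
by exists M => x /=; rewrite in_itv/= => /andP[*]; exact: hM.
Qed.

Lemma continuous_measurable_fst (D : set (measurableTypeR R * measurableTypeR R))
  (phi : R -> R) : measurable D ->
  continuous phi -> measurable_fun D (fun z => phi z.1).
Proof.
move=> mD cp; apply: measurable_funTS.
by apply: (@measurableT_comp _ _ _ _ _ _ phi) => //; exact: continuous_measurable_fun.
Qed.

Lemma continuous_measurable_snd (D : set (measurableTypeR R * measurableTypeR R))
  (phi : R -> R) : measurable D ->
  continuous phi -> measurable_fun D (fun z => phi z.2).
Proof.
move=> mD cp; apply: measurable_funTS.
by apply: (@measurableT_comp _ _ _ _ _ _ phi) => //; exact: continuous_measurable_fun.
Qed.

Lemma L1_rect_test (F : measurableTypeR R * measurableTypeR R -> R) (a b c d : R) (phi psi : R -> R) :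
  L1 mu2 (rect a b c d) F -> continuous phi -> continuous psi ->
  L1 mu2 (rect a b c d) (fun z => F z * (phi z.1 * psi z.2)).
Proof.
move=> iF cp cq.
have [M hM] := @continuous_bounded_itv a b _ cp.
have [M' hM'] := @continuous_bounded_itv c d _ cq.
apply: (L1M (K := M * M')) => //.
- exact: measurable_rect.
- apply: measurable_funM; [apply: continuous_measurable_fst|apply: continuous_measurable_snd] => //;
    exact: measurable_rect.
- by move=> z [/= h1 h2]; rewrite normrM ler_pM// ?hM ?hM'.
Qed.

(** By Fubini, the integral of F(t, x) in x is a function of t whose integral against every rational
    time bump is zero; this is the setting of [fund_bump]. *)
Lemma slice_test (F : measurableTypeR R * measurableTypeR R -> R) (a b c d : R) : a < b ->
  L1 mu2 (rect a b c d) F ->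
  (forall n (e e' : rat), a < ratr e -> ratr e < ratr e' :> R -> ratr e' < b ->
    \int[mu2]_(z in rect a b c d) (F z * bump n (ratr e) (ratr e') z.1) = 0) ->
  {ae mu, forall t, `[a, b]%classic t -> \int[mu]_(x in `[c, d]) F (t, x) = 0}.
Proof.
move=> ab iF hF.
apply: fund_bump => //; first exact: leb2_L1 iF.
move=> n e e' ae ee' eb; rewrite -[RHS](hF n e e')//.
have iF' : L1 mu2 (rect a b c d) (fun z => F z * bump n (ratr e) (ratr e') z.1).
  have := @L1_rect_test F a b c d (bump n (ratr e) (ratr e')) (cst 1) iF
    (@bump_continuous _ _ _ _) (fun x => @cst_continuous _ _ _ _).
  by apply: eq_L1; [exact: measurable_rect|move=> z _ /=; rewrite mulr1].
rewrite (leb2_fubini1 iF').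
have sl := leb2_slice1 iF.
apply: ae_eq_Rint => //.
- apply: measurable_funM; first by apply: L1_measurable; exact: leb2_L1 iF.
  by apply: measurable_funTS; apply: continuous_measurable_fun; exact: bump_continuous.
- by apply: L1_measurable; exact: leb2_L1 iF'.
- by apply: filterS sl => t ht tab /=; rewrite RintegralZr//; exact: ht.
Qed.
End rect.

Section slices.
Context (R : realType).
Notation mu := (leb R).
Notation mu2 := (leb2 R).

Lemma tst_widen (a b a' b' : R) phi dphi : a' <= a -> b <= b' ->
  tst a b phi dphi -> tst a' b' phi dphi.
Proof.
move=> aa bb [[s z] h c z'].
have sub x : x \notin `[a', b'] -> x \notin `[a, b].
  by apply: contra; rewrite !in_itv/= => /andP[h1 h2]; apply/andP; split; lra.
by split => //; [split => // x /sub /z|move=> x /sub /z'].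
Qed.

Lemma tst_continuous (a b : R) phi dphi : tst a b phi dphi -> continuous phi.
Proof. by move=> [[s _] _ _ _]; exact: (Dk_continuous (s 0)). Qed.

Lemma half_rect (al be c d : R) (F : R -> R -> R) (a b : R -> R) : 0 < al ->
  (forall x, x \notin `[al, be] -> a x = 0) -> (forall x, x \notin `[c, d] -> b x = 0) ->
  \int[mu2]_(z in @half_plane R) (F z.1 z.2 * (a z.1 * b z.2)) =
  \int[mu2]_(z in rect al be c d) (F z.1 z.2 * (a z.1 * b z.2)).
Proof.
move=> al0 za zb; apply: Rint_supp => z.
  move=> _ nz; have [h|h] := boolP (z.1 \in `[al, be]); last by rewrite za// mul0r mulr0.
  by rewrite zb ?mulr0//; apply/negP => h2; apply: nz; split.
by move=> [/= + _] nz; rewrite in_itv/= => /andP[/(lt_le_trans al0)].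
Qed.

Lemma weak_dx_rect (h k : R -> R -> R) (al be c d : R) (a a' b b' : R -> R) :
  weak_dx h k -> 0 < al -> tst al be a a' -> tst c d b b' ->
  \int[mu2]_(z in rect al be c d) (h z.1 z.2 * (a z.1 * b' z.2)) =
  - \int[mu2]_(z in rect al be c d) (k z.1 z.2 * (a z.1 * b z.2)).
Proof.
move=> [_ _ H] al0 [sa ha ca za] [sb hb cb zb].
have da (x : R) : derivable a x 1 by apply: ex_derive.
have := H _ (test_function_prod al0 sa sb).
rewrite -(half_rect _ al0 sa.2 zb) -(half_rect _ al0 sa.2 sb.2).
move=> <-; apply: eq_Rintegral => z _; congr (_ * _).
by rewrite (dx_prod (da _) (hb _)).
Qed.

Lemma weak_equation_rect (p m : R) f (u v : R -> R -> R) (al be c d : R) (a a' b b' : R -> R) :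
  weak_equation p m f u v -> 0 < al -> tst al be a a' -> tst c d b b' ->
  \int[mu2]_(z in rect al be c d) (u z.1 z.2 * (a' z.1 * b z.2)) +
  \int[mu2]_(z in rect al be c d) (f (u z.1 z.2) * (a z.1 * b' z.2)) =
  m * \int[mu2]_(z in rect al be c d) (flux p v z.1 z.2 * (a z.1 * b' z.2)).
Proof.
move=> [iu ifu iv H] al0 ta tb.
have [sa ha ca za] := ta; have [sb hb cb zb] := tb.
have cta := tst_continuous ta; have ctb := tst_continuous tb.
have da (x : R) : derivable a x 1 by apply: ex_derive.
have db (x : R) : derivable b x 1 by apply: ex_derive.
have := H _ (test_function_prod al0 sa sb) => /oppr_inj.
under eq_Rintegral do rewrite (dx_prod (da _) (hb _)) (dt_prod (ha _) (db _)).
under [X in _ = _ * X]eq_Rintegral do rewrite (dx_prod (da _) (hb _)).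
rewrite (half_rect (flux p v) al0 sa.2 zb) => <-.
rewrite -RintegralD//.
- apply/esym/Rint_supp => z.
    move=> _ nz; have [h|h] := boolP (z.1 \in `[al, be]); last first.
      by rewrite sa.2// za// !mul0r !mulr0 addr0.
    have h2 : z.2 \notin `[c, d] by apply/negP => h2; apply: nz; split.
    by rewrite zb// sb.2// !mulr0 addr0.
  by move=> [/= + _] nz; rewrite in_itv/= => /andP[/(lt_le_trans al0)].
- exact: measurable_rect.
- by apply: L1_rect_test => //; exact: locally_integrable2_rect.
- by apply: L1_rect_test => //; exact: (@locally_integrable2_rect _ (fun t x => f (u t x))).
Qed.

(** The weak identity is tested on a time bump times a [dbr_prim] in x. For each space test
    [slice_test] leaves out a null set of times; at the times outside their union [du_bois_reymond]
    applies to the slice. *)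
Lemma slice_AC (h k : R -> R -> R) (al be N : R) : 0 < al -> al < be -> 0 < N -> weak_dx h k ->
  {ae mu, forall t, `[al, be]%classic t -> [/\ L1 mu `[-N, N] (h t), L1 mu `[-N, N] (k t) &
    exists C, {ae mu, forall x, `[-N, N]%classic x -> h t x = C + \int[mu]_(y in `[-N, x]) k t y}]}.
Proof.
move=> al0 albe N0 hk; have [ih ik _] := hk.
have ihr := locally_integrable2_rect be (-N) N al0 ih.
have ikr := locally_integrable2_rect be (-N) N al0 ik.
pose c0 := - (N / 2); pose d0 := N / 2.
have c0d0 : c0 < d0 by rewrite /c0 /d0; lra.
have key : {ae mu, forall t, forall (i : nat * (rat * rat)), `[al, be]%classic t ->
   -N < ratr i.2.1 -> ratr i.2.1 < ratr i.2.2 :> R -> ratr i.2.2 < N ->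
   \int[mu]_(x in `[-N, N]) (h t x * dbr_test c0 d0 i.1 (ratr i.2.1) (ratr i.2.2) x +
     k t x * dbr_prim c0 d0 i.1 (ratr i.2.1) (ratr i.2.2) x) = 0}.
  apply: ae_forall_count => -[n [e e']]/=.
  have [Ne|Ne] := ltP (- N) (ratr e); last by apply: aeW => t.
  have [ee|ee] := ltP (ratr e) (ratr e' : R); last by apply: aeW => t.
  have [eN|eN] := ltP (ratr e') N; last by apply: aeW => t.
  have tt : tst (-N) N (dbr_prim c0 d0 n (ratr e) (ratr e')) (dbr_test c0 d0 n (ratr e) (ratr e')).
    apply: tst_widen (tst_dbr n c0d0 ee).
      by rewrite le_min (ltW Ne)/= /c0; lra.
    by rewrite ge_max (ltW eN)/= /d0; lra.
  have [_ _ ct _] := tt; have cp := tst_continuous tt.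
  have i1 := L1_rect_test ihr (fun x => @cst_continuous _ _ (1 : R) x) ct.
  have i2 := L1_rect_test ikr (fun x => @cst_continuous _ _ (1 : R) x) cp.
  pose F (z : measurableTypeR R * measurableTypeR R) : R :=
    h z.1 z.2 * (cst 1 z.1 * dbr_test c0 d0 n (ratr e) (ratr e') z.2) +
    k z.1 z.2 * (cst 1 z.1 * dbr_prim c0 d0 n (ratr e) (ratr e') z.2).
  have iF : L1 mu2 (rect al be (-N) N) F by apply: L1D => //; exact: measurable_rect.
  have : {ae mu, forall t, `[al, be]%classic t -> \int[mu]_(x in `[-N, N]) F (t, x) = 0}.
    apply: slice_test => // m q q' alq qq qbe.
    have [a' ta] := tst_bump m (ratr q : R) (ratr q').
    have {}ta := tst_widen (ltW alq) (ltW qbe) ta.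
    have := weak_dx_rect hk al0 ta tt.
    move/eqP; rewrite -subr_eq0 opprK -RintegralD.
    - move/eqP => E; rewrite -[RHS]E; apply: eq_Rintegral => z _; rewrite /F/= !mul1r; ring.
    - exact: measurable_rect.
    - by apply: L1_rect_test => //; exact: bump_continuous.
    - by apply: L1_rect_test => //; exact: bump_continuous.
  apply: filterS => t ht tab _ _ _; rewrite -[RHS](ht tab).
  by apply: eq_Rintegral => x _; rewrite /F/= !mul1r.
apply: filterS3 key (leb2_slice1 ihr) (leb2_slice1 ikr) => t ht h1 h2 tab.
have {}h1 := h1 tab; have {}h2 := h2 tab.
split => //; apply: (@du_bois_reymond R c0 d0) => //; rewrite /c0 /d0; try lra.
move=> n e e' ne ee eN; have /= := ht (n, (e, e')) tab ne ee eN.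
have tt : tst (-N) N (dbr_prim c0 d0 n (ratr e) (ratr e')) (dbr_test c0 d0 n (ratr e) (ratr e')).
  apply: tst_widen (tst_dbr n c0d0 ee).
    by rewrite le_min (ltW ne)/= /c0; lra.
  by rewrite ge_max (ltW eN)/= /d0; lra.
have [_ _ ct _] := tt; have cp := tst_continuous tt.
have iM g phi : L1 mu `[-N, N] g -> continuous phi -> L1 mu `[-N, N] (fun x => g x * phi x).
  move=> ig cphi; have [M hM] := @continuous_bounded_itv _ (-N) N _ cphi.
  apply: (L1M (K := M)) => //; apply: measurable_funTS.
  exact: continuous_measurable_fun.
rewrite RintegralD//; [|exact: iM|exact: iM].
by move/eqP; rewrite addr_eq0 => /eqP.
Qed.

(** The segments [1/(n+1), n+2] exhaust the positive times. *)
Lemma ae_pos (P : R -> Prop) :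
  (forall al be, 0 < al -> al < be -> {ae mu, forall t, `[al, be]%classic t -> P t}) ->
  {ae mu, forall t, 0 < t -> P t}.
Proof.
move=> h; have : {ae mu, forall t, forall n : nat, `[n.+1%:R^-1, n.+2%:R]%classic t -> P t}.
  apply: ae_foralln => n; apply: h; first by rewrite invr_gt0.
  by apply: (@le_lt_trans _ _ 1); [rewrite invf_le1 ?ler1n|rewrite ltr1n].
apply: filterS => t ht t0.
pose n := Num.bound (t + t^-1).
have hn : t + t^-1 < n%:R.
  by apply: archi_boundP; rewrite addr_ge0 ?invr_ge0// ltW.
have it0 : 0 < t^-1 by rewrite invr_gt0.
apply: (ht n); rewrite /= in_itv/=; apply/andP; split.
  by rewrite invf_ple ?posrE// -natr1; lra.
by rewrite -natr1 -natr1; lra.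
Qed.

Lemma slices (h k : R -> R -> R) : weak_dx h k ->
  {ae mu, forall t, 0 < t -> forall n : nat,
    exists W, [/\ L1 mu `[-n.+1%:R, n.+1%:R] (h t), AC (-n.+1%:R) n.+1%:R W (k t) &
     {ae mu, forall x, `[-n.+1%:R, n.+1%:R]%classic x -> h t x = W x}]}.
Proof.
move=> hk; apply: ae_pos => al be al0 albe.
have : {ae mu, forall t, forall n : nat, `[al, be]%classic t -> exists W,
    [/\ L1 mu `[-n.+1%:R, n.+1%:R] (h t), AC (-n.+1%:R) n.+1%:R W (k t) &
     {ae mu, forall x, `[-n.+1%:R, n.+1%:R]%classic x -> h t x = W x}]}.
  apply: ae_foralln => n.
  have n0 : 0 < n.+1%:R :> R by [].
  apply: filterS (slice_AC al0 albe n0 hk) => t ht tab.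
  have [h1 h2 [C hC]] := ht tab.
  exists (fun x => C + \int[mu]_(y in `[-n.+1%:R, x]) k t y); split => //.
  split => // x x1 x2; rewrite set_itv1 Rintegral_set1 addr0//.
by apply: filterS => t ht tab n; exact: ht.
Qed.
End slices.

(** * Pointwise bound by the mass and the energy *)

Section morrey.
Context (R : realType).
Notation mu := (leb R).

(** If |k| exceeds [del], then (|k| / del)^p >= 1, and multiplication by |k| gives the second term
    alone. *)
Lemma le_young_powR (p del k : R) : 1 < p -> 0 < del ->
  `|k| <= del + (del `^ p)^-1 * `|k| `^ (p + 1).
Proof.
move=> p1 d0; have [kd|dk] := leP `|k| del.
  by rewrite (le_trans kd)// lerDl mulr_ge0 ?invr_ge0 ?powR_ge0.
have k0 : 0 < `|k| by exact: lt_trans dk.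
have dp0 : 0 < del `^ p by exact: powR_gt0.
apply: (@le_trans _ _ ((del `^ p)^-1 * `|k| `^ (p + 1))); last by rewrite lerDr ltW.
rewrite ler_pdivlMl// powRD; last by rewrite (gt_eqF k0) implybT.
rewrite powRr1 ?normr_ge0// ler_wpM2r//.
by apply: ge0_ler_powR; rewrite ?nnegrE ?ltW//; lra.
Qed.

(* By Young, [`|k| <= del + del^-p `|k|^(p+1)], so that [h] varies by at most
   half of [`|h x|] on an interval of length of order [`|h x| / del] starting at [x]. *)
Lemma morrey (h k : R -> R) (p B E : R) : 1 < p -> 0 < E ->
  (forall n : nat, exists W, AC (-n.+1%:R) n.+1%:R W k /\
     {ae mu, forall x, `[-n.+1%:R, n.+1%:R]%classic x -> h x = W x}) ->
  L1 mu setT (fun x => h x ^+ 2) -> \int[mu]_x (h x ^+ 2) <= B ->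
  L1 mu setT (fun x => `|k x| `^ (p + 1)) -> \int[mu]_x (`|k x| `^ (p + 1)) <= E ->
  {ae mu, forall x, `|h x| `^ (3 * p + 1) <= (16 * B) `^ p * (4 * E)}.
Proof.
move=> p1 E0 hW ih hB ik hE.
have B0 : 0 <= B by apply: le_trans hB; apply: Rintegral_ge0 => x _; rewrite sqr_ge0.
have {hW} [W hW] := choice hW.
have := ae_foralln (fun n => (hW n).2); apply: filterS => x hx.
have [hx0|hx0] := eqVneq (h x) 0.
  rewrite hx0 normr0 powR0; last by rewrite gt_eqF//; lra.
  by rewrite mulr_ge0 ?powR_ge0// mulr_ge0// ltW.
set kap := `|h x|; have k0 : 0 < kap by rewrite normr_gt0.
(* [del] is tuned to del^p = 4 E / kap, so that the energy term E / del^p equals kap / 4. The length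
   [l] chosen below makes del l equal to kap / 4 as well, and the total variation is at most kap /
   2. *)
pose del := (4 * E / kap) `^ p^-1.
have Ek0 : 0 < 4 * E / kap by rewrite divr_gt0// mulr_gt0.
have d0 : 0 < del by exact: powR_gt0.
have dp : del `^ p = 4 * E / kap.
  rewrite /del -powRrM mulVf; last by rewrite gt_eqF//; lra.
  by rewrite powRr1// ltW.
pose l := kap / (4 * del).
have l0 : 0 < l by rewrite divr_gt0// mulr_gt0.
pose n := Num.bound (`|x| + l).
have hn : `|x| + l < n.+1%:R.
  apply: (@lt_trans _ _ n%:R); last by rewrite ltr_nat.
  by apply: archi_boundP; rewrite addr_ge0// ltW.
have xn1 : - n.+1%:R <= x by have := ler_norm (- x); rewrite normrN; lra.
have xn2 : x + l <= n.+1%:R by have := ler_norm x; lra.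
have [hAC aeW] := hW n.
have nn : - n.+1%:R <= n.+1%:R :> R by lra.
have hxW : h x = W n x by apply: hx; rewrite /= in_itv/= xn1; lra.
have bound y : x <= y -> y <= x + l -> kap / 2 <= `|W n y|.
  move=> xy yl.
  have sxy : `[x, y] `<=` (`[- n.+1%:R, n.+1%:R] : set R) by apply: subset_cc; lra.
  have ikxy : L1 mu `[x, y] k by apply: (L1S _ _ _ hAC.1).
  have ipxy : L1 mu `[x, y] (fun x => `|k x| `^ (p + 1)) by apply: (L1S _ _ _ ik).
  have : `|W n y - W n x| <= kap / 2.
    rewrite (AC_sub hAC)//; last by lra.
    apply: (le_trans (le_normr_Rintegral _ ikxy)) => //.
    apply: (@le_trans _ _ (\int[mu]_(t in `[x, y]) (del + (del `^ p)^-1 * `|k t| `^ (p + 1)))).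
      apply: le_Rintegral => //.
      - exact: L1_norm.
      - by apply: L1D => //; [apply: L1_cst => //; exact: leb_cc_fin|exact: L1Z].
      - by move=> t _; exact: le_young_powR.
    rewrite RintegralD//; [|by apply: L1_cst => //; exact: leb_cc_fin|exact: L1Z].
    rewrite RintegralZl// Rint_cst_cc//.
    have h1 : del * (y - x) <= kap / 4.
      have -> : kap / 4 = del * l by rewrite /l; field; rewrite gt_eqF.
      by rewrite ler_wpM2l ?(ltW d0)//; lra.
    have h2 : (del `^ p)^-1 * \int[mu]_(t in `[x, y]) (`|k t| `^ (p + 1)) <= kap / 4.
      rewrite dp invf_div.
      have -> : kap / 4 = kap / (4 * E) * E by field; rewrite gt_eqF.
      rewrite ler_wpM2l ?divr_ge0 ?mulr_ge0 ?(ltW k0) ?(ltW E0)//.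
      by apply: le_trans hE; apply: Rint_subset_le => // *; exact: powR_ge0.
    lra.
  have := lerB_normD (W n x) (W n y - W n x).
  rewrite -hxW subrKC -/kap; lra.
(* Since |h| is at least kap / 2 on an interval of length [l], this is a lower bound for the mass
   there. *)
have key : (kap / 2) ^+ 2 * l <= B.
  have sx : `[x, x + l] `<=` (`[- n.+1%:R, n.+1%:R] : set R) by apply: subset_cc; lra.
  have ih' : L1 mu `[x, x + l] (fun y => h y ^+ 2) by apply: (L1S _ _ _ ih).
  have xxl : x <= x + l by rewrite lerDl ltW.
  have mW : measurable_fun (`[x, x + l] : set (measurableTypeR R)) (fun y => W n y ^+ 2).
    apply: measurable_funX; apply: measurable_funS (AC_measurable nn hAC (fun x => cvg_id)) => //.
  have eqW : {ae mu, forall y, `[x, x + l]%classic y -> h y ^+ 2 = W n y ^+ 2}.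
    by apply: filterS aeW => y hy xy; rewrite hy//; exact: sx.
  apply: le_trans hB.
  apply: (@le_trans _ _ (\int[mu]_(y in `[x, x + l]) (h y ^+ 2))); last first.
    by apply: Rint_subset_le => // *; exact: sqr_ge0.
  rewrite (ae_eq_Rint _ (L1_measurable ih') mW eqW)//.
  rewrite (_ : _ * l = \int[mu]_(y in `[x, x + l]) (kap / 2) ^+ 2); last first.
    by rewrite Rint_cst_cc// addrAC subrr add0r.
  apply: le_Rintegral => //.
  - by apply: L1_cst => //; exact: leb_cc_fin.
  - exact: (ae_eq_L1 _ mW eqW ih').
  move=> y; rewrite /= in_itv/= => /andP[xy yl].
  rewrite -(@real_normK _ (W n y)) ?num_real// ler_sqr ?nnegrE ?normr_ge0 ?divr_ge0 ?(ltW k0)//.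
  exact: bound.
(* Substituting [l] gives this cubic bound. Raised to the power p it contains del^p = 4 E / kap, and
   moving this last kap to the left produces the exponent 3 p + 1. *)
have key2 : kap ^+ 3 <= 16 * B * del.
  have -> : kap ^+ 3 = 16 * del * ((kap / 2) ^+ 2 * l).
    by rewrite /l; field; rewrite gt_eqF.
  by rewrite [leRHS]mulrAC ler_wpM2l// mulr_ge0// ltW.
have p0 : 0 < p by lra.
have : (kap ^+ 3) `^ p <= (16 * B * del) `^ p.
  by apply: ge0_ler_powR; rewrite ?nnegrE ?exprn_ge0 ?mulr_ge0 ?(ltW p0) ?(ltW k0) ?(ltW d0).
rewrite powRM ?mulr_ge0 ?(ltW d0)// dp -powR_mulrn ?(ltW k0)// -powRrM.
rewrite mulrA ler_pdivlMr// => key3.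
by rewrite powRD ?powRr1 ?(ltW k0)// (gt_eqF k0) implybT.
Qed.
End morrey.

(** * Primitives from minus infinity, level entropies, and the initial datum *)

Section primitives.
Context (R : realType).
Notation mu := (leb R).

(** Integration from minus infinity gives a primitive on the whole line by a single formula; the
    vanishing of [c] below [a] makes the integral finite. *)
Lemma prim_left (c : R -> R) (a : R) : continuous c -> (forall y, y <= a -> c y = 0) ->
  (forall y : R, is_derive y 1 (fun y => \int[mu]_(t in `]-oo, y]) c t) (c y)) /\
  (forall y, y <= a -> \int[mu]_(t in `]-oo, y]) c t = 0).
Proof.
move=> cc c0; split; last first.
  move=> y ya; rewrite (@Rint_supp _ _ R mu _ set0) ?Rintegral_set0// => z.
  by rewrite /= in_itv/= => zy _; apply: c0; exact: le_trans ya.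
move=> y; have y1 : y < y + 1 by rewrite ltrDl.
have i1 : L1 mu `]-oo, y + 1] c.
  rewrite /L1; apply/(integrable_mkcond _ _).2 => //.
  rewrite restrict_EFin (_ : c \_ _ = c \_ `[Num.min a (y + 1), y + 1]).
    rewrite -restrict_EFin; apply/(integrable_mkcond _ _).1 => //.
    exact: continuous_L1.
  apply/funext => z; rewrite !patchE.
  have [h1|h1] := boolP (z \in `]-oo, y + 1]%classic); last first.
    case: ifPn => // h2; exfalso; move/negP: h1; apply; move: h2.
    by rewrite !inE/= !in_itv/= => /andP[].
  case: ifPn => // /negP h2; apply: c0; rewrite leNgt; apply/negP => az; apply: h2.
  by move: h1; rewrite !inE/= !in_itv/= => ->; rewrite ge_min (ltW az).
have := @continuous_FTC1 R c -oo%O y (y + 1) y1 i1 _ (cc y).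
case; first by rewrite ltNyr.
by move=> h1; rewrite derive1E => <-; exact: DeriveDef.
Qed.

Lemma prim_gt0 (P c : R -> R) (a : R) : (forall y : R, is_derive y 1 P (c y)) ->
  (forall y, y <= a -> P y = 0) -> (forall y, a < y -> 0 < c y) -> forall y, a < y -> 0 < P y.
Proof.
move=> hP P0 c0 y ay.
have cP : {within `[a, y], continuous P}.
  by apply: continuous_subspaceT => x; exact: is_derive_continuous (hP x).
have [x] := MVT ay (fun x _ => hP x) cP.
rewrite (P0 a)// subr0 in_itv/= => /andP[ax _] ->.
by rewrite mulr_gt0 ?c0// subr_gt0.
Qed.

(** [e2] is the positive part of y - k, capped at 1, and is integrated twice. The square of the
    positive part would have a discontinuous second derivative, whereas the entropy estimates use a
    continuous bounded [e2]. As k >= 0, [e0] and [e1] vanish at 0. *)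
Lemma level_entropy (k : R) : 0 <= k -> exists e0 e1 e2 : R -> R,
  [/\ forall y : R, is_derive y 1 e0 (e1 y), forall y : R, is_derive y 1 e1 (e2 y),
   continuous e2, forall y, 0 <= e2 y <= 1 &
   (forall y, y <= k -> e0 y = 0) /\ (forall y, y <= k -> e1 y = 0) /\ (forall y, k < y -> 0 < e0 y)].
Proof.
move=> k0; pose e2 y := Num.max 0 (Num.min 1 (y - k)) : R.
have c2 : continuous e2.
  move=> y; apply: (@continuous_max _ _ (cst 0) (fun y => Num.min 1 (y - k))).
    exact: cst_continuous.
  apply: (@continuous_min _ _ (cst 1) (fun y => y - k)); first exact: cst_continuous.
  by apply: cvgB; [exact: cvg_id|exact: cvg_cst].
have z2 y : y <= k -> e2 y = 0.
  move=> yk; apply/max_idPl; rewrite ge_min; apply/orP; right; lra.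
have p2 y : k < y -> 0 < e2 y by move=> ky; rewrite lt_max lt_min ltr01 subr_gt0 ky orbT.
have [d1 z1] := prim_left c2 z2.
set e1 := fun y => \int[mu]_(t in `]-oo, y]) e2 t in d1 z1.
have c1 : continuous e1 by move=> y; exact: is_derive_continuous (d1 y).
have [d0 z0] := prim_left c1 z1.
exists (fun y => \int[mu]_(t in `]-oo, y]) e1 t), e1, e2; split => //.
  by move=> y; rewrite le_max lexx/= ge_max ler01 ge_min lexx.
split => //; split => //.
by apply: prim_gt0 d0 z0 _ => y; exact: (prim_gt0 d1 z1 p2).
Qed.

(** The part of [a, b] within r / 2 of [x0] is a segment of positive length, so a null set cannot
    contain it. *)
Lemma ae_dense (a b x0 r : R) (P : R -> Prop) : a < b -> a <= x0 -> x0 <= b -> 0 < r ->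
  {ae mu, forall x, `[a, b]%classic x -> P x} ->
  exists y, [/\ a <= y, y <= b, `|y - x0| < r & P y].
Proof.
move=> ab ax xb r0 [N [mN N0 hN]].
apply: contrapT => nex.
pose c := Num.max a (x0 - r / 2); pose d := Num.min b (x0 + r / 2).
have cd : c < d by rewrite gt_max !lt_min; apply/andP; split; apply/andP; split; lra.
have sub : (`[c, d] : set (measurableTypeR R)) `<=` N.
  move=> y; rewrite /= in_itv/= ge_max le_min => /andP[/andP[h1 h2] /andP[h3 h4]].
  apply: hN => /= hy; apply: nex; exists y; split => //.
    by rewrite ltr_norml; apply/andP; split; lra.
  by apply: hy; rewrite in_itv/= h1.
have : (mu `[c, d] <= mu N)%E by apply: le_measure; rewrite ?inE.
by rewrite N0 leNgt (leb_cc (ltW cd)) lte_fin subr_gt0 cd.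
Qed.

(** The counterpart of [slices] for a function of x alone: du Bois-Reymond on [-N, N], fed directly
    by the definition of the weak derivative. *)
Lemma initial_AC (h k : R -> R) : weak_derivative h k ->
  forall n : nat, exists W, AC (-n.+1%:R) n.+1%:R W k /\
     {ae mu, forall x, `[-n.+1%:R, n.+1%:R]%classic x -> h x = W x}.
Proof.
move=> [ih ik H] n; set N : R := n.+1%:R; have N0 : 0 < N by rewrite ltr0n.
have L1l g : locally_integrable [set: R] g -> L1 mu `[-N, N] g.
  move=> [mg _ hg]; apply/integrableP; split.
    by apply/measurable_EFinP; apply: measurable_funS mg.
  by apply: hg => //; exact: segment_compact.
pose c0 := - (N / 2); pose d0 := N / 2.
have c0d0 : c0 < d0 by rewrite /c0 /d0; lra.
have [C hC] : exists C, {ae mu, forall x, `[- N, N]%classic x -> h x = C + \int[mu]_(t in `[- N, x]) k t}.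
  apply: (@du_bois_reymond R c0 d0 (- N) N h k _ _ _ (L1l _ ih) (L1l _ ik)) => //; rewrite /c0 /d0; try lra.
  move=> m e e' ne ee eN.
  have tt : tst (-N) N (dbr_prim c0 d0 m (ratr e) (ratr e')) (dbr_test c0 d0 m (ratr e) (ratr e')).
    apply: tst_widen (tst_dbr m c0d0 ee).
      by rewrite le_min (ltW ne)/= /c0; lra.
    by rewrite ge_max (ltW eN)/= /d0; lra.
  have [sb hb _ zb] := tt.
  have := H _ (test_function_bump sb).
  rewrite (@Rint_supp _ _ R mu setT `[-N, N]); last 2 first.
  - move=> x _ /negP hx; rewrite derive1E (@derive_val _ _ _ _ _ _ _ (hb x)) zb ?mulr0//.
  - by move=> x _ /(_ Logic.I).
  rewrite [X in _ = - X -> _](@Rint_supp _ _ R mu setT `[-N, N]); last 2 first.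
  - by move=> x _ /negP hx; rewrite sb.2 ?mulr0.
  - by move=> x _ /(_ Logic.I).
  move=> <-; apply: eq_Rintegral => x _; congr (_ * _).
  by rewrite derive1E (@derive_val _ _ _ _ _ _ _ (hb x)).
exists (fun x => C + \int[mu]_(y in `[-N, x]) k y); split => //.
by split; [exact: L1l|move=> x x1 x2; rewrite set_itv1 Rintegral_set1 addr0].
Qed.
End primitives.

(** * The equation at almost every point *)

Section fubini_test.
Context (R : realType).
Notation mu := (leb R).
Notation mu2 := (leb2 R).

Lemma L1_cc_continuous (a b : R) (g phi : R -> R) : L1 mu `[a, b] g -> continuous phi ->
  L1 mu `[a, b] (fun x => g x * phi x).
Proof.
move=> ig cphi; have [M hM] := @continuous_bounded_itv _ a b _ cphi.
apply: (L1M (K := M)) => //; apply: measurable_funTS.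
exact: continuous_measurable_fun.
Qed.

Lemma L1_rect_test2 (F : measurableTypeR R * measurableTypeR R -> R) (a b c d : R) (psi : R -> R) :
  L1 mu2 (rect a b c d) F -> continuous psi ->
  L1 mu2 (rect a b c d) (fun z => F z * psi z.2).
Proof.
move=> iF cp; have := L1_rect_test iF (fun x => @cst_continuous _ _ (1 : R) x) cp.
by apply: eq_L1; [exact: measurable_rect|move=> z _ /=; rewrite mul1r].
Qed.

Lemma fubini_test (F : measurableTypeR R * measurableTypeR R -> R) (a b c d : R) (phi psi : R -> R) :
  L1 mu2 (rect a b c d) F -> continuous phi -> continuous psi ->
  \int[mu2]_(z in rect a b c d) (F z * (phi z.1 * psi z.2)) =
  \int[mu]_(t in `[a, b]) ((\int[mu]_(x in `[c, d]) (F (t, x) * psi x)) * phi t).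
Proof.
move=> iF cp cq; have i2 := L1_rect_test2 iF cq.
have i3 := L1_rect_test iF cp cq.
rewrite (leb2_fubini1 i3); apply: ae_eq_Rint => //.
- by apply: L1_measurable; exact: leb2_L1 i3.
- by apply: L1_measurable; apply: L1_cc_continuous => //; exact: leb2_L1 i2.
- apply: filterS (leb2_slice1 i2) => t ht tab; rewrite -RintegralZr//; last exact: ht.
  by apply: eq_Rintegral => x _ /=; rewrite mulrCA mulrC.
Qed.
End fubini_test.

(** Turns smallness in L^2 into smallness in L^1 on a bounded interval: if x^2 has integral at most
    d^2, both terms contribute a multiple of d. *)
Lemma le_young2 (R : realType) (d x : R) : 0 < d -> `|x| <= d + d^-1 * x ^+ 2.
Proof.
move=> d0; rewrite -(ler_pM2l d0).
have -> : d * (d + d^-1 * x ^+ 2) = d ^+ 2 + `|x| ^+ 2.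
  by rewrite real_normK ?num_real//; field; rewrite gt_eqF.
by set y := `|x|; have := sqr_ge0 (d - y); nra.
Qed.

Section energy.
Context (R : realType).
Notation mu := (leb R).
Variables (p m ut M : R) (f f' : R -> R) (u v A : R -> R -> R).
Hypotheses (p1 : 1 < p) (m0 : 0 < m) (M0 : 0 < M).
Hypotheses (df : forall y : R, is_derive y 1 f (f' y)) (cf' : continuous f').
Hypotheses (hdx : weak_dx u v) (hdA : weak_dx (flux p v) A) (heq : weak_equation p m f u v).
Let w t x := u t x - ut.
Hypothesis hw : forall t : R, 0 <= t ->
  measurable_fun (setT : set (measurableTypeR R)) (w t) /\ L1 mu setT (fun x => w t x ^+ 2).
Hypothesis hc : forall s : R, 0 <= s -> forall e : R, 0 < e -> exists2 r : R, 0 < r &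
  forall t : R, 0 <= t -> `|t - s| < r -> \int[mu]_x ((w t x - w s x) ^+ 2) <= e.

Lemma L1_w_cc (t : R) (a b : R) : 0 <= t -> L1 mu `[a, b] (w t).
Proof.
move=> t0; have [mw iw] := hw t0.
apply: (@le_L1 _ _ _ mu _ _ (fun x => 1 + w t x ^+ 2)) => //.
- exact: measurable_funTS.
- move=> x _; rewrite [leRHS]ger0_norm ?addr_ge0 ?sqr_ge0// -real_normK ?num_real//.
  by have := sqr_ge0 (`|w t x| - 1 : R); set y : R := `|w t x|; nra.
- apply: L1D => //; [by apply: L1_cst => //; exact: leb_cc_fin|].
  exact: (L1S _ _ _ iw).
Qed.

Lemma L1_dw2 (s t : R) : 0 <= s -> 0 <= t -> L1 mu setT (fun x => (w t x - w s x) ^+ 2).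
Proof.
move=> s0 t0; have [mw iw] := hw t0; have [mw' iw'] := hw s0.
apply: (@le_L1 _ _ _ mu _ _ (fun x => 2 * (w t x ^+ 2 + w s x ^+ 2))) => //.
- by apply: measurable_funX; exact: measurable_funB.
- move=> x _; rewrite !ger0_norm ?sqr_ge0 ?mulr_ge0 ?addr_ge0 ?sqr_ge0//.
  by have := sqr_ge0 (w t x + w s x); lra.
- by apply: L1Z => //; exact: L1D.
Qed.

Lemma pairing_continuous (a b : R) (phi : R -> R) (s e : R) : continuous phi -> a <= b -> 0 <= s -> 0 < e ->
  exists2 r, 0 < r & forall t, 0 <= t -> `|t - s| < r ->
    `|\int[mu]_(x in `[a, b]) (w t x * phi x) - \int[mu]_(x in `[a, b]) (w s x * phi x)| < e.
Proof.
move=> cphi ab s0 e0.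
have [K hK] := @continuous_bounded_itv _ a b _ cphi.
have K0 : 0 <= K.
  by apply: le_trans (hK a _) => //; rewrite /= in_itv/= lexx.
(* When the square of the increment has integral at most d^2, the pairing moves by at most K (d (b -
   a) + d), and this [d] brings it to at most e / 2. The 1 in [K + 1] covers K = 0. *)
pose d := e / 2 / ((K + 1) * (b - a + 1)).
have D0 : 0 < (K + 1) * (b - a + 1) by rewrite mulr_gt0//; lra.
have d0 : 0 < d by rewrite divr_gt0// divr_gt0.
have [r r0 hr] := hc s0 (exprn_gt0 2 d0).
exists r => // t t0 ts.
have it := L1_w_cc a b t0; have is_ := L1_w_cc a b s0.
have id2 : L1 mu `[a, b] (fun x => (w t x - w s x) ^+ 2) by apply: (L1S _ _ _ (L1_dw2 s0 t0)).
rewrite -RintegralB//; [|exact: L1_cc_continuous|exact: L1_cc_continuous].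
have iB : L1 mu `[a, b] (fun x => w t x * phi x - w s x * phi x).
  by apply: L1B => //; exact: L1_cc_continuous.
apply: (le_lt_trans (le_normr_Rintegral _ iB)) => //.
have iK : L1 mu `[a, b] (fun x => K * (d + d^-1 * (w t x - w s x) ^+ 2)).
  by apply: L1Z => //; apply: L1D => //; [apply: L1_cst => //; exact: leb_cc_fin|exact: L1Z].
apply: (@le_lt_trans _ _ (\int[mu]_(x in `[a, b]) (K * (d + d^-1 * (w t x - w s x) ^+ 2)))).
  apply: le_Rintegral => //; first exact: L1_norm.
  move=> x xab; rewrite -mulrBl normrM mulrC ler_pM//; first exact: hK.
  exact: le_young2.
rewrite RintegralZl//; last first.
  by apply: L1D => //; [apply: L1_cst => //; exact: leb_cc_fin|exact: L1Z].
rewrite RintegralD//; [|by apply: L1_cst => //; exact: leb_cc_fin|exact: L1Z].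
rewrite Rint_cst_cc// RintegralZl//.
have h1 : \int[mu]_(x in `[a, b]) ((w t x - w s x) ^+ 2) <= d ^+ 2.
  apply: le_trans (hr t t0 ts); apply: Rint_subset_le => //; first exact: L1_dw2.
  by move=> x _; exact: sqr_ge0.
have h2 : d^-1 * \int[mu]_(x in `[a, b]) ((w t x - w s x) ^+ 2) <= d.
  by rewrite ler_pdivrMl// -expr2.
apply: (@le_lt_trans _ _ (K * (d * (b - a + 1)))).
  by rewrite ler_wpM2l//; lra.
apply: (@le_lt_trans _ _ ((K + 1) * (d * (b - a + 1)))).
  have X0 : 0 <= d * (b - a + 1) by apply: mulr_ge0; lra.
  by apply: ler_wpM2r => //; lra.
have -> : (K + 1) * (d * (b - a + 1)) = e / 2 by rewrite mulrCA /d divfK// gt_eqF.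
lra.
Qed.

(** On product tests the weak equation says that [U], the pairing of u with [b], has weak time
    derivative [G]. Du Bois-Reymond gives U = C + int G at almost every time. Both sides are
    continuous in time, [U] by the L^2 continuity of [w], so the identity extends to every time of
    [s, t]. The contribution of [ut] to [U] does not depend on time and cancels. *)
Lemma time_identity (N s t : R) (b b' : R -> R) : 0 < N -> tst (- N) N b b' -> 0 < s -> s <= t ->
  exists2 G : R -> R, (forall tau, G tau = \int[mu]_(x in `[- N, N]) (f (u tau x) * b' x) -
     m * \int[mu]_(x in `[- N, N]) (flux p v tau x * b' x)) &
  L1 mu `[s, t] G /\
  \int[mu]_(x in `[- N, N]) ((w t x - w s x) * b x) = \int[mu]_(tau in `[s, t]) G tau.
Proof.
move=> N0 tb s0 st.
have [sb _ cb' _] := tb; have cb := tst_continuous tb.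
have [iu ifu ifl _] := heq.
(* The margins keep [al] positive, and [al < be] even when s = t. *)
pose al := s / 2; pose be := t + 1.
have al0 : 0 < al by rewrite /al; lra.
have albe : al < be by rewrite /al /be; lra.
have iur := locally_integrable2_rect be (- N) N al0 iu.
have ifur := @locally_integrable2_rect _ (fun t x => f (u t x)) _ be (- N) N al0 ifu.
have iflr := locally_integrable2_rect be (- N) N al0 ifl.
pose P1 tau := \int[mu]_(x in `[- N, N]) (f (u tau x) * b' x).
pose P2 tau := \int[mu]_(x in `[- N, N]) (flux p v tau x * b' x).
pose U tau := \int[mu]_(x in `[- N, N]) (u tau x * b x).
have iP1 : L1 mu `[al, be] P1 by exact: leb2_L1 (L1_rect_test2 ifur cb').
have iP2 : L1 mu `[al, be] P2 by exact: leb2_L1 (L1_rect_test2 iflr cb').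
have iU : L1 mu `[al, be] U by exact: leb2_L1 (L1_rect_test2 iur cb).
pose G tau := P1 tau - m * P2 tau.
have iG : L1 mu `[al, be] G by apply: L1B => //; exact: L1Z.
exists G => //.
pose c0 := (2 * al + be) / 3; pose d0 := (al + 2 * be) / 3.
have c0d0 : c0 < d0 by rewrite /c0 /d0; lra.
have [C hC] : exists C, {ae mu, forall x, `[al, be]%classic x -> U x = C + \int[mu]_(t in `[al, x]) G t}.
  apply: (@du_bois_reymond R c0 d0) => //; rewrite /c0 /d0; try lra.
  move=> k e e' ne ee eN.
  have ta : tst al be (dbr_prim c0 d0 k (ratr e) (ratr e')) (dbr_test c0 d0 k (ratr e) (ratr e')).
    apply: tst_widen (tst_dbr k c0d0 ee).
      by rewrite le_min (ltW ne)/= /c0; lra.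
    by rewrite ge_max (ltW eN)/= /d0; lra.
  have [_ _ ca' _] := ta; have ca := tst_continuous ta.
  have := weak_equation_rect heq al0 ta tb.
  rewrite (fubini_test iur ca' cb) (fubini_test ifur ca cb') (fubini_test iflr ca cb').
  rewrite -[X in X + _ = _]/(\int[mu]_(t in `[al, be]) (U t * dbr_test c0 d0 k (ratr e) (ratr e') t)).
  rewrite -[X in _ + X = _]/(\int[mu]_(t in `[al, be]) (P1 t * dbr_prim c0 d0 k (ratr e) (ratr e') t)).
  rewrite -[X in _ = m * X]/(\int[mu]_(t in `[al, be]) (P2 t * dbr_prim c0 d0 k (ratr e) (ratr e') t)).
  move/eqP; rewrite -subr_eq0 => /eqP E.
  have -> : \int[mu]_(x in `[al, be]) (G x * dbr_prim c0 d0 k (ratr e) (ratr e') x) =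
    \int[mu]_(t in `[al, be]) (P1 t * dbr_prim c0 d0 k (ratr e) (ratr e') t) -
    m * \int[mu]_(t in `[al, be]) (P2 t * dbr_prim c0 d0 k (ratr e) (ratr e') t).
    rewrite -RintegralZl//; last exact: L1_cc_continuous.
    rewrite -RintegralB//; [|exact: L1_cc_continuous|by apply: L1Z => //; exact: L1_cc_continuous].
    by apply: eq_Rintegral => x _; rewrite /G; ring.
  by move: E; lra.
have hAC : AC al be (fun x => C + \int[mu]_(t in `[al, x]) G t) G.
  by split => // x _ _; rewrite set_itv1 Rintegral_set1 addr0.
have iwb tau : 0 <= tau -> L1 mu `[- N, N] (fun x => w tau x * b x).
  by move=> tau0; apply: L1_cc_continuous => //; exact: L1_w_cc.
have UE tau : 0 <= tau -> U tau = \int[mu]_(x in `[- N, N]) (w tau x * b x) +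
    ut * \int[mu]_(x in `[- N, N]) b x.
  move=> tau0; rewrite -RintegralZl//; last exact: continuous_L1.
  rewrite -RintegralD//; [|exact: iwb|by apply: L1Z => //; exact: continuous_L1].
  by apply: eq_Rintegral => x _; rewrite /w; ring.
have Uc tau : s <= tau -> tau <= t -> U tau = C + \int[mu]_(t in `[al, tau]) G t.
  move=> stau taut; apply/eqP; rewrite -subr_eq0; apply/negPn/negP; rewrite -normr_gt0.
  set e := `|_| => e0; have e20 : 0 < e / 2 by lra.
  have tau0 : 0 <= tau by lra.
  have NN : - N <= N by lra.
  have [r1 r10 h1] := pairing_continuous cb NN tau0 e20.
  have atau : al <= tau by rewrite /al; lra.
  have btau : tau <= be by rewrite /be; lra.
  have [r2 r20 h2] := AC_cont (ltW albe) hAC atau btau e20.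
  have r0 : 0 < Num.min r1 r2 by rewrite lt_min r10.
  have [y [ay yb yr hy]] := ae_dense albe atau btau r0 hC.
  have y0 : 0 <= y by lra.
  move: yr; rewrite lt_min => /andP[yr1 yr2].
  have a1 := h1 y y0 yr1; have a2 := h2 y ay yb yr2.
  have : e <= `|(C + \int[mu]_(t in `[al, y]) G t) - (C + \int[mu]_(t in `[al, tau]) G t)| +
    `|\int[mu]_(x in `[- N, N]) (w y x * b x) - \int[mu]_(x in `[- N, N]) (w tau x * b x)|.
    apply: le_trans (ler_normB _ _); rewrite -hy !UE// /e UE//.
    by rewrite le_eqVlt; apply/orP; left; apply/eqP; congr (`|_|); ring.
  by move=> E; have := le_lt_trans E (ltrD a2 a1); rewrite -splitr ltxx.
split; first by apply: (L1S _ _ _ iG) => //; apply: subset_cc; rewrite /al /be; lra.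
rewrite -(AC_sub hAC) ?/al ?/be//; try lra.
rewrite -!Uc//; try lra.
rewrite !UE//; try lra.
under eq_Rintegral do rewrite mulrBl.
rewrite RintegralB//; [lra|apply: iwb; lra|apply: iwb; lra].
Qed.
End energy.

Section clamp.
Context (R : realType) (M : R).
Hypothesis M0 : 0 < M.

Definition clamp (y : R) : R := Num.max (- M) (Num.min M y).

Lemma clamp_le y : `|clamp y| <= M.
Proof.
rewrite /clamp ler_norml le_max lexx/= ge_max ge_min lexx/= andbT.
by move: M0; lra.
Qed.

Lemma clamp_id y : `|y| <= M -> clamp y = y.
Proof.
rewrite ler_norml => /andP[h1 h2].
have e : Num.min M y = y by apply/min_idPr.
by rewrite /clamp e; apply/max_idPr.
Qed.

Lemma clamp_continuous : continuous clamp.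
Proof.
move=> y; apply: (@continuous_max _ _ (cst (- M)) (fun y => Num.min M y)).
  exact: cst_continuous.
by apply: (@continuous_min _ _ (cst M) id); [exact: cst_continuous|exact: cvg_id].
Qed.
End clamp.

(** * Increments of the solution in time *)

Section identity.
Context (R : realType).
Notation mu := (leb R).
Notation mu2 := (leb2 R).
Variables (p m ut M : R) (f f' : R -> R) (u v A : R -> R -> R).
Hypotheses (M0 : 0 < M).
Hypotheses (df : forall y : R, is_derive y 1 f (f' y)) (cf' : continuous f').
Hypotheses (hdx : weak_dx u v) (hdA : weak_dx (flux p v) A) (heq : weak_equation p m f u v).
Let w t x := u t x - ut.
Hypothesis hw : forall t : R, 0 <= t ->
  measurable_fun (setT : set (measurableTypeR R)) (w t) /\ L1 mu setT (fun x => w t x ^+ 2).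
Hypothesis hc : forall s : R, 0 <= s -> forall e : R, 0 < e -> exists2 r : R, 0 < r &
  forall t : R, 0 <= t -> `|t - s| < r -> \int[mu]_x ((w t x - w s x) ^+ 2) <= e.
Hypothesis hM : forall t : R, 0 <= t -> {ae mu, forall x, `|w t x| <= M}.

(* [wc] is bounded by [M] everywhere, [w t] only almost everywhere. *)
Definition wc t x := clamp M (u t x - ut).
Definition speed t x := f' (ut + wc t x).
(** The right-hand side mu (|v|^(p-1) v)_x - f'(u) v of the equation, in the role of the time
    derivative of [w]. The speed is taken at the clamped value, hence bounded everywhere, which
    makes [gg] integrable on rectangles. *)
Definition gg t x := m * A t x - v t x * speed t x.

Lemma speed_bounded : exists K, forall t x, `|speed t x| <= K.
Proof.
have cs : continuous (fun y => f' (ut + y)).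
  move=> y; apply: continuous_comp; last exact: cf'.
  by apply: cvgD; [exact: cvg_cst|exact: cvg_id].
have [K hK] := @continuous_bounded_itv _ (- M) M _ cs.
by exists K => t x; apply: hK; rewrite /= in_itv/= -ler_norml clamp_le.
Qed.

Lemma measurable_speed (d : measure_display) (T : measurableType d) (D : set T) (h : T -> R) :
  measurable_fun D h -> measurable_fun D (fun z => f' (ut + clamp M (h z - ut))).
Proof.
move=> mh; apply: (@measurableT_comp _ _ _ _ _ _ f').
  exact: continuous_measurable_fun.
apply: measurable_funD => //; apply: (@measurableT_comp _ _ _ _ _ _ (clamp M)).
  by apply: continuous_measurable_fun; exact: clamp_continuous.
exact: measurable_funB.
Qed.

Lemma measurable_slice_u t : 0 <= t -> measurable_fun (setT : set (measurableTypeR R)) (u t).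
Proof.
move=> t0; have [mw _] := hw t0.
rewrite (_ : u t = fun x => w t x + ut); last by apply/funext => x; rewrite /w subrK.
exact: measurable_funD.
Qed.

(** What the integrations by parts on a slice use; almost every positive time qualifies. *)
Definition good (t : R) := [/\ 0 < t,
  {ae mu, forall x, u t x = ut + wc t x} &
  forall n : nat, exists W1 W2,
  [/\ AC (- n.+1%:R) n.+1%:R W1 (v t), AC (- n.+1%:R) n.+1%:R W2 (A t),
    L1 mu `[- n.+1%:R, n.+1%:R] (flux p v t),
    {ae mu, forall x, `[- n.+1%:R, n.+1%:R]%classic x -> u t x = W1 x} &
    {ae mu, forall x, `[- n.+1%:R, n.+1%:R]%classic x -> flux p v t x = W2 x}]].

Lemma ae_good : {ae mu, forall t, 0 < t -> good t}.
Proof.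
apply: filterS2 (slices hdx) (slices hdA) => t h1 h2 t0.
split => //.
  apply: filterS (hM (ltW t0)) => x hx.
  by rewrite /wc clamp_id ?subrKC.
move=> n; have [W1 [_ a1 b1]] := h1 t0 n; have [W2 [i2 a2 b2]] := h2 t0 n.
by exists W1, W2.
Qed.

Lemma gg_L1 t n : good t -> L1 mu `[- n.+1%:R, n.+1%:R] (gg t).
Proof.
move=> [t0 _ /(_ n)[W1 [W2 [a1 a2 _ _ _]]]].
have [K hK] := speed_bounded.
apply: L1B => //; first by apply: L1Z => //; exact: a2.1.
apply: (L1M (K := K)) => //; first exact: a1.1.
by apply: measurable_funTS; apply: measurable_speed; apply: measurable_slice_u; exact: ltW.
Qed.

(** At a good time f(u) and the flux agree almost everywhere with absolutely continuous functions,
    and [b] vanishes at the ends of the window, so both x-derivatives can be moved off [b]. This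
    rewrites the [G] of [time_identity] as the pairing of [gg] with [b]. *)
Lemma slice_identity n (b b' : R -> R) (c d t : R) : - n.+1%:R < c -> d < n.+1%:R ->
  tst c d b b' -> good t ->
  \int[mu]_(x in `[- n.+1%:R, n.+1%:R]) (f (u t x) * b' x) -
     m * \int[mu]_(x in `[- n.+1%:R, n.+1%:R]) (flux p v t x * b' x) =
  \int[mu]_(x in `[- n.+1%:R, n.+1%:R]) (gg t x * b x).
Proof.
set N : R := n.+1%:R => Nc dN tb gt.
have [t0 hu /(_ n)[W1 [W2 [a1 a2 ifl e1 e2]]]] := gt; rewrite -/N in a1 a2 e1 e2 ifl.
have [sb hb cb' zb] := tb; have cb := tst_continuous tb.
have NN : - N <= N by have : (0 : R) <= N; [exact: ler0n|lra].
have bN : b N = 0 by apply: sb.2; rewrite in_itv/= negb_and -!ltNge dN orbT.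
have bNN : b (- N) = 0 by apply: sb.2; rewrite in_itv/= negb_and -!ltNge Nc.
have hbAC : AC (- N) N b b' by exact: AC_smooth.
have mu_t := measurable_slice_u (ltW t0).
have cf : continuous f by move=> y; exact: is_derive_continuous (df y).
have fAC := AC_comp NN a1 df cf'.
have [K hK] := speed_bounded.
have msp : measurable_fun (setT : set (measurableTypeR R)) (speed t) by exact: measurable_speed.
have ivs : L1 mu `[- N, N] (fun x => v t x * speed t x).
  by apply: (L1M (K := K)) => //; [exact: a1.1|exact: measurable_funTS].
have E1 : \int[mu]_(x in `[- N, N]) (f (u t x) * b' x) =
    - \int[mu]_(x in `[- N, N]) ((v t x * speed t x) * b x).
  transitivity (\int[mu]_(x in `[- N, N]) (f (W1 x) * b' x)).
    apply: ae_eq_Rint => //.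
    - apply: measurable_funM; apply: measurable_funTS; last exact: continuous_measurable_fun.
      apply: (@measurableT_comp _ _ _ _ _ _ f) => //; exact: continuous_measurable_fun.
    - apply: measurable_funM; first exact: (AC_measurable NN a1 cf).
      by apply: measurable_funTS; exact: continuous_measurable_fun.
    - by apply: filterS e1 => x hx xN; rewrite hx.
  rewrite (AC_ibp NN fAC hbAC) bN bNN !mulr0 subr0 sub0r; congr (- _).
  apply: ae_eq_Rint => //.
  - by apply: L1_measurable; apply: L1_cc_continuous => //; exact: fAC.1.
  - by apply: L1_measurable; exact: L1_cc_continuous.
  - by apply: filterS2 hu e1 => x h1 h2 xN; rewrite /speed -h1 h2//; congr (_ * _); exact: mulrC.
have E2 : \int[mu]_(x in `[- N, N]) (flux p v t x * b' x) =
    - \int[mu]_(x in `[- N, N]) (A t x * b x).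
  transitivity (\int[mu]_(x in `[- N, N]) (W2 x * b' x)).
    apply: ae_eq_Rint => //.
    - by apply: L1_measurable; exact: L1_cc_continuous.
    - apply: measurable_funM; first exact: (AC_measurable NN a2 (fun x => cvg_id)).
      by apply: measurable_funTS; exact: continuous_measurable_fun.
    - by apply: filterS e2 => x hx xN; rewrite hx.
  by rewrite (AC_ibp NN a2 hbAC) bN bNN !mulr0 subr0 sub0r.
have iA : L1 mu `[- N, N] (fun x => A t x * b x) by apply: L1_cc_continuous => //; exact: a2.1.
rewrite E1 E2 mulrN opprK addrC -RintegralZl// -RintegralB//; last 2 first.
- exact: L1Z.
- exact: L1_cc_continuous.
by apply: eq_Rintegral => x _; rewrite /gg; ring.
Qed.

Lemma gg_rect_L1 (a b N : R) : 0 < a -> L1 mu2 (rect a b (- N) N) (fun z => gg z.1 z.2).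
Proof.
move=> a0; have [K hK] := speed_bounded.
have [iu iv _] := hdx; have [_ iA _] := hdA.
have mR := measurable_rect a b (- N) N.
apply: L1B => //; first by apply: L1Z => //; exact: locally_integrable2_rect iA.
apply: (L1M (K := K)) => //; first exact: locally_integrable2_rect iv.
apply: measurable_speed.
by apply: L1_measurable; exact: locally_integrable2_rect iu.
Qed.

(** By [time_identity], [slice_identity] and Fubini, both sides have the same integral against every
    rational bump in x. The exceptional set of x depends on [s] and [t]. *)
Lemma increment_identity n (s t : R) : 0 < s -> s < t ->
  {ae mu, forall x, `[- n.+1%:R, n.+1%:R]%classic x ->
     w t x - w s x = \int[mu]_(tau in `[s, t]) gg tau x}.
Proof.
move=> s0 st; set N : R := n.+1%:R.
have N0 : 0 < N by rewrite ltr0n.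
have ig := gg_rect_L1 t N s0.
have iI : L1 mu `[- N, N] (fun x => \int[mu]_(tau in `[s, t]) gg tau x) by exact: leb2_L2 ig.
have t0 : 0 <= t by lra.
have iw tau : 0 <= tau -> L1 mu `[- N, N] (w tau) by move=> ?; exact: L1_w_cc.
have iD : L1 mu `[- N, N] (fun x => w t x - w s x) by apply: L1B => //; apply: iw => //; exact: ltW.
suff : {ae mu, forall x, `[- N, N]%classic x -> w t x - w s x - \int[mu]_(tau in `[s, t]) gg tau x = 0}.
  by apply: filterS => x hx xN; apply/eqP; rewrite -subr_eq0; apply/eqP; exact: hx.
apply: fund_bump; [lra|exact: L1B|].
move=> k e e' Ne ee eN.
have [b' tb] := tst_bump k (ratr e : R) (ratr e').
have tbN := tst_widen (ltW Ne) (ltW eN) tb.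
have [G hG [iG hI]] := time_identity heq hw hc N0 tbN s0 (ltW st).
have cb := tst_continuous tb.
under eq_Rintegral do rewrite mulrBl.
rewrite RintegralB//; [|exact: L1_cc_continuous|exact: L1_cc_continuous].
rewrite hI; apply/eqP; rewrite subr_eq0; apply/eqP.
have ib := L1_rect_test2 ig cb.
transitivity (\int[mu]_(tau in `[s, t]) \int[mu]_(x in `[- N, N]) (gg tau x * bump k (ratr e) (ratr e') x)).
  apply: ae_eq_Rint => //.
  - exact: (L1_measurable iG).
  - by apply: L1_measurable; exact: leb2_L1 ib.
  - apply: filterS ae_good => tau gtau; rewrite /= in_itv/= => /andP[stau _].
    rewrite hG; apply: (slice_identity Ne eN tb); apply: gtau; exact: lt_le_trans stau.
rewrite -(leb2_fubini1 ib) (leb2_fubini2 ib).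
apply: ae_eq_Rint => //.
- by apply: L1_measurable; exact: leb2_L2 ib.
- by apply: L1_measurable; exact: L1_cc_continuous.
- by apply: filterS (leb2_slice2 ig) => x hx xN; rewrite /= RintegralZr//; exact: hx.
Qed.
End identity.

(** * Entropy inequality *)

Lemma clampB (R : realType) (M : R) : 0 < M -> forall a b, `|clamp M a - clamp M b| <= `|a - b|.
Proof.
move=> M0; have key a b : a <= b -> 0 <= clamp M b - clamp M a <= b - a.
  move=> ab; have cE y : [\/ y <= - M /\ clamp M y = - M, `|y| <= M /\ clamp M y = y |
      M <= y /\ clamp M y = M].
    have [h|h] := leP y (- M).
      apply: Or31; split => //; rewrite /clamp; apply/max_idPl; rewrite ge_min h orbT//.
    have [h'|h'] := leP M y.
      have e : Num.min M y = M by apply/min_idPl.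
      apply: Or33; split => //; rewrite /clamp e; apply/max_idPr; lra.
    have yM : `|y| <= M by rewrite ler_norml !ltW.
    by apply: Or32; split => //; rewrite clamp_id.
  have [[h1 ->]|[+ ->]|[h1 ->]] := cE a; have [[h2 ->]|[+ ->]|[h2 ->]] := cE b;
    rewrite ?ler_norml; lra.
move=> a b; have [ab|ba] := leP a b.
  have := key _ _ ab; rewrite distrC => /andP[h1 h2].
  by rewrite ger0_norm// (le_trans h2)// distrC ler_norm.
have := key _ _ (ltW ba) => /andP[h1 h2].
by rewrite ger0_norm// (le_trans h2)// ler_norm.
Qed.

Lemma itv_dist (R : realType) (z x y a r : R) : z <= x -> x <= y -> z <= a -> a <= y ->
  y - z < r -> `|a - x| < r.
Proof. by move=> *; rewrite ltr_norml; apply/andP; split; lra. Qed.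

Lemma two_quarter (R : realType) (a b e : R) : a <= e / 4 -> b <= e / 4 -> 2 * (a + b) <= e.
Proof. lra. Qed.

Lemma sqr_sub_le (R : realType) (a b c : R) :
  (a - b) ^+ 2 <= 2 * ((a - c) ^+ 2 + (b - c) ^+ 2).
Proof. by have := sqr_ge0 (a + b - 2 * c); nra. Qed.

Lemma le_young_prod (R : realType) (e a b : R) : 0 < e ->
  2 * (`|a| * `|b|) <= e^-1 * b ^+ 2 + e * a ^+ 2.
Proof.
move=> e0; rewrite -(ler_pM2l e0).
have -> : e * (e^-1 * b ^+ 2 + e * a ^+ 2) = `|b| ^+ 2 + (e * `|a|) ^+ 2.
  by rewrite exprMn !real_normK ?num_real//; field; rewrite gt_eqF.
set x := `|a|; set y := `|b|; have := sqr_ge0 (y - e * x); nra.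
Qed.

Section entropy.
Context (R : realType).
Variables (L : R) (e0 e1 e2 : R -> R).
Hypotheses (d0 : forall y : R, is_derive y 1 e0 (e1 y)) (d1 : forall y : R, is_derive y 1 e1 (e2 y)).
Hypotheses (h2 : forall y, 0 <= e2 y <= L) (e10 : e1 0 = 0) (e00 : e0 0 = 0).

Lemma entropy_lip a b : `|e1 a - e1 b| <= L * `|a - b|.
Proof.
have [c _ ->] := MVT_between b a d1.
by rewrite normrM ler_wpM2r// ger0_norm; have /andP[] := h2 c.
Qed.

Lemma entropy_lin a : `|e1 a| <= L * `|a|.
Proof. by have := entropy_lip a 0; rewrite e10 !subr0. Qed.

(** The slope is taken at [b]. With [b] the value at the later time, this bounds the growth of the
    entropy from above. *)
Lemma entropy_convex a b : e0 b - e0 a <= e1 b * (b - a).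
Proof.
have [c hc ->] := MVT_between a b d0.
have [c' _ E] := MVT_between c b d1.
have /andP[p2 _] := h2 c'.
rewrite -subr_ge0 -mulrBl E -mulrA mulr_ge0//.
move: hc; have [ab|ba] := leP a b => /andP[h h'].
  by apply: mulr_ge0; lra.
by rewrite -mulrNN; apply: mulr_ge0; lra.
Qed.

Lemma entropy_ge0 a : 0 <= e0 a.
Proof. by have := entropy_convex a 0; rewrite e10 e00 mul0r; lra. Qed.

Lemma entropy_le a : e0 a <= L * a ^+ 2.
Proof.
have := entropy_convex 0 a; rewrite e00 !subr0 => /le_trans; apply.
rewrite (le_trans (ler_norm _))// normrM -real_normK ?num_real// expr2 mulrA ler_wpM2r//.
exact: entropy_lin.
Qed.
End entropy.

(** The cut-off in space: zero at the ends of [-N, N], close to 1 on bounded sets as N grows, with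
    slope at most 2 / N on the window. It is only integrated over [-N, N], where its zeros remove
    the boundary terms. *)
Definition parab (R : realType) (N x : R) : R := 1 - (x / N) ^+ 2.

Lemma parab_itv (R : realType) (N x : R) : 0 < N -> - N <= x -> x <= N -> 0 <= parab N x <= 1.
Proof.
move=> N0 h1 h2; have h : (x / N) ^+ 2 <= 1.
  rewrite -[_ ^+ 2]real_normK ?num_real// expr_le1// normf_div (gtr0_norm N0).
  by rewrite ler_pdivrMr// mul1r ler_norml h1.
by rewrite /parab subr_ge0 h gerBl sqr_ge0.
Qed.

Lemma is_derive_parab (R : realType) (N x : R) : is_derive x 1 (parab N) (- (2 * x / N ^+ 2)).
Proof.
have h1 : is_derive x 1 (fun x => x * N^-1) N^-1.
  have := is_deriveM (is_derive_id x (1 : R)) (is_derive_cst N^-1 x (1 : R)).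
  by rewrite scaler0 add0r /GRing.scale/= mulr1.
have := is_deriveB (is_derive_cst (1 : R) x (1 : R)) (is_deriveX 2 h1).
move=> h; apply: (is_derive_eq h).
by rewrite expr1 /GRing.scale/= sub0r; congr (- _); rewrite expr2 invfM; ring.
Qed.

Lemma parab_continuous (R : realType) (N : R) : continuous (parab N).
Proof. by move=> x; exact: is_derive_continuous (is_derive_parab N x). Qed.

Section entropy_time.
Context (R : realType).
Notation mu := (leb R).
Notation mu2 := (leb2 R).
Variables (p m ut M : R) (f f' : R -> R) (u v A : R -> R -> R).
Hypotheses (p1 : 1 < p) (M0 : 0 < M).
Hypotheses (df : forall y : R, is_derive y 1 f (f' y)) (cf' : continuous f').
Hypotheses (hdx : weak_dx u v) (hdA : weak_dx (flux p v) A) (heq : weak_equation p m f u v).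
Let w t x := u t x - ut.
Hypothesis hw : forall t : R, 0 <= t ->
  measurable_fun (setT : set (measurableTypeR R)) (w t) /\ L1 mu setT (fun x => w t x ^+ 2).
Hypothesis hc : forall s : R, 0 <= s -> forall e : R, 0 < e -> exists2 r : R, 0 < r &
  forall t : R, 0 <= t -> `|t - s| < r -> \int[mu]_x ((w t x - w s x) ^+ 2) <= e.
Hypothesis hM : forall t : R, 0 <= t -> {ae mu, forall x, `|w t x| <= M}.
Hypothesis hv : forall a b N : R, 0 < a -> L1 mu2 (rect a b (- N) N) (fun z => `|v z.1 z.2| `^ (p + 1)).
Hypothesis hA : forall a b N : R, 0 < a -> L1 mu2 (rect a b (- N) N) (fun z => A z.1 z.2 ^+ 2).

Variables (L : R) (e0 e1 e2 : R -> R).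
Hypotheses (d0 : forall y : R, is_derive y 1 e0 (e1 y)) (d1 : forall y : R, is_derive y 1 e1 (e2 y)).
Hypotheses (h2 : forall y, 0 <= e2 y <= L) (e10 : e1 0 = 0) (e00 : e0 0 = 0).

Local Notation wt := (wc ut M u).
Local Notation g := (gg m ut M f' u v A).

Let L0 : 0 <= L. Proof. by have /andP[/le_trans] := h2 0; apply. Qed.

(** [A] is square integrable, the speed is bounded, and v^2 <= 1 + |v|^(p+1) because p + 1 >= 2. *)
Lemma gg2_L1 (a b N : R) : 0 < a -> L1 mu2 (rect a b (- N) N) (fun z => g z.1 z.2 ^+ 2).
Proof.
move=> a0; have mR := measurable_rect a b (- N) N.
have [K hK] := speed_bounded ut u M0 cf'.
have ig := gg_rect_L1 m ut M0 cf' hdx hdA b N a0.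
apply: (@le_L1 _ _ _ mu2 _ _ (fun z => 2 * (m ^+ 2 * A z.1 z.2 ^+ 2 + K ^+ 2 * (1 + `|v z.1 z.2| `^ (p + 1))))) => //.
- by apply: measurable_funX; exact: (L1_measurable ig).
- move=> z _; rewrite ger0_norm ?sqr_ge0// [leRHS]ger0_norm; last first.
    by rewrite mulr_ge0// addr_ge0// mulr_ge0 ?sqr_ge0// addr_ge0 ?powR_ge0.
  have hv2 : v z.1 z.2 ^+ 2 <= 1 + `|v z.1 z.2| `^ (p + 1).
    rewrite -[_ ^+ 2]real_normK ?num_real//; set y := `|v _ _|.
    have y0 : 0 <= y by exact: normr_ge0.
    have [y1|y1] := leP y 1.
      by rewrite (le_trans (_ : _ <= 1)) ?expr_le1// lerDl powR_ge0.
    rewrite -powR_mulrn// (le_trans (_ : _ <= y `^ (p + 1)))//; last by rewrite lerDr.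
    by apply: ler_powR; [exact: ltW|move: p1; lra].
  have hs : speed ut M f' u z.1 z.2 ^+ 2 <= K ^+ 2.
    rewrite -[X in X <= _]real_normK ?num_real// ler_sqr ?nnegrE//.
    exact: le_trans (hK 0 0).
  have hvs : (v z.1 z.2 * speed ut M f' u z.1 z.2) ^+ 2 <= K ^+ 2 * (1 + `|v z.1 z.2| `^ (p + 1)).
    by rewrite exprMn mulrC ler_pM ?sqr_ge0.
  rewrite /gg.
  have := sqr_ge0 (m * A z.1 z.2 + v z.1 z.2 * speed ut M f' u z.1 z.2).
  rewrite -exprMn; move: hvs; set X := m * _; set Y := _ * speed _ _ _ _ _ _.
  set Z := K ^+ 2 * _; nra.
- apply: L1Z => //; apply: L1D => //; first by apply: L1Z => //; exact: hA.
  by apply: L1Z => //; apply: L1D => //; [apply: L1_cst => //; exact: rect_fin|exact: hv].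
Qed.

Let e1M t x : `|e1 (wt t x)| <= L * M.
Proof.
apply: (le_trans (entropy_lin d1 h2 e10 _)); rewrite ler_wpM2l//; exact: clamp_le.
Qed.

Let ce1 : continuous e1. Proof. by move=> y; exact: is_derive_continuous (d1 y). Qed.
Let ce0 : continuous e0. Proof. by move=> y; exact: is_derive_continuous (d0 y). Qed.

Let m_clamp d (T : measurableType d) (D : set T) (h : T -> R) (phi : R -> R) : continuous phi ->
  measurable_fun D h -> measurable_fun D (fun z => phi (clamp M (h z - ut))).
Proof.
move=> cphi mh; apply: (@measurableT_comp _ _ _ _ _ _ phi).
  exact: continuous_measurable_fun.
apply: (@measurableT_comp _ _ _ _ _ _ (clamp M)).
  by apply: continuous_measurable_fun; exact: clamp_continuous.
exact: measurable_funB.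
Qed.

Lemma L1_entropy (N t : R) : 0 < N -> 0 <= t -> L1 mu `[- N, N] (fun x => parab N x * e0 (wt t x)).
Proof.
move=> N0 t0; apply: (@L1_bounded _ _ _ mu _ (L * M ^+ 2)) => //; first exact: leb_cc_fin.
  apply: measurable_funM; apply: measurable_funTS.
    by apply: continuous_measurable_fun; exact: parab_continuous.
  by apply: m_clamp => //; exact: measurable_slice_u hw _ t0.
move=> x; rewrite /= in_itv/= => /andP[x1 x2]; have /andP[c0 c1] := parab_itv N0 x1 x2.
rewrite normrM (ger0_norm c0) -[leRHS]mul1r ler_pM// ger0_norm ?(entropy_ge0 d0 d1 h2)//.
apply: (le_trans (entropy_le d0 d1 h2 e10 e00 _)); rewrite ler_wpM2l//.
rewrite -[_ ^+ 2]real_normK ?num_real// ler_sqr ?nnegrE//; [exact: clamp_le|exact: ltW].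
Qed.

(** The formal time derivative of the integral of parab e0(w): the chain rule with [gg] in place of
    w_t. *)
Definition Gam (N t : R) := \int[mu]_(x in `[- N, N]) (g t x * (parab N x * e1 (wt t x))).

Let chi_e1_le N x y : 0 < N -> - N <= x -> x <= N -> `|y| <= L * M -> `|parab N x * y| <= L * M.
Proof.
move=> N0 x1 x2 hy; have /andP[c0 c1] := parab_itv N0 x1 x2.
by rewrite normrM (ger0_norm c0) -[leRHS]mul1r ler_pM.
Qed.

Lemma Gam_rect_L1 (a b N : R) : 0 < N -> 0 < a ->
  L1 mu2 (rect a b (- N) N) (fun z => g z.1 z.2 * (parab N z.2 * e1 (wt z.1 z.2))).
Proof.
move=> N0 a0; have mR := measurable_rect a b (- N) N.
apply: (L1M (K := L * M)) => //; first exact: (gg_rect_L1 m ut M0 cf' hdx hdA b N a0).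
- apply: measurable_funM; first by apply: continuous_measurable_snd => //; exact: parab_continuous.
  apply: m_clamp => //; apply: L1_measurable; have [iu _ _] := hdx.
  exact: locally_integrable2_rect iu.
- move=> z [_ /=]; rewrite in_itv/= => /andP[x1 x2]; exact: chi_e1_le.
Qed.

Lemma frozen_rect_L1 (a b N y : R) : 0 < N -> 0 < a -> 0 <= y ->
  L1 mu2 (rect a b (- N) N) (fun z => g z.1 z.2 * (parab N z.2 * e1 (wt y z.2))).
Proof.
move=> N0 a0 y0; have mR := measurable_rect a b (- N) N.
apply: (L1M (K := L * M)) => //; first exact: (gg_rect_L1 m ut M0 cf' hdx hdA b N a0).
- apply: measurable_funM; first by apply: continuous_measurable_snd => //; exact: parab_continuous.
  apply: measurable_funTS; apply: (@measurableT_comp _ _ _ _ _ _ (fun x => e1 (wt y x))) => //.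
  by apply: m_clamp => //; exact: measurable_slice_u hw _ y0.
- move=> z [_ /=]; rewrite in_itv/= => /andP[x1 x2]; exact: chi_e1_le.
Qed.

Let Q (N tau : R) := \int[mu]_(x in `[- N, N]) (g tau x ^+ 2).

Lemma L1_Gam (N a b : R) : 0 < N -> 0 < a -> L1 mu `[a, b] (Gam N).
Proof. by move=> N0 a0; exact: leb2_L1 (Gam_rect_L1 b N0 a0). Qed.

(** Convexity bounds the increment of e0(w) by e1(w(y)) (w(y) - w(z)), whose last factor is the time
    integral of [gg]. This is the integral of [H], that is, of [Gam] with e1(w) frozen at the later
    time [y]. Unfreezing costs L |g| |w(y) - w(tau)|, which Young splits with weight [e]: the L^2
    continuity contributes e^2 / e, the square of g contributes e Q. *)
Lemma entropy_local n (e x y z : R) : 0 < e -> 0 < z -> z < y ->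
  (forall tau, z <= tau -> tau <= y -> \int[mu]_x ((w y x - w tau x) ^+ 2) <= e ^+ 2) ->
  \int[mu]_(x in `[- n.+1%:R, n.+1%:R]) (parab n.+1%:R x * e0 (wt y x)) -
  \int[mu]_(x in `[- n.+1%:R, n.+1%:R]) (parab n.+1%:R x * e0 (wt z x)) -
  \int[mu]_(tau in `[z, y]) Gam n.+1%:R tau <=
  L / 2 * e * (y - z + \int[mu]_(tau in `[z, y]) Q n.+1%:R tau).
Proof.
move=> e_gt0 z0 zy hyz; set N : R := n.+1%:R.
have N0 : 0 < N by rewrite ltr0n.
have y0 : 0 <= y by lra.
have z0' : 0 <= z by lra.
have iy := L1_entropy N0 y0.
have iz := L1_entropy N0 z0'.
have iF := frozen_rect_L1 y N0 z0 y0.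
have iG := Gam_rect_L1 y N0 z0.
have iQ := gg2_L1 y N z0.
pose H tau := \int[mu]_(x in `[- N, N]) (g tau x * (parab N x * e1 (wt y x))).
have iH : L1 mu `[z, y] H by exact: leb2_L1 iF.
have iGam : L1 mu `[z, y] (Gam N) by exact: leb2_L1 iG.
have iQi : L1 mu `[z, y] (Q N) by exact: leb2_L1 iQ.
have step1 : \int[mu]_(x in `[- N, N]) (parab N x * e0 (wt y x)) -
  \int[mu]_(x in `[- N, N]) (parab N x * e0 (wt z x)) <= \int[mu]_(tau in `[z, y]) H tau.
  have ig := gg_rect_L1 m ut M0 cf' hdx hdA y N z0.
  have iP : L1 mu `[- N, N] (fun x => \int[mu]_(tau in `[z, y]) (g tau x * (parab N x * e1 (wt y x)))).
    exact: leb2_L2 iF.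
  rewrite -(leb2_fubini1 iF) (leb2_fubini2 iF) -RintegralB//.
  have mE : measurable_fun (`[- N, N] : set (measurableTypeR R))
      (fun x => parab N x * (e1 (wt y x) * (wt y x - wt z x))).
    have mc q (phi : R -> R) : 0 <= q -> continuous phi -> measurable_fun (setT : set (measurableTypeR R)) (fun x => phi (wt q x)).
      move=> q0 cphi; apply: (@measurableT_comp _ _ _ _ _ _ phi).
        exact: continuous_measurable_fun.
      apply: (@measurableT_comp _ _ _ _ _ _ (clamp M)).
        by apply: continuous_measurable_fun; exact: clamp_continuous.
      by have [] := hw q0.
    apply: measurable_funTS; apply: measurable_funM.
      by apply: continuous_measurable_fun; exact: parab_continuous.
    apply: measurable_funM; first exact: mc.
    by apply: measurable_funB; apply: (mc _ id) => // q; exact: cvg_id.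
  have eqE : {ae mu, forall x, `[- N, N]%classic x ->
     \int[mu]_(tau in `[z, y]) (g tau x * (parab N x * e1 (wt y x))) =
     parab N x * (e1 (wt y x) * (wt y x - wt z x))}.
    have a1 := increment_identity M0 df cf' hdx hdA heq hw hc hM n z0 zy.
    have a2 := hM y0; have a3 := hM z0'.
    apply: filterS (filterI (filterI a1 a2) (filterI a3 (leb2_slice2 ig))) => q [[h3 h4] [h5 h6]] qN.
    rewrite RintegralZr//; last exact: h6.
    rewrite -h3// /wc !clamp_id//; ring.
  rewrite (ae_eq_Rint _ (L1_measurable iP) mE eqE)//.
  apply: le_Rintegral => //; first exact: L1B.
    exact: (ae_eq_L1 _ mE eqE iP).
  move=> q; rewrite /= in_itv/= => /andP[q1 q2]; have /andP[c0 _] := parab_itv N0 q1 q2.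
  by rewrite -mulrBr ler_wpM2l//; exact: (entropy_convex d0 d1 h2).
have step2 : \int[mu]_(tau in `[z, y]) H tau - \int[mu]_(tau in `[z, y]) Gam N tau <=
   L / 2 * e * (y - z + \int[mu]_(tau in `[z, y]) Q N tau).
  rewrite -RintegralB// -[y - z]mul1r -Rint_cst_cc ?(ltW zy)//.
  have i1 : L1 mu `[z, y] (fun=> 1) by apply: L1_cst => //; exact: leb_cc_fin.
  rewrite -RintegralD// -RintegralZl//; last exact: L1D.
  have iR : L1 mu `[z, y] (fun tau => L / 2 * e * (1 + Q N tau)) by apply: L1Z => //; exact: L1D.
  apply: ae_le_Rint => //; first exact: L1B.
  apply: filterS (filterI (leb2_slice1 iF) (filterI (leb2_slice1 iG) (leb2_slice1 iQ))).
  move=> tau [h3 [h4 h5]] tzy; have i3 := h3 tzy; have i4 := h4 tzy; have i5 := h5 tzy.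
  have [ztau tauy] : z <= tau /\ tau <= y by move: tzy; rewrite /= in_itv/= => /andP[].
  have tau0 : 0 <= tau by lra.
  rewrite -RintegralB//.
  have idw : L1 mu `[- N, N] (fun x => (w y x - w tau x) ^+ 2).
    by apply: (L1S _ _ _ (L1_dw2 hw tau0 y0)).
  have iK : L1 mu `[- N, N] (fun x => L / 2 * (e^-1 * (w y x - w tau x) ^+ 2 + e * g tau x ^+ 2)).
    by apply: L1Z => //; apply: L1D => //; exact: L1Z.
  apply: (@le_trans _ _ (\int[mu]_(x in `[- N, N]) (L / 2 * (e^-1 * (w y x - w tau x) ^+ 2 + e * g tau x ^+ 2)))).
    apply: le_Rintegral => //; first exact: L1B.
    move=> q; rewrite /= in_itv/= => /andP[q1 q2]; have /andP[c0 c1] := parab_itv N0 q1 q2.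
    rewrite -mulrBr -mulrBr (le_trans (ler_norm _))// !normrM (ger0_norm c0).
    have hl : `|e1 (wt y q) - e1 (wt tau q)| <= L * `|w y q - w tau q|.
      apply: (le_trans (entropy_lip d1 h2 _ _)); rewrite ler_wpM2l// (le_trans (clampB M0 _ _))//.
    have hy : 2 * (`|g tau q| * `|w y q - w tau q|) <= e^-1 * (w y q - w tau q) ^+ 2 + e * g tau q ^+ 2.
      exact: le_young_prod.
    apply: (@le_trans _ _ (`|g tau q| * (1 * (L * `|w y q - w tau q|)))).
      by rewrite ler_wpM2l// ler_pM.
    rewrite mul1r mulrCA -mulrA ler_wpM2l//.
    by rewrite ler_pdivlMl.
  rewrite RintegralZl//; last by apply: L1D => //; exact: L1Z.
  rewrite -[leRHS]mulrA ler_wpM2l ?divr_ge0// RintegralD//; [|exact: L1Z|exact: L1Z].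
  rewrite !RintegralZl// mulrDr mulr1 lerD2r.
  rewrite ler_pdivrMl// -expr2; apply: le_trans (hyz tau ztau tauy).
  by apply: Rint_subset_le => //; [exact: L1_dw2|move=> *; exact: sqr_ge0].
by apply: le_trans step2; rewrite lerD2r.
Qed.

(* [w] has no pointwise time derivative: convexity bounds the increments between
   two close times by [Gam] up to a small multiple of [y - z + int Q], and
   [local_to_global] sums these up. *)
Lemma entropy_time n (s T : R) : 0 < s -> s <= T ->
  \int[mu]_(x in `[- n.+1%:R, n.+1%:R]) (parab n.+1%:R x * e0 (wt T x)) <=
  \int[mu]_(x in `[- n.+1%:R, n.+1%:R]) (parab n.+1%:R x * e0 (wt s x)) +
  \int[mu]_(tau in `[s, T]) Gam n.+1%:R tau.
Proof.
move=> s0 sT; set N : R := n.+1%:R.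
have N0 : 0 < N by rewrite ltr0n.
have iGam : L1 mu `[s, T] (Gam N) by exact: L1_Gam.
have iQi : L1 mu `[s, T] (Q N) by exact: leb2_L1 (gg2_L1 T N s0).
pose D t := \int[mu]_(x in `[- N, N]) (parab N x * e0 (wt t x)) - \int[mu]_(tau in `[s, t]) Gam N tau.
(* The error in [entropy_local] is [e] times the increment of this function, as [local_to_global]
   requires. *)
pose mm t := L / 2 * (t + \int[mu]_(tau in `[s, t]) Q N tau).
suff : D T <= D s by rewrite /D set_itv1 Rintegral_set1 subr0 lerBlDr.
apply: (@local_to_global _ s T D mm sT) => e e_gt0 x sx xT.
have x0 : 0 <= x by lra.
(* The times [y] and [tau] are both compared with [x], and [sqr_sub_le] turns two errors e^2 / 4
   into e^2. *)
have e24 : 0 < e ^+ 2 / 4 by rewrite divr_gt0// exprn_gt0.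
have [r r0 hr] := hc x0 e24.
exists r => // z y sz zx xy yT yzr.
have sub (h : R -> R) : L1 mu `[s, T] h -> z <= y -> \int[mu]_(tau in `[s, y]) h tau =
   \int[mu]_(tau in `[s, z]) h tau + \int[mu]_(tau in `[z, y]) h tau.
  move=> ih zy; apply: Rint_cc_split => //.
  by apply: (L1S _ _ _ ih) => //; exact: subset_cc.
have zy : z <= y by lra.
rewrite /D /mm !(sub _ _ zy)//.
have [zeq|zlt] := eqVneq z y.
  by rewrite zeq set_itv1 !Rintegral_set1 !addr0 !subrr mulr0.
have {zlt} zlt : z < y by rewrite lt_neqAle zlt.
have z0 : 0 < z by lra.
have := @entropy_local n e x y z e_gt0 z0 zlt; rewrite -/N => h.
have hh : forall tau : R, z <= tau -> tau <= y -> \int[mu]_x ((w y x - w tau x) ^+ 2) <= e ^+ 2.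
  move=> tau ztau tauy; have tau0 : 0 <= tau := le_trans (ltW z0) ztau.
  have y0 : 0 <= y := le_trans x0 xy.
  have h3 : \int[mu]_q ((w y q - w x q) ^+ 2) <= e ^+ 2 / 4.
    by apply: hr => //; exact: (itv_dist zx xy).
  have h4 : \int[mu]_q ((w tau q - w x q) ^+ 2) <= e ^+ 2 / 4.
    by apply: hr => //; exact: (itv_dist zx xy).
  have i1 := L1_dw2 hw x0 y0; have i2 := L1_dw2 hw x0 tau0.
  apply: (@le_trans _ _ (\int[mu]_q (2 * ((w y q - w x q) ^+ 2 + (w tau q - w x q) ^+ 2)))).
    apply: le_Rintegral => //; [exact: L1_dw2|by apply: L1Z => //; exact: L1D|].
    by move=> q _; exact: sqr_sub_le.
  rewrite RintegralZl//; last exact: L1D.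
  by rewrite RintegralD//; exact: two_quarter.
have := h hh; set X := \int[mu]_(tau in `[z, y]) Gam N tau; set Y := \int[mu]_(tau in `[z, y]) Q N tau.
set a1 := \int[mu]_(tau in `[s, z]) Gam N tau; set b1 := \int[mu]_(tau in `[s, z]) Q N tau.
set c1 := \int[mu]_(x in `[- N, N]) _; set c2 := \int[mu]_(x in `[- N, N]) _ => {}h.
move: c1 c2 X Y a1 b1 h => c1 c2 X Y a1 b1 h.
have -> : e * (L / 2 * (y + (b1 + Y)) - L / 2 * (z + b1)) = L / 2 * e * (y - z + Y) by ring.
lra.
Qed.
End entropy_time.

Lemma flux_mul (R : realType) (p : R) (v : R -> R -> R) t x : 1 < p ->
  flux p v t x * v t x = `|v t x| `^ (p + 1) /\ `|flux p v t x| = `|v t x| `^ p.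
Proof.
move=> p1; rewrite /flux; set y := v t x.
have [->|y0] := eqVneq y 0.
  rewrite !mulr0 !normr0 !powR0 ?normr0//; rewrite gt_eqF//; lra.
have y0' : 0 < `|y| by rewrite normr_gt0.
have ny := gt_eqF y0'; split.
  rewrite -mulrA -expr2 -real_normK ?num_real// -powR_mulrn// -powRD ?ny ?implybT//.
  by congr powR; lra.
rewrite normrM ger0_norm ?powR_ge0// -{2}[`|y|]powRr1// -powRD ?ny ?implybT//.
by congr powR; lra.
Qed.

(** If a <= b, then a b^p <= b^(p+1); otherwise a b^p <= a^(p-1) a^2 with a <= M. For a = |w| and b
    = |v| it bounds a cut-off error by the mass and energy densities, both integrable over the
    line. *)
Lemma young_flux (R : realType) (p M a b : R) : 1 < p -> 0 < M -> 0 <= a -> a <= M -> 0 <= b ->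
  a * b `^ p <= M `^ (p - 1) * a ^+ 2 + b `^ (p + 1).
Proof.
move=> p1 M0 a0 aM b0.
have mp x : 0 <= x -> x * x `^ p = x `^ (p + 1).
  move=> x0; have p10 : 0 < p + 1 by lra.
  by have := mulr_powRB1 x0 p10; rewrite addrK.
have [ab|ba] := leP a b.
  apply: ler_wpDl; first by rewrite mulr_ge0 ?powR_ge0 ?sqr_ge0.
  by rewrite -mp// ler_wpM2r ?powR_ge0.
apply: ler_wpDr; first by rewrite powR_ge0.
apply: (@le_trans _ _ (a * a `^ p)).
  by rewrite ler_wpM2l// ge0_ler_powR ?nnegrE// ?(ltW ba)//; lra.
rewrite -mulr_powRB1//; last by lra.
rewrite mulrA mulrC -expr2 ler_wpM2r ?sqr_ge0// ge0_ler_powR ?nnegrE ?(ltW M0)//; lra.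
Qed.

(** * Entropy production on a time slice *)

Section entropy_slice.
Context (R : realType).
Notation mu := (leb R).
Notation mu2 := (leb2 R).
Variables (p m ut M : R) (f f' : R -> R) (u v A : R -> R -> R).
Hypotheses (p1 : 1 < p) (m0 : 0 < m) (M0 : 0 < M).
Hypotheses (df : forall y : R, is_derive y 1 f (f' y)) (cf' : continuous f').
Hypotheses (hdx : weak_dx u v) (hdA : weak_dx (flux p v) A) (heq : weak_equation p m f u v).
Let w t x := u t x - ut.
Hypothesis hw : forall t : R, 0 <= t ->
  measurable_fun (setT : set (measurableTypeR R)) (w t) /\ L1 mu setT (fun x => w t x ^+ 2).
Hypothesis hc : forall s : R, 0 <= s -> forall e : R, 0 < e -> exists2 r : R, 0 < r &
  forall t : R, 0 <= t -> `|t - s| < r -> \int[mu]_x ((w t x - w s x) ^+ 2) <= e.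
Hypothesis hM : forall t : R, 0 <= t -> {ae mu, forall x, `|w t x| <= M}.
Hypothesis hv : forall a b N : R, 0 < a -> L1 mu2 (rect a b (- N) N) (fun z => `|v z.1 z.2| `^ (p + 1)).
Hypothesis hA : forall a b N : R, 0 < a -> L1 mu2 (rect a b (- N) N) (fun z => A z.1 z.2 ^+ 2).

Variables (L : R) (e0 e1 e2 : R -> R).
Hypotheses (d0 : forall y : R, is_derive y 1 e0 (e1 y)) (d1 : forall y : R, is_derive y 1 e1 (e2 y)).
Hypotheses (ce2 : continuous e2) (h2 : forall y, 0 <= e2 y <= L) (e10 : e1 0 = 0) (e00 : e0 0 = 0).

Local Notation wt := (wc ut M u).
Local Notation g := (gg m ut M f' u v A).

Let L0 : 0 <= L. Proof. by have /andP[/le_trans] := h2 0; apply. Qed.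

(** Makes convection an exact derivative: where |w| <= M, e1(w) f'(u) v is the x-derivative of
    Phi(w). The normalization Phi(0) = 0 and |e1(y)| <= L |y| give the quadratic bound, so Phi(w) is
    controlled by the mass. *)
Lemma entropy_flux : exists Phi c K, [/\ forall y : R, is_derive y 1 Phi (c y), continuous c,
   forall y, `|y| <= M -> c y = e1 y * f' (ut + y), 0 <= K &
   forall y, `|y| <= M -> `|Phi y| <= K * y ^+ 2].
Proof.
(* A continuous switch, 0 below -(M + 1) and 1 on [-M, M]. It lets the primitive start at minus
   infinity without changing the integrand at the values taken by [w]. *)
pose th (y : R) : R := Num.max 0 (Num.min 1 (y + (M + 1))).
have cth : continuous th.
  move=> y; apply: (@continuous_max _ _ (cst 0) (fun y => Num.min 1 (y + (M + 1)))).
    exact: cst_continuous.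
  apply: (@continuous_min _ _ (cst 1) (fun y => y + (M + 1))); first exact: cst_continuous.
  by apply: cvgD; [exact: cvg_id|exact: cvg_cst].
have cs : continuous (fun y => f' (ut + y)).
  move=> y; apply: continuous_comp; last exact: cf'.
  by apply: cvgD; [exact: cvg_cst|exact: cvg_id].
have ce1 : continuous e1 by move=> y; exact: is_derive_continuous (d1 y).
pose c y := e1 y * f' (ut + y) * th y.
have cc : continuous c.
  by move=> y; apply: cvgM; [apply: cvgM; [exact: ce1|exact: cs]|exact: cth].
have c0 y : y <= - (M + 1) -> c y = 0.
  move=> yM; rewrite /c (_ : th y = 0) ?mulr0//.
  by apply/max_idPl; rewrite ge_min; apply/orP; right; lra.
have [dP _] := prim_left cc c0.
set P := fun y => _ in dP.
have [K hK] := @continuous_bounded_itv _ (- M) M _ cs.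
have K0 : 0 <= K by apply: le_trans (hK 0 _) => //; rewrite /= in_itv/= oppr_le0 !ltW.
have th1 y : `|y| <= M -> th y = 1.
  rewrite ler_norml => /andP[y1 y2].
  have e : Num.min 1 (y + (M + 1)) = 1 by apply/min_idPl; lra.
  by rewrite /th e; apply/max_idPr.
exists (fun y => P y - P 0), c, (L * K); split.
- move=> y; have := is_deriveB (dP y) (is_derive_cst (P 0) y (1 : R)).
  by rewrite subr0.
- exact: cc.
- by move=> y hy; rewrite /c th1// mulr1.
- exact: mulr_ge0.
- move=> y hy; have [x hx ->] := MVT_between 0 y dP.
  have xy : `|x| <= `|y|.
    move: hx; have [h|h] := leP 0 y => /andP[h3 h4].
      by rewrite !ger0_norm.
    by rewrite (ler0_norm h4) (ltr0_norm h) lerN2.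
  have xM : `|x| <= M by exact: le_trans hy.
  rewrite subr0 normrM -real_normK ?num_real// expr2 mulrA ler_wpM2r//.
  rewrite /c th1// mulr1 normrM.
  apply: (@le_trans _ _ ((L * `|y|) * K)); last by rewrite mulrAC.
  apply: ler_pM => //; last by apply: hK; rewrite /= in_itv/= -ler_norml.
  by rewrite (le_trans (entropy_lin d1 h2 e10 _))// ler_wpM2l.
Qed.

Definition Dis (N t : R) := \int[mu]_(x in `[- N, N]) (parab N x * e2 (wt t x) * `|v t x| `^ (p + 1)).

(** Integration by parts turns [Gam] into minus the dissipation plus the integral of parab' (Phi(w)
    - m e1(w) flux). As |parab'| <= 2 / N, the error is 2 / N times a combination of mass and
    energy. Their bounds do not depend on time, hence one [C] for all [n] and [t]. *)
Lemma entropy_slice K2 Kv : 0 <= K2 -> 0 <= Kv -> exists2 C, 0 <= C & forall n t,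
  good p ut M u v A t -> \int[mu]_x (w t x ^+ 2) <= K2 ->
  L1 mu setT (fun x => `|v t x| `^ (p + 1)) -> \int[mu]_x (`|v t x| `^ (p + 1)) <= Kv ->
  Gam m ut M f' u v A e1 n.+1%:R t <= - m * Dis n.+1%:R t + C / n.+1%:R.
Proof.
move=> K20 Kv0; have [Phi [c [K [dPhi cc hcE K0 hPhi]]]] := entropy_flux.
pose c1 := m * L * M `^ (p - 1) + K; pose c2 := m * L.
have c20 : 0 <= c2 by rewrite mulr_ge0// ltW.
have c10 : 0 <= c1 by rewrite addr_ge0// mulr_ge0 ?powR_ge0.
exists (2 * (c1 * K2 + c2 * Kv)); first by rewrite mulr_ge0// addr_ge0// mulr_ge0.
move=> n t gt hK2 iv hKv; set N : R := n.+1%:R.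
have N0 : 0 < N by rewrite ltr0n.
have NN : - N <= N by lra.
have [t0 hu /(_ n)[W1 [W2 [a1 a2 ifl b1 b2]]]] := gt; rewrite -/N in a1 a2 b1 b2 ifl.
have t0' : 0 <= t := ltW t0.
have ce1 : continuous e1 by move=> q; exact: is_derive_continuous (d1 q).
have [mw iw] := hw t0'.
have [Ks hKs] := speed_bounded ut u M0 cf'.
have dpar (x : R) : is_derive x 1 (parab N) (- (2 * x / N ^+ 2)) by exact: is_derive_parab.
have cdpar : continuous (fun x : R => - (2 * x / N ^+ 2)).
  move=> x; apply: cvgN; apply: cvgM; last exact: cvg_cst.
  by apply: cvgM; [exact: cvg_cst|exact: cvg_id].
pose w1 x := W1 x - ut.
have w1AC : AC (- N) N w1 (v t).
  have := ACD a1 (@AC_smooth R (- N) N (fun=> - ut) (fun=> 0) NN (fun y => is_derive_cst (- ut) y (1 : R)) (fun y => @cst_continuous R R 0 y)).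
  by apply: eq_AC => x; rewrite ?addr0.
have parAC := AC_smooth NN dpar cdpar.
have aAC := ACM NN parAC (AC_comp NN w1AC d1 ce2).
(* The x-derivative of parab (m e1(w) flux - Phi(w)), which vanishes at both ends of the window. Its
   integral is zero and may be subtracted from that of [gterm]. *)
pose dens x := m * (parab N x * e1 (w1 x) * A t x +
    (parab N x * (e2 (w1 x) * v t x) + - (2 * x / N ^+ 2) * e1 (w1 x)) * W2 x) +
  -1 * (parab N x * (c (w1 x) * v t x) + - (2 * x / N ^+ 2) * Phi (w1 x)).
have FAC : AC (- N) N _ dens := ACD (ACZ m (ACM NN aAC a2)) (ACZ (- 1) (ACM NN parAC (AC_comp NN w1AC dPhi cc))).
have par1 : parab N N = 0 by rewrite /parab divff ?gt_eqF// expr1n subrr.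
have par2 : parab N (- N) = 0 by rewrite /parab mulNr divff ?gt_eqF// sqrrN expr1n subrr.
have Idens : \int[mu]_(x in `[- N, N]) dens x = 0.
  rewrite -(AC_sub FAC (lexx _) NN (lexx _)) par1 par2.
  by rewrite !mul0r !mulr0 subrr.
have idens : L1 mu `[- N, N] dens by exact: FAC.1.
pose gterm x := g t x * (parab N x * e1 (wt t x)).
have mwt (phi : R -> R) : continuous phi -> measurable_fun (setT : set (measurableTypeR R)) (fun x => phi (wt t x)).
  move=> cphi; apply: (@measurableT_comp _ _ _ _ _ _ phi); first exact: continuous_measurable_fun.
  apply: (@measurableT_comp _ _ _ _ _ _ (clamp M)) => //.
  by apply: continuous_measurable_fun; exact: clamp_continuous.
have parN x : `[- N, N]%classic x -> 0 <= parab N x <= 1.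
  by rewrite /= in_itv/= => /andP[x1 x2]; exact: parab_itv.
have mpar : measurable_fun (setT : set (measurableTypeR R)) (parab N).
  by apply: continuous_measurable_fun; exact: parab_continuous.
have igterm : L1 mu `[- N, N] gterm.
  apply: (L1M (K := L * M)) => //; first exact: (gg_L1 m M0 cf' hw n gt).
    by apply: measurable_funTS; apply: measurable_funM => //; exact: mwt.
  move=> x /parN /andP[p0 p1']; rewrite normrM (ger0_norm p0) -[leRHS]mul1r ler_pM//.
  by rewrite (le_trans (entropy_lin d1 h2 e10 _))// ler_wpM2l// clamp_le.
have iv' : L1 mu `[- N, N] (fun x => `|v t x| `^ (p + 1)) by apply: (L1S _ _ _ iv).
have iw' : L1 mu `[- N, N] (fun x => w t x ^+ 2) by apply: (L1S _ _ _ iw).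
have iDis : L1 mu `[- N, N] (fun x => parab N x * e2 (wt t x) * `|v t x| `^ (p + 1)).
  rewrite (_ : (fun _ => _) = (fun x => `|v t x| `^ (p + 1) * (parab N x * e2 (wt t x)))).
    apply: (L1M (K := L)) => //.
      by apply: measurable_funTS; apply: measurable_funM => //; exact: mwt.
    move=> x /parN /andP[p0 p1']; have /andP[q0 q1] := h2 (wt t x).
    by rewrite ger0_norm ?mulr_ge0// -[leRHS]mul1r ler_pM.
  by apply/funext => x; rewrite mulrC.
pose E x := c1 * w t x ^+ 2 + c2 * `|v t x| `^ (p + 1).
have iE : L1 mu `[- N, N] E by apply: L1D => //; exact: L1Z.
pose B x := - m * (parab N x * e2 (wt t x) * `|v t x| `^ (p + 1)) + 2 / N * E x.
have iB : L1 mu `[- N, N] B by apply: L1D => //; exact: L1Z.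
have : Gam m ut M f' u v A e1 N t <= \int[mu]_(x in `[- N, N]) B x.
  rewrite /Gam -[leLHS]subr0 -Idens -RintegralB//.
  apply: ae_le_Rint => //; first exact: L1B.
  apply: filterS (filterI (filterI hu (hM t0')) (filterI b1 b2)) => x [[h3 h4] [h5 h6]] xN.
  have {}h5 := h5 xN; have {}h6 := h6 xN.
  have hwx : w t x = wt t x by rewrite /wc clamp_id.
  have hw1 : w1 x = wt t x by rewrite /w1 -h5.
  have yM : `|wt t x| <= M by exact: clamp_le.
  have [fm fa] := flux_mul v t x p1.
  rewrite /dens /= hw1 -h6 /gg /speed hcE// /B /E hwx.
  set y := wt t x; set P := parab N x; set P' := - (2 * x / N ^+ 2).
  (* The terms in [A] and in f' cancel exactly; the dissipation and the cut-off error remain. *)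
  have -> : (m * A t x - v t x * f' (ut + y)) * (P * e1 y) -
    (m * (P * e1 y * A t x + (P * (e2 y * v t x) + P' * e1 y) * flux p v t x) +
     -1 * (P * (e1 y * f' (ut + y) * v t x) + P' * Phi y)) =
    - m * (P * e2 y * (flux p v t x * v t x)) + P' * (Phi y - m * (e1 y * flux p v t x)) by ring.
  rewrite fm lerD2l (le_trans (ler_norm _))// normrM.
  have hP' : `|P'| <= 2 / N.
    move: xN; rewrite /= in_itv/= => /andP[x1 x2].
    have xN : `|x| <= N by rewrite ler_norml x1.
    have -> : `|P'| = 2 * (`|x| / N ^+ 2).
      by rewrite /P' normrN !normrM normfV normrX (gtr0_norm N0) (ger0_norm (_ : 0 <= 2))// mulrA.
    apply: ler_wpM2l => //; rewrite ler_pdivrMr ?exprn_gt0//.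
    by rewrite expr2 mulKf// gt_eqF.
  apply: ler_pM => //.
  apply: (le_trans (ler_normB _ _)); rewrite normrM (gtr0_norm m0) normrM fa.
  have y1 : `|y| * `|v t x| `^ p <= M `^ (p - 1) * y ^+ 2 + `|v t x| `^ (p + 1).
    by rewrite -[y ^+ 2]real_normK ?num_real//; exact: young_flux.
  have y2 : m * (`|e1 y| * `|v t x| `^ p) <= m * L * (M `^ (p - 1) * y ^+ 2 + `|v t x| `^ (p + 1)).
    rewrite -mulrA ler_pM2l//; apply: (@le_trans _ _ (L * (`|y| * `|v t x| `^ p))).
      by rewrite mulrA ler_wpM2r ?powR_ge0//; exact: (entropy_lin d1 h2 e10).
    by rewrite ler_wpM2l.
  apply: (le_trans (lerD (hPhi y yM) y2)).
  by rewrite le_eqVlt; apply/orP; left; apply/eqP; rewrite /c1 /c2; ring.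
move=> /le_trans; apply.
rewrite RintegralD//; [|exact: L1Z|exact: L1Z].
rewrite !RintegralZl// lerD2l RintegralD//; [|exact: L1Z|exact: L1Z].
rewrite !RintegralZl// mulrAC ler_wpM2r ?invr_ge0 ?(ltW N0)// ler_wpM2l// lerD//.
  rewrite ler_wpM2l//; apply: le_trans hK2; apply: Rint_subset_le => // *; exact: sqr_ge0.
rewrite ler_wpM2l//; apply: le_trans hKv; apply: Rint_subset_le => // *; exact: powR_ge0.
Qed.
End entropy_slice.

(** * Entropy inequality on the whole line *)

Section energy_inequality.
Context (R : realType).
Notation mu := (leb R).
Notation mu2 := (leb2 R).
Variables (p m ut M : R) (f f' : R -> R) (u v A : R -> R -> R).
Hypotheses (p1 : 1 < p) (m0 : 0 < m) (M0 : 0 < M).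
Hypotheses (df : forall y : R, is_derive y 1 f (f' y)) (cf' : continuous f').
Hypotheses (hdx : weak_dx u v) (hdA : weak_dx (flux p v) A) (heq : weak_equation p m f u v).
Let w t x := u t x - ut.
Hypothesis hw : forall t : R, 0 <= t ->
  measurable_fun (setT : set (measurableTypeR R)) (w t) /\ L1 mu setT (fun x => w t x ^+ 2).
Hypothesis hc : forall s : R, 0 <= s -> forall e : R, 0 < e -> exists2 r : R, 0 < r &
  forall t : R, 0 <= t -> `|t - s| < r -> \int[mu]_x ((w t x - w s x) ^+ 2) <= e.
Hypothesis hM : forall t : R, 0 <= t -> {ae mu, forall x, `|w t x| <= M}.
Hypothesis hv : forall a b N : R, 0 < a -> L1 mu2 (rect a b (- N) N) (fun z => `|v z.1 z.2| `^ (p + 1)).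
Hypothesis hA : forall a b N : R, 0 < a -> L1 mu2 (rect a b (- N) N) (fun z => A z.1 z.2 ^+ 2).

Variables (K2 Kv : R).
Hypotheses (K20 : 0 <= K2) (Kv0 : 0 <= Kv).
Hypothesis hK2 : {ae mu, forall t, 0 < t -> \int[mu]_x (w t x ^+ 2) <= K2}.
Hypothesis hKv : {ae mu, forall t, 0 < t -> L1 mu setT (fun x => `|v t x| `^ (p + 1)) /\
   \int[mu]_x (`|v t x| `^ (p + 1)) <= Kv}.

Variables (L : R) (e0 e1 e2 : R -> R).
Hypotheses (d0 : forall y : R, is_derive y 1 e0 (e1 y)) (d1 : forall y : R, is_derive y 1 e1 (e2 y)).
Hypotheses (ce2 : continuous e2) (h2 : forall y, 0 <= e2 y <= L) (e10 : e1 0 = 0) (e00 : e0 0 = 0).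

Local Notation wt := (wc ut M u).

Let L0 : 0 <= L. Proof. by have /andP[/le_trans] := h2 0; apply. Qed.

Let mwt t (phi : R -> R) : 0 <= t -> continuous phi ->
  measurable_fun (setT : set (measurableTypeR R)) (fun x => phi (wt t x)).
Proof.
move=> t0 cphi; have [mw _] := hw t0.
apply: (@measurableT_comp _ _ _ _ _ _ phi); first exact: continuous_measurable_fun.
apply: (@measurableT_comp _ _ _ _ _ _ (clamp M)) => //.
by apply: continuous_measurable_fun; exact: clamp_continuous.
Qed.

Let ce0 : continuous e0. Proof. by move=> y; exact: is_derive_continuous (d0 y). Qed.

Lemma L1_e0 t : 0 <= t -> L1 mu setT (fun x => e0 (wt t x)).
Proof.
move=> t0; have [mw iw] := hw t0.
apply: (@le_L1 _ _ _ mu _ _ (fun x => L * w t x ^+ 2)) => //; last exact: L1Z.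
  exact: mwt.
have q x : 0 <= L * w t x ^+ 2 by apply: mulr_ge0 => //; exact: sqr_ge0.
move=> x _; rewrite ger0_norm ?(entropy_ge0 d0 d1 h2)// (ger0_norm (q x)).
apply: (le_trans (entropy_le d0 d1 h2 e10 e00 _)); rewrite ler_wpM2l//.
rewrite -[leLHS]real_normK ?num_real// -[leRHS]real_normK ?num_real// ler_sqr ?nnegrE//.
have := clampB M0 (w t x) 0.
have cl0 : clamp M 0 = 0 by apply: clamp_id; rewrite normr0 ltW.
by rewrite cl0 !subr0.
Qed.

Lemma Dis_rect_L1 (a b N : R) (h : R -> R) : 0 < N -> 0 < a -> continuous h ->
  (forall x, - N <= x -> x <= N -> 0 <= h x <= 1) ->
  L1 mu2 (rect a b (- N) N) (fun z => h z.2 * e2 (wt z.1 z.2) * `|v z.1 z.2| `^ (p + 1)).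
Proof.
move=> N0 a0 ch hh; have mR := measurable_rect a b (- N) N.
rewrite (_ : (fun _ => _) = (fun z => `|v z.1 z.2| `^ (p + 1) * (h z.2 * e2 (wt z.1 z.2)))); last first.
  by apply/funext => z; rewrite mulrC.
apply: (L1M (K := L)) => //; first exact: hv.
- apply: measurable_funM; first exact: continuous_measurable_snd.
  apply: (@measurableT_comp _ _ _ _ _ _ e2); first exact: continuous_measurable_fun.
  apply: (@measurableT_comp _ _ _ _ _ _ (clamp M)).
    by apply: continuous_measurable_fun; exact: clamp_continuous.
  apply: measurable_funB => //; apply: L1_measurable; have [iu _ _] := hdx.
  exact: locally_integrable2_rect iu.
- move=> z [_ /=]; rewrite in_itv/= => /andP[x1 x2]; have /andP[p0 p1'] := hh _ x1 x2.
  have /andP[q0 q1] := h2 (wt z.1 z.2).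
  by rewrite ger0_norm ?mulr_ge0// -[leRHS]mul1r ler_pM.
Qed.

Lemma energy_N : exists2 C, 0 <= C & forall n (s T : R), 0 < s -> s <= T ->
  \int[mu]_(x in `[- n.+1%:R, n.+1%:R]) (parab n.+1%:R x * e0 (wt T x)) +
  m * \int[mu]_(tau in `[s, T]) Dis p ut M u v e2 n.+1%:R tau <=
  \int[mu]_(x in `[- n.+1%:R, n.+1%:R]) (parab n.+1%:R x * e0 (wt s x)) + C * (T - s) / n.+1%:R.
Proof.
have [C C0 hC] := entropy_slice v A p1 m0 M0 cf' hw hM d1 ce2 h2 e10 K20 Kv0.
exists C => // n s T s0 sT.
have N0 : 0 < n.+1%:R :> R by rewrite ltr0n.
have := entropy_time p1 M0 df cf' hdx hdA heq hw hc hM hv hA d0 d1 h2 e10 e00 n s0 sT.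
have iG : L1 mu `[s, T] (Gam m ut M f' u v A e1 n.+1%:R).
  exact: leb2_L1 (Gam_rect_L1 m ut M0 cf' hdx hdA d1 h2 e10 T N0 s0).
have iD : L1 mu `[s, T] (Dis p ut M u v e2 n.+1%:R).
  apply: leb2_L1 (Dis_rect_L1 T N0 s0 (@parab_continuous _ _) _).
  by move=> x x1 x2; exact: parab_itv.
have : \int[mu]_(tau in `[s, T]) Gam m ut M f' u v A e1 n.+1%:R tau <=
   \int[mu]_(tau in `[s, T]) (- m * Dis p ut M u v e2 n.+1%:R tau + C / n.+1%:R).
  apply: ae_le_Rint => //.
    by apply: L1D => //; [exact: L1Z|apply: L1_cst => //; exact: leb_cc_fin].
  apply: filterS (filterI (ae_good hdx hdA hM) (filterI hK2 hKv)) => tau [h3 [h4 h5]].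
  rewrite /= in_itv/= => /andP[stau _]; have tau0 : 0 < tau := lt_le_trans s0 stau.
  have [i5 {}h5] := h5 tau0.
  by apply: hC => //; [exact: h3|exact: h4].
rewrite RintegralD//; [|exact: L1Z|by apply: L1_cst => //; exact: leb_cc_fin].
rewrite RintegralZl// Rint_cst_cc// mulNr.
move=> h3 h4; rewrite -lerBrDr; apply: (le_trans h4).
rewrite -addrA lerD2l; apply: (le_trans h3).
by rewrite addrC mulrAC.
Qed.

(** Two windows: the left side stays on [-N0, N0] while the cut-off window [-N, N] grows. On the
    small one parab is at least 1 - (N0/N)^2, so [X <= Y] holds up to errors of order 1 / N. *)
Lemma energy_ineq n0 (s T : R) : 0 < s -> s <= T ->
  \int[mu]_(x in `[- n0.+1%:R, n0.+1%:R]) e0 (wt T x) +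
  m * \int[mu]_(tau in `[s, T]) \int[mu]_(x in `[- n0.+1%:R, n0.+1%:R]) (e2 (wt tau x) * `|v tau x| `^ (p + 1)) <=
  \int[mu]_x e0 (wt s x).
Proof.
move=> s0 sT; set N0 : R := n0.+1%:R.
have N00 : 0 < N0 by rewrite ltr0n.
have [C C0 hC] := energy_N.
have T0 : 0 <= T := le_trans (ltW s0) sT.
have s0' : 0 <= s := ltW s0.
have iD0 : L1 mu2 (rect s T (- N0) N0) (fun z => e2 (wt z.1 z.2) * `|v z.1 z.2| `^ (p + 1)).
  have := @Dis_rect_L1 s T N0 (cst 1) N00 s0 (fun x => @cst_continuous R R 1 x) _.
  have h1 : forall x : R, - N0 <= x -> x <= N0 -> 0 <= (cst 1 x : R) <= 1 by move=> x _ _ /=; rewrite ler01 lexx.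
  move=> /(_ h1); apply: eq_L1; first exact: measurable_rect.
  by move=> z _ /=; rewrite mul1r.
pose V tau := \int[mu]_(x in `[- N0, N0]) (e2 (wt tau x) * `|v tau x| `^ (p + 1)).
have iV : L1 mu `[s, T] V by exact: leb2_L1 iD0.
have e0p y : 0 <= e0 y by exact: (entropy_ge0 d0 d1 h2).
have dp tau x : 0 <= e2 (wt tau x) * `|v tau x| `^ (p + 1).
  by have /andP[q _] := h2 (wt tau x); rewrite mulr_ge0 ?powR_ge0.
set X := _ + m * _; set Y := \int[mu]_x _.
have X0 : 0 <= X.
  apply: addr_ge0; first by apply: Rintegral_ge0.
  by apply: mulr_ge0; [exact: ltW|apply: Rintegral_ge0 => tau _; apply: Rintegral_ge0].
have key n : N0 <= n.+1%:R -> X <= Y + (X * N0 ^+ 2 + C * (T - s)) / n.+1%:R.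
  move=> Nn; set N : R := n.+1%:R in Nn *.
  have N0' : 0 < N by rewrite ltr0n.
  have N1 : 1 <= N by rewrite ler1n.
  pose th := 1 - (N0 / N) ^+ 2.
  have th0 : 0 <= th.
    by rewrite /th subr_ge0 expr_le1// ?divr_ge0 ?ler_pdivrMr ?mul1r// ltW.
  have par_ge x : - N0 <= x -> x <= N0 -> th <= parab N x.
    move=> x1 x2; rewrite /th /parab lerD2l lerN2 -[leLHS]real_normK ?num_real//.
    rewrite ler_sqr ?nnegrE ?divr_ge0 ?(ltW N00) ?(ltW N0')// normrM normfV (gtr0_norm N0').
    by rewrite ler_wpM2r ?invr_ge0 ?(ltW N0')// ler_norml x1.
  have sub : `[- N0, N0] `<=` (`[- N, N] : set R) by apply: subset_cc => //; rewrite lerN2.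
  have subL g : L1 mu `[- N, N] g -> L1 mu `[- N0, N0] g by move=> ig; apply: (L1S _ _ _ ig).
  have par0 x : `[- N, N]%classic x -> 0 <= parab N x.
    by rewrite /= in_itv/= => /andP[x1 x2]; have /andP[] := parab_itv N0' x1 x2.
  have iE := L1_entropy M0 hw d0 d1 h2 e10 e00 N0' T0.
  have iE0 : L1 mu `[- N0, N0] (fun x => e0 (wt T x)) by apply: (L1S _ _ _ (L1_e0 T0)).
  have a1 : th * \int[mu]_(x in `[- N0, N0]) e0 (wt T x) <= \int[mu]_(x in `[- N, N]) (parab N x * e0 (wt T x)).
    rewrite -RintegralZl//.
    apply: (@le_trans _ _ (\int[mu]_(x in `[- N0, N0]) (parab N x * e0 (wt T x)))).
      apply: le_Rintegral => //; [exact: L1Z|exact: subL|].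
      by move=> x; rewrite /= in_itv/= => /andP[x1 x2]; rewrite ler_wpM2r// par_ge.
    by apply: Rint_subset_le => // x xN; rewrite mulr_ge0// par0.
  have iDr := Dis_rect_L1 T N0' s0 (@parab_continuous _ _) (fun x x1 x2 => parab_itv N0' x1 x2).
  have iD : L1 mu `[s, T] (Dis p ut M u v e2 N) by exact: leb2_L1 iDr.
  have a2 : th * \int[mu]_(tau in `[s, T]) V tau <= \int[mu]_(tau in `[s, T]) Dis p ut M u v e2 N tau.
    rewrite -RintegralZl//; apply: ae_le_Rint => //; first exact: L1Z.
    apply: filterS (filterI (leb2_slice1 iD0) (leb2_slice1 iDr)) => tau [h3 h4] tsT.
    have {}h3 := h3 tsT; have {}h4 := h4 tsT; rewrite /V -RintegralZl//.
    apply: (@le_trans _ _ (\int[mu]_(x in `[- N0, N0]) (parab N x * e2 (wt tau x) * `|v tau x| `^ (p + 1)))).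
      apply: le_Rintegral => //; [exact: L1Z|exact: subL|].
      by move=> x; rewrite /= in_itv/= => /andP[x1 x2]; rewrite -mulrA ler_wpM2r// par_ge.
    by apply: Rint_subset_le => // x xN; rewrite -mulrA mulr_ge0// par0.
  have a3 : \int[mu]_(x in `[- N, N]) (parab N x * e0 (wt s x)) <= Y.
    have iEs := L1_entropy M0 hw d0 d1 h2 e10 e00 N0' s0'.
    have iS : L1 mu `[- N, N] (fun x => e0 (wt s x)) by apply: (L1S _ _ _ (L1_e0 s0')).
    apply: (@le_trans _ _ (\int[mu]_(x in `[- N, N]) e0 (wt s x))).
      apply: le_Rintegral => // x; rewrite /= in_itv/= => /andP[x1 x2].
      by have /andP[_ q] := parab_itv N0' x1 x2; rewrite ler_piMl.
    by apply: Rint_subset_le => //; exact: L1_e0.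
  have h3 := hC n s T s0 sT; rewrite -/N in h3.
  have h5 : th * X <= Y + C * (T - s) / N.
    rewrite /X mulrDr mulrCA; apply: le_trans (lerD a3 (lexx _)).
    by apply: le_trans h3; apply: lerD => //; rewrite ler_wpM2l ?(ltW m0).
  (* N^2 is weakened to N, using N >= 1, to put both errors over the same denominator. *)
  have h6 : X - X * N0 ^+ 2 / N <= th * X.
    have -> : th * X = X - X * N0 ^+ 2 / N ^+ 2 by rewrite /th expr_div_n; ring.
    rewrite lerD2l lerN2 ler_wpM2l ?mulr_ge0 ?sqr_ge0//.
    rewrite lef_pV2 ?posrE ?exprn_gt0// expr2 ler_peMr// ltW//.
  rewrite mulrDl; apply: le_trans (_ : Y + C * (T - s) / N + X * N0 ^+ 2 / N <= _).
    by rewrite -lerBlDr; exact: le_trans h5.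
  by rewrite -addrA lerD2l addrC.
rewrite leNgt; apply/negP => YX.
pose Z := X * N0 ^+ 2 + C * (T - s).
have Z0 : 0 <= Z by rewrite addr_ge0// mulr_ge0 ?sqr_ge0// subr_ge0.
(* Large enough for the big window to contain the small one and for the error to be less than X -
   Y. *)
pose n := Num.bound (N0 + Z / (X - Y)).
have XY : 0 < X - Y by rewrite subr_gt0.
have q0 : 0 <= Z / (X - Y) by rewrite divr_ge0// ltW.
have hn : N0 + Z / (X - Y) < n.+1%:R.
  apply: (@lt_trans _ _ n%:R); last by rewrite ltr_nat.
  by apply: archi_boundP; rewrite addr_ge0// ltW.
have h3 : N0 <= n.+1%:R by apply: ltW; apply: le_lt_trans hn; rewrite lerDl.
have h4 : Z / (X - Y) < n.+1%:R by apply: le_lt_trans hn; rewrite lerDr ltW.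
have := key n h3; rewrite -/Z -lerBlDl leNgt => /negP; apply.
by rewrite ltr_pdivrMr// mulrC -ltr_pdivrMr.
Qed.
End energy_inequality.

(** * Lebesgue norms *)

Section norms.
Context d (T : measurableType d) (R : realType) (mu : {measure set T -> \bar R}).

Lemma Lnorm_fin (q : R) (h : T -> R) : L1 mu setT (fun x => `|h x| `^ q) ->
  'N[mu]_q%:E[EFin \o h]%E = ((\int[mu]_x (`|h x| `^ q)) `^ q^-1)%:E.
Proof.
move=> ih; rewrite unlock.
rewrite (eq_integral (fun x => (`|h x| `^ q)%:E)) => [|x _]; last exact: poweR_EFin.
by rewrite L1_fin_num.
Qed.

Lemma Lfun_L1 (q : R) (h : T -> R) : 1 <= q -> h \in Lfun mu q%:E ->
  measurable_fun setT h /\ L1 mu setT (fun x => `|h x| `^ q).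
Proof.
move=> q1 hq; split; last exact: Lfun_integrable.
by move: hq; rewrite inE => /andP[/[!inE]].
Qed.

Lemma Lnorm_le_Rint (q K : R) (h : T -> R) : 1 <= q -> h \in Lfun mu q%:E ->
  ('N[mu]_q%:E[EFin \o h] <= K%:E)%E ->
  \int[mu]_x (`|h x| `^ q) <= `|K| `^ q.
Proof.
move=> q1 hq; have [_ iq] := Lfun_L1 q1 hq; rewrite Lnorm_fin// lee_fin.
have q0 : 0 < q by exact: lt_le_trans q1.
have I0 : 0 <= \int[mu]_x (`|h x| `^ q).
  by apply: Rintegral_ge0 => x _; exact: powR_ge0.
move: I0; move: (\int[mu]_x _) => I I0 hK.
have {1}-> : I = (I `^ q^-1) `^ q by rewrite -powRrM mulVf ?gt_eqF// powRr1.
apply: ge0_ler_powR; rewrite ?nnegrE ?powR_ge0 ?normr_ge0 ?(ltW q0)//.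
by rewrite (le_trans hK)// ler_norm.
Qed.

Lemma powR_sqr (x : R) : `|x| `^ 2 = x ^+ 2.
Proof. by rewrite powR_mulrn// real_normK// num_real. Qed.

Lemma Lfun2_L1 (h : T -> R) : h \in Lfun mu 2%:E ->
  measurable_fun setT h /\ L1 mu setT (fun x => h x ^+ 2).
Proof.
move=> /(Lfun_L1 (ler1n _ 2))[mh ih]; split=> //.
by apply: eq_L1 ih => // x _; exact: powR_sqr.
Qed.

Lemma Lnorm2_le_Rint (K : R) (h : T -> R) : h \in Lfun mu 2%:E ->
  ('N[mu]_2%:E[EFin \o h] <= K%:E)%E -> \int[mu]_x (h x ^+ 2) <= K ^+ 2.
Proof.
move=> hh hK; rewrite -powR_sqr.
have -> : \int[mu]_x (h x ^+ 2) = \int[mu]_x (`|h x| `^ 2).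
  by apply: eq_Rintegral => x _; rewrite powR_sqr.
exact: Lnorm_le_Rint (ler1n _ 2) hh hK.
Qed.
End norms.

Section bridge.
Context (R : realType).
Notation mu := (leb R).
Notation mu2 := (leb2 R).

Lemma Ck_derive (k : nat) (f : R -> R) : Ck k.+2 f ->
  (forall y : R, is_derive y 1 f ('D_1 f y)) /\ continuous ('D_1 f : R -> R).
Proof.
move=> [_ /(_ 1)[df [cf _]]]; split=> // y; exact: derivableP.
Qed.

Lemma C0_L2_measurable (w : R -> R -> R) : C0_L2 w -> forall t : R, 0 <= t ->
  measurable_fun (setT : set (measurableTypeR R)) (w t) /\ L1 mu setT (fun x => w t x ^+ 2).
Proof. by move=> [hw _] t t0; have := Lfun2_L1 (hw _ t0). Qed.

Lemma C0_L2_continuous (w : R -> R -> R) : C0_L2 w ->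
  forall s : R, 0 <= s -> forall e : R, 0 < e -> exists2 r : R, 0 < r &
  forall t : R, 0 <= t -> `|t - s| < r -> \int[mu]_x ((w t x - w s x) ^+ 2) <= e.
Proof.
move=> [hw hc] s s0 e e0.
have se0 : 0 < Num.sqrt e by rewrite sqrtr_gt0.
have : nbhs 0%E (fun y : \bar R => (y < (Num.sqrt e)%:E)%E).
  by apply: open_ereal_lt'; rewrite lte_fin.
move=> /(hc _ s0).
rewrite /nbhs/= /within/= => -[r r0 hr]; exists r => // t t0 ts.
have : ball s r t by rewrite /ball/= distrC.
move=> /hr; rewrite /= in_itv/= andbT => /(_ t0) /ltW H.
rewrite -[leRHS](sqr_sqrtr (ltW e0)).
have mt := hw _ t0; have ms := hw _ s0.
apply: (@Lnorm2_le_Rint _ _ _ mu _ (w t \- w s)) => //.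
have p1 : (1 <= 2%:E :> \bar R)%E by rewrite lee_fin ler1n.
have [_ hD] := Lfun_addr_closed mu p1.
by apply: hD => //; exact: Lfun_oppr_closed.
Qed.

Lemma Linfty_Lq_bound (q : R) (h : R -> R -> R) : 1 <= q -> Linfty_Lq q h ->
  exists2 K : R, 0 <= K & {ae mu, forall t, 0 < t -> L1 mu setT (fun x => `|h t x| `^ q) /\
   \int[mu]_x (`|h t x| `^ q) <= K}.
Proof.
move=> q1 [M hM]; exists (`|M| `^ q); first exact: powR_ge0.
apply: filterS hM => t H t0; have [hL hN] := H t0.
by split; [exact: (Lfun_L1 q1 hL).2|exact: Lnorm_le_Rint hN].
Qed.

Lemma space_time_L1 (q : R) (h : R -> R -> R) (S : set (measurableTypeR R * measurableTypeR R)) :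
  1 <= q -> measurable S -> S `<=` @half_plane R -> Lq_space_time q h ->
  L1 mu2 S (fun z => `|h z.1 z.2| `^ q).
Proof.
move=> q1 mS SH /(Lfun_L1 q1)[_ ih].
have : L1 mu2 S (fun z => `|((fun z => h z.1 z.2) \_ (@half_plane R)) z| `^ q).
  by apply: (L1S _ _ _ ih).
apply: eq_L1 => // z; rewrite inE => Sz; rewrite patchE ifT// inE; exact: SH.
Qed.
End bridge.

(** * Passage to L^2 limits and to the whole line *)

Section L2_limits.
Context (R : realType).
Notation mu := (leb R).

(** The excess max(0, |h| - M) is at most |h - g| wherever |g| <= M, so its square has integral
    below every [e]. This carries a sup bound from almost every time to every time. *)
Lemma ae_le_L2_closed (h : R -> R) (M : R) : 0 <= M ->
  measurable_fun (setT : set (measurableTypeR R)) h -> L1 mu setT (fun x => h x ^+ 2) ->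
  (forall e : R, 0 < e -> exists g : R -> R, [/\ L1 mu setT (fun x => (h x - g x) ^+ 2),
     \int[mu]_x ((h x - g x) ^+ 2) <= e & {ae mu, forall x, `|g x| <= M}]) ->
  {ae mu, forall x, `|h x| <= M}.
Proof.
move=> M0 mh ih hg; pose F x := (Num.max 0 (`|h x| - M)) ^+ 2.
have F0 x : 0 <= F x by exact: sqr_ge0.
have mF : measurable_fun (setT : set (measurableTypeR R)) F.
  apply: measurable_funX; apply: measurable_maxr => //.
  by apply: measurable_funB => //; exact: measurableT_comp.
have iF : L1 mu setT F.
  apply: (@le_L1 _ _ _ mu _ _ (fun x => h x ^+ 2)) => // x _.
  rewrite !ger0_norm// ?sqr_ge0// -[leRHS]real_normK ?num_real// /F.
  rewrite ler_sqr ?nnegrE ?le_max ?lexx ?normr_ge0//.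
  by rewrite ge_max normr_ge0/= gerBl.
have Fe e : 0 < e -> \int[mu]_x F x <= e.
  move=> /hg[g [ig ge ae]]; apply: le_trans ge; apply: ae_le_Rint => //.
  apply: filterS ae => x gM _.
  rewrite -[leRHS]real_normK ?num_real// /F ler_sqr ?nnegrE ?le_max ?lexx ?normr_ge0//.
  rewrite ge_max normr_ge0/=.
  by apply: le_trans (lerB_dist _ _); rewrite lerB.
have F_le0 : \int[mu]_x F x <= 0.
  by apply/ler_addgt0Pl => e e0; rewrite addr0; exact: Fe.
have := Rint_eq0_ae measurableT iF (fun x _ => F0 x) F_le0.
apply: filterS => x /(_ I) /eqP; rewrite sqrf_eq0 => /eqP /max_idPl.
by rewrite subr_le0.
Qed.

Lemma Rint_exhaust (F : R -> R) : L1 mu setT F ->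
  \int[mu]_(x in `[- n.+1%:R, n.+1%:R]) F x @[n --> \oo] --> \int[mu]_x F x.
Proof.
move=> iF; pose I n : set (measurableTypeR R) := `[- n.+1%:R, n.+1%:R]%classic.
have mF := L1_measurable iF.
pose G n := F \_ (I n).
have -> : (fun n => \int[mu]_(x in `[- n.+1%:R, n.+1%:R]) F x) = (fun n => \int[mu]_x G n x).
  by apply/funext => n; rewrite Rintegral_mkcond.
apply: (@Rint_dominated _ _ _ mu setT G F (fun x => `|F x|)) => //.
- move=> n; apply/(measurable_restrictT _ _).1 => //.
  exact: measurable_itv.
  by apply: (measurable_funS _ _ mF).
- apply: aeW => x _; apply: cvg_near_cst; exists (Num.truncn `|x|) => // n /= xn.
  rewrite /G patchE ifT// inE /I /= in_itv/= -ler_norml.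
  by rewrite (le_trans (ltW (truncnS_gt _)))// ler_nat.
- exact: L1_norm.
- apply: aeW => x n _; rewrite /G patchE; case: ifP => // _.
  by rewrite normr0 normr_ge0.
Qed.

Lemma ae_exhaust (P : R -> Prop) :
  (forall n : nat, {ae mu, forall x, `[- n.+1%:R, n.+1%:R]%classic x -> P x}) ->
  {ae mu, forall x, P x}.
Proof.
move=> /ae_forall_count; apply: filterS => x H.
apply: (H (Num.truncn `|x|)); rewrite /= in_itv/= -ler_norml.
by rewrite ltW// truncnS_gt.
Qed.
End L2_limits.

(** * Maximum principle and decay *)

Section comparison.
Context (R : realType).
Notation mu := (leb R).
Notation mu2 := (leb2 R).
Variables (p m ut M : R) (f f' : R -> R) (u v A : R -> R -> R).
Hypotheses (p1 : 1 < p) (m0 : 0 < m) (M0 : 0 < M).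
Hypotheses (df : forall y : R, is_derive y 1 f (f' y)) (cf' : continuous f').
Hypotheses (hdx : weak_dx u v) (hdA : weak_dx (flux p v) A) (heq : weak_equation p m f u v).
Let w t x := u t x - ut.
Hypothesis hw : forall t : R, 0 <= t ->
  measurable_fun (setT : set (measurableTypeR R)) (w t) /\ L1 mu setT (fun x => w t x ^+ 2).
Hypothesis hc : forall s : R, 0 <= s -> forall e : R, 0 < e -> exists2 r : R, 0 < r &
  forall t : R, 0 <= t -> `|t - s| < r -> \int[mu]_x ((w t x - w s x) ^+ 2) <= e.
Hypothesis hM : forall t : R, 0 <= t -> {ae mu, forall x, `|w t x| <= M}.
Hypothesis hv : forall a b N : R, 0 < a -> L1 mu2 (rect a b (- N) N) (fun z => `|v z.1 z.2| `^ (p + 1)).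
Hypothesis hA : forall a b N : R, 0 < a -> L1 mu2 (rect a b (- N) N) (fun z => A z.1 z.2 ^+ 2).
Variables (K2 Kv : R).
Hypotheses (K20 : 0 <= K2) (Kv0 : 0 <= Kv).
Hypothesis hK2 : {ae mu, forall t, 0 < t -> \int[mu]_x (w t x ^+ 2) <= K2}.
Hypothesis hKv : {ae mu, forall t, 0 < t -> L1 mu setT (fun x => `|v t x| `^ (p + 1)) /\
   \int[mu]_x (`|v t x| `^ (p + 1)) <= Kv}.

Local Notation wt := (wc ut M u).

Lemma ae_wc (t : R) : 0 <= t -> {ae mu, forall x, wt t x = w t x}.
Proof. by move=> /hM; apply: filterS => x xM; exact: clamp_id. Qed.

(** The energy inequality starts at positive times; this gives access to s = 0. *)
Lemma near_time (s T e : R) : 0 <= s -> s < T -> 0 < e -> exists s' : R,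
  [/\ 0 < s', s < s', s' <= T & \int[mu]_x ((w s' x - w s x) ^+ 2) <= e].
Proof.
move=> s0 sT e0; have [r r0 hr] := hc s0 e0.
exists (s + Num.min (T - s) (r / 2)).
have h : 0 < Num.min (T - s) (r / 2) by rewrite lt_min subr_gt0 sT divr_gt0.
have h1 : Num.min (T - s) (r / 2) <= T - s by rewrite ge_min lexx.
have h2 : Num.min (T - s) (r / 2) <= r / 2 by rewrite ge_min lexx orbT.
move: h h1 h2; move: (Num.min _ _) => y h h1 h2.
split; [lra|lra|lra|apply: hr]; first lra.
by rewrite addrC addKr gtr0_norm//; lra.
Qed.

(** Where e0(w(s)) and e1(w(s)) vanish, e0(w(s')) is at most L (w(s') - w(s))^2, which has small
    integral for s' just after s. The energy inequality started at s' keeps the entropy small up to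
    T. The detour through s' makes s = 0 admissible. *)
Lemma entropy_vanish (L : R) (e0 e1 e2 : R -> R) :
  (forall y : R, is_derive y 1 e0 (e1 y)) -> (forall y : R, is_derive y 1 e1 (e2 y)) ->
  continuous e2 -> (forall y, 0 <= e2 y <= L) -> e1 0 = 0 -> e0 0 = 0 ->
  forall s T : R, 0 <= s -> s <= T ->
  {ae mu, forall x, e0 (w s x) = 0 /\ e1 (w s x) = 0} ->
  {ae mu, forall x, e0 (w T x) = 0}.
Proof.
move=> d0 d1 ce2 h2 e10 e00 s T s0; rewrite le_eqVlt => /predU1P[<-|sT hs].
  by apply: filterS => x [].
have T0 : 0 <= T by exact: le_trans (ltW sT).
have L0 : 0 <= L by have /andP[+ +] := h2 0; exact: le_trans.
have e0_ge0 := entropy_ge0 d0 d1 h2 e10 e00.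
suff : {ae mu, forall x, e0 (wt T x) = 0}.
  by move=> h; apply: filterS2 h (ae_wc T0) => x <- ->.
apply: ae_exhaust => n; apply: Rint_eq0_ae => //.
  by apply: (L1S _ _ _ (L1_e0 M0 hw d0 d1 h2 e10 e00 T0)).
apply/ler_addgt0Pl => e e_gt0; rewrite addr0.
have eL : 0 < e / (L + 1) by rewrite divr_gt0//; lra.
have [s' [s'0 ss' s'T hs']] := near_time s0 sT eL.
have := energy_ineq p1 m0 M0 df cf' hdx hdA heq hw hc hM hv hA K20 Kv0 hK2 hKv
  d0 d1 ce2 h2 e10 e00 n s'0 s'T.
have X0 : 0 <= m * \int[mu]_(tau in `[s', T]) \int[mu]_(x in `[- n.+1%:R, n.+1%:R])
    (e2 (wt tau x) * `|v tau x| `^ (p + 1)).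
  rewrite mulr_ge0 ?(ltW m0)//; apply: Rintegral_ge0 => t _; apply: Rintegral_ge0 => x _.
  by rewrite mulr_ge0 ?powR_ge0//; have /andP[] := h2 (wt t x).
move: X0; move: (m * _) => X X0 H.
apply: le_trans (_ : \int[mu]_x e0 (wt s' x) <= _); first by apply: le_trans H; rewrite lerDl.
have iD := L1_dw2 hw s0 (ltW s'0).
apply: (@le_trans _ _ (\int[mu]_x (L * (w s' x - w s x) ^+ 2))).
  apply: ae_le_Rint => //; [exact: L1_e0 (ltW s'0)|exact: L1Z|].
  apply: filterS2 hs (ae_wc (ltW s'0)) => x [a0 a1] -> _.
  have := entropy_convex d0 d1 h2 (w s x) (w s' x); rewrite a0 subr0 => /le_trans; apply.
  rewrite (le_trans (ler_norm _))// normrM -real_normK ?num_real// expr2 mulrA ler_wpM2r//.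
  by have := entropy_lip d1 h2 (w s' x) (w s x); rewrite a1 subr0.
rewrite RintegralZl//.
apply: le_trans (ler_wpM2l L0 hs') _.
by rewrite mulrA ler_pdivrMr; [rewrite mulrC ler_pM2l// lerDl|lra].
Qed.

Lemma upper_bound_propagates (s T k : R) : 0 <= s -> s <= T -> 0 <= k ->
  {ae mu, forall x, w s x <= k} -> {ae mu, forall x, w T x <= k}.
Proof.
move=> s0 sT k0 hs; have [e0 [e1 [e2 [d0 d1 ce2 h2 [z0 [z1 pos]]]]]] := level_entropy k0.
have h : {ae mu, forall x, e0 (w T x) = 0}.
  apply: (entropy_vanish d0 d1 ce2 h2 (z1 _ k0) (z0 _ k0) s0 sT).
  by apply: filterS hs => x xk; split; [exact: z0|exact: z1].
apply: filterS h => x e; rewrite leNgt; apply/negP => /pos.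
by rewrite e ltxx.
Qed.

Lemma lower_bound_propagates (s T k : R) : 0 <= s -> s <= T -> 0 <= k ->
  {ae mu, forall x, - k <= w s x} -> {ae mu, forall x, - k <= w T x}.
Proof.
move=> s0 sT k0 hs; have [e0 [e1 [e2 [d0 d1 ce2 h2 [z0 [z1 pos]]]]]] := level_entropy k0.
have dN (g g' : R -> R) : (forall y : R, is_derive y 1 g (g' y)) ->
    forall y : R, is_derive y 1 (fun y => g (- y)) (- g' (- y)).
  move=> dg y; have hN : is_derive (y : R) 1 (fun y : R => - y) (- 1 : R).
    by apply: is_deriveN; exact: is_derive_id.
  have := @is_derive1_comp _ g (fun y => - y) y _ _ (dg (- y)) hN.
  by rewrite mulrN1.
have d0' : forall y : R, is_derive y 1 (fun y => e0 (- y)) (- e1 (- y)) by exact: dN.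
have d1' : forall y : R, is_derive y 1 (fun y => - e1 (- y)) (e2 (- y)).
  move=> y; rewrite -[e2 _]opprK; apply: is_deriveN; exact: dN.
have h : {ae mu, forall x, e0 (- w T x) = 0}.
  apply: (entropy_vanish d0' d1' _ (fun y => h2 (- y)) _ _ s0 sT).
  - by move=> y; apply: continuous_comp; [exact: oppr_continuous|exact: ce2].
  - by rewrite oppr0 z1// oppr0.
  - by rewrite oppr0 z0.
  - by apply: filterS hs => x xk; rewrite z0 ?z1 ?oppr0//; lra.
apply: filterS h => x e; rewrite leNgt; apply/negP => h.
by have := pos (- w T x); rewrite e ltxx ltrNr => /(_ h).
Qed.

Lemma maximum_principle (s T k : R) : 0 <= s -> s <= T -> 0 <= k ->
  {ae mu, forall x, `|w s x| <= k} -> {ae mu, forall x, `|w T x| <= k}.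
Proof.
move=> s0 sT k0 hs.
have h1 : {ae mu, forall x, w T x <= k}.
  apply: (upper_bound_propagates s0 sT k0); apply: filterS hs => x.
  by rewrite ler_norml => /andP[].
have h2 : {ae mu, forall x, - k <= w T x}.
  apply: (lower_bound_propagates s0 sT k0); apply: filterS hs => x.
  by rewrite ler_norml => /andP[].
by apply: filterS2 h1 h2 => x a b; rewrite ler_norml a b.
Qed.

Variable B1 : R.
Hypothesis hB1 : \int[mu]_x (w 0 x ^+ 2) <= B1.

Lemma square_energy n (s T : R) : 0 < s -> s <= T ->
  \int[mu]_(x in `[- n.+1%:R, n.+1%:R]) (w T x ^+ 2) +
  2 * m * \int[mu]_(tau in `[s, T]) \int[mu]_(x in `[- n.+1%:R, n.+1%:R]) (`|v tau x| `^ (p + 1)) <=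
  \int[mu]_x (w s x ^+ 2).
Proof.
move=> s0 sT; have T0 : 0 < T by exact: lt_le_trans sT.
have d0 (y : R) : is_derive y 1 (fun y : R => y ^+ 2) (2 * y).
  have := is_deriveX 2 (is_derive_id y (1 : R)).
  by rewrite /GRing.scale/= mulr1 expr1.
have d1 (y : R) : is_derive y 1 (fun y : R => 2 * y) 2.
  have := is_deriveZ (2 : R) (is_derive_id y (1 : R)).
  by rewrite /GRing.scale/= mulr1.
have h2 (y : R) : 0 <= (fun=> 2 : R) y <= (2 : R) by rewrite ler0n lexx.
have ce2 : continuous (fun _ : R => 2 : R) by move=> y; exact: cst_continuous.
have z0 : 0 ^+ 2 = 0 :> R by rewrite expr0n.
have z1 : 2 * 0 = 0 :> R by rewrite mulr0.
have := energy_ineq p1 m0 M0 df cf' hdx hdA heq hw hc hM hv hA K20 Kv0 hK2 hKv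
  d0 d1 ce2 h2 z1 z0 n s0 sT.
have iw t : 0 < t -> L1 mu setT (fun x => wt t x ^+ 2).
  by move=> /ltW t0; exact: (L1_e0 M0 hw d0 d1 h2 z1 z0 t0).
have Ew t (D : set (measurableTypeR R)) : measurable D -> 0 < t ->
    \int[mu]_(x in D) (wt t x ^+ 2) = \int[mu]_(x in D) (w t x ^+ 2).
  move=> mD t0; apply: ae_eq_Rint => //.
  - by apply: (measurable_funS _ _ (L1_measurable (iw t t0))).
  - by apply: (measurable_funS _ _ (L1_measurable (hw (ltW t0)).2)).
  - by apply: filterS (ae_wc (ltW t0)) => x ->.
rewrite !Ew//.
suff -> : \int[mu]_(tau in `[s, T]) \int[mu]_(x in `[- n.+1%:R, n.+1%:R]) (2 * `|v tau x| `^ (p + 1))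
  = 2 * \int[mu]_(tau in `[s, T]) \int[mu]_(x in `[- n.+1%:R, n.+1%:R]) (`|v tau x| `^ (p + 1)).
  by rewrite mulrA (mulrC m).
have iR := hv T n.+1%:R s0.
rewrite -RintegralZl//; last exact: (rect_fubini_L1 _ _ iR).
apply: ae_eq_Rint => //.
- exact: (L1_measurable (rect_fubini_L1 _ _ (L1Z 2 (measurable_rect _ _ _ _) iR))).
- exact: (L1_measurable (L1Z 2 _ (rect_fubini_L1 _ _ iR))).
have := leb2_slice1 iR; apply: filterS => t it st.
by rewrite RintegralZl//; exact: it.
Qed.

(** The energy inequality is started at a time s for which (w(s) - w(0))^2 has integral at most 1,
    and w(s)^2 <= 2 w(0)^2 + 2 (w(s) - w(0))^2. Unlike [K2], the resulting bound involves the
    initial mass only. *)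
Lemma mass_bound (t : R) : 0 <= t -> \int[mu]_x (w t x ^+ 2) <= 2 * B1 + 2.
Proof.
have B10 : 0 <= B1 by apply: le_trans hB1; apply: Rintegral_ge0 => x _; exact: sqr_ge0.
rewrite le_eqVlt => /predU1P[<-|t0]; first by apply: (le_trans hB1); lra.
have [s [s0 _ st hs]] := near_time (lexx 0) t0 ltr01.
have [_ iw0] := hw (lexx 0); have iD := L1_dw2 hw (lexx 0) (ltW s0).
have [_ iws] := hw (ltW s0); have [_ iwt] := hw (ltW t0).
have sB : \int[mu]_x (w s x ^+ 2) <= 2 * B1 + 2.
  apply: (@le_trans _ _ (\int[mu]_x (2 * w 0 x ^+ 2 + 2 * (w s x - w 0 x) ^+ 2))).
    apply: ae_le_Rint => //; first by apply: L1D => //; exact: L1Z.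
    apply: aeW => x _; have := sqr_ge0 (w s x - 2 * w 0 x).
    by move: (w s x) (w 0 x) => a b; lra.
  rewrite RintegralD//; [|exact: L1Z|exact: L1Z].
  rewrite !RintegralZl//; move: hB1 hs; move: (\int[mu]_x _) (\int[mu]_x _) => a b; lra.
apply: (@ler_cvg_to _ _ _ _ _ (cst (2 * B1 + 2)) _ _ (Rint_exhaust iwt)).
  exact: cvg_cst.
apply: nearW => n.
apply: le_trans sB; apply: le_trans (square_energy n s0 st).
rewrite lerDl; apply: mulr_ge0; first by rewrite mulr_ge0 ?(ltW m0).
by apply: Rintegral_ge0 => ? _; apply: Rintegral_ge0 => ? _; exact: powR_ge0.
Qed.

Lemma dissipation_bound n (s T : R) : 0 < s -> s <= T ->
  2 * m * \int[mu]_(tau in `[s, T]) \int[mu]_(x in `[- n.+1%:R, n.+1%:R]) (`|v tau x| `^ (p + 1)) <=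
  2 * B1 + 2.
Proof.
move=> s0 sT; apply: le_trans (mass_bound (ltW s0)).
apply: le_trans (square_energy n s0 sT); rewrite lerDr.
by apply: Rintegral_ge0 => x _; exact: sqr_ge0.
Qed.
End comparison.

Lemma powR_le_root (R : realType) (a K r : R) : 0 <= a -> 0 < r -> a `^ r <= K -> a <= K `^ r^-1.
Proof.
move=> a0 r0 aK; have {1}-> : a = (a `^ r) `^ r^-1.
  by rewrite -powRrM mulfV ?gt_eqF// powRr1.
by apply: ge0_ler_powR; rewrite ?nnegrE ?invr_ge0 ?(ltW r0) ?powR_ge0// (le_trans _ aK) ?powR_ge0.
Qed.

Lemma ae_pos_near (R : realType) (P : R -> Prop) : {ae leb R, forall t, 0 < t -> P t} ->
  forall t r : R, 0 <= t -> 0 < r -> exists s, [/\ 0 < s, `|t - s| < r, `|s - t| < r & P s].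
Proof.
move=> hP t r t0 r0.
have [s [h1 h2 _ [s0 Ps]]] : exists s, [/\ t + r / 4 <= s, s <= t + r / 2,
    `|s - (t + r / 2)| < 1 & 0 < s /\ P s].
  apply: ae_dense => //; [lra|lra|].
  apply: filterS hP => s H; rewrite /= in_itv/= => /andP[h1 h2].
  have s0 : 0 < s by lra.
  by split=> //; exact: H.
have e : `|s - t| < r by rewrite ger0_norm; lra.
by exists s; split=> //; rewrite distrC.
Qed.

(** The first summand is the bound of [sup_decay_pos] combined with 1 / t <= 2 / (1 + t) for t >= 1,
    whence the leading 2. The second covers t <= 1: the maximum principle gives [k0], and
    2^(1/(3p+1)) offsets the factor (1 + t)^(-1/(3p+1)). *)
Definition sup_const (R : realType) (p m B1 k0 : R) : R :=
  (2 * ((16 * (2 * B1 + 2)) `^ p * (4 * ((2 * B1 + 3) / m)))) `^ (3 * p + 1)^-1 +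
  k0 * 2 `^ (3 * p + 1)^-1.

Lemma sup_const_gt0 (R : realType) (p m B1 k0 : R) : 0 < m -> 0 <= B1 -> 0 <= k0 ->
  0 < sup_const p m B1 k0.
Proof.
move=> m0 B10 k00; rewrite ltr_wpDr ?mulr_ge0 ?powR_ge0//.
apply: powR_gt0; rewrite mulr_gt0// mulr_gt0 ?powR_gt0 ?mulr_gt0 ?invr_gt0//; lra.
Qed.

(** * Decay rate of the supremum *)

Section decay.
Context (R : realType).
Notation mu := (leb R).
Notation mu2 := (leb2 R).
Variables (p m ut : R) (f f' : R -> R) (u v A : R -> R -> R).
Hypotheses (p1 : 1 < p) (m0 : 0 < m).
Hypotheses (df : forall y : R, is_derive y 1 f (f' y)) (cf' : continuous f').
Hypotheses (hdx : weak_dx u v) (hdA : weak_dx (flux p v) A) (heq : weak_equation p m f u v).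
Let w t x := u t x - ut.
Hypothesis hw : forall t : R, 0 <= t ->
  measurable_fun (setT : set (measurableTypeR R)) (w t) /\ L1 mu setT (fun x => w t x ^+ 2).
Hypothesis hc : forall s : R, 0 <= s -> forall e : R, 0 < e -> exists2 r : R, 0 < r &
  forall t : R, 0 <= t -> `|t - s| < r -> \int[mu]_x ((w t x - w s x) ^+ 2) <= e.
Hypothesis hv : forall a b : R, 0 < a ->
  L1 mu2 ((`[a, b] : set (measurableTypeR R)) `*` (setT : set (measurableTypeR R)))
    (fun z => `|v z.1 z.2| `^ (p + 1)).
Hypothesis hA : forall a b N : R, 0 < a -> L1 mu2 (rect a b (- N) N) (fun z => A z.1 z.2 ^+ 2).
Variables (K2 Kv : R).
Hypotheses (K20 : 0 <= K2) (Kv0 : 0 <= Kv).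
Hypothesis hK2 : {ae mu, forall t, 0 < t -> \int[mu]_x (w t x ^+ 2) <= K2}.
Hypothesis hKv : {ae mu, forall t, 0 < t -> L1 mu setT (fun x => `|v t x| `^ (p + 1)) /\
   \int[mu]_x (`|v t x| `^ (p + 1)) <= Kv}.

(** [B] and [E] are left free because it is used twice: with [K2] and [Kv] for a first sup bound,
    then with bounds from the initial datum for the decay. *)
Lemma slice_morrey : {ae mu, forall t, 0 < t -> forall B E : R, 0 < E ->
  \int[mu]_x (w t x ^+ 2) <= B -> \int[mu]_x (`|v t x| `^ (p + 1)) <= E ->
  {ae mu, forall x, `|w t x| <= ((16 * B) `^ p * (4 * E)) `^ (3 * p + 1)^-1}}.
Proof.
apply: filterS2 (slices hdx) hKv => t H1 H2 t0 B E E0 hB hE.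
have [iv _] := H2 t0; have [_ iw] := hw (ltW t0).
suff : {ae mu, forall x, `|w t x| `^ (3 * p + 1) <= (16 * B) `^ p * (4 * E)}.
  by apply: filterS => x; apply: powR_le_root => //; move: p1; lra.
apply: (morrey p1 E0 _ iw hB iv hE) => n.
have [W [_ [ik HW] hW]] := H1 t0 n; exists (fun x => W x - ut); split.
  by split=> // x ax xb; rewrite HW// addrAC.
by apply: filterS hW => x hx xn; rewrite /w hx.
Qed.

(** The crude bound, dependent on the solution, that serves as [M] in the energy inequality; it does
    not appear in the final rate. The 1 next to [Kv] makes the energy bound positive, the outer 1
    makes [supM] positive. *)
Let supM := ((16 * K2) `^ p * (4 * (Kv + 1))) `^ (3 * p + 1)^-1 + 1.

Let supM0 : 0 < supM.
Proof. by rewrite ltr_wpDl// powR_ge0. Qed.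

(** [slice_morrey] gives the bound at almost every time, and L^2 continuity extends it to every
    time, 0 included. *)
Lemma sup_bound (t : R) : 0 <= t -> {ae mu, forall x, `|w t x| <= supM}.
Proof.
move=> t0; have [mw iw] := hw t0; apply: ae_le_L2_closed => //; first exact: ltW.
move=> e e0; have [r r0 hr] := hc t0 e0.
have good : {ae mu, forall s, 0 < s -> {ae mu, forall x, `|w s x| <= supM}}.
  apply: filterS3 slice_morrey hK2 hKv => s H1 H2 H3 s0.
  have E : 0 < Kv + 1 by rewrite ltr_wpDl.
  have vE : \int[mu]_x (`|v s x| `^ (p + 1)) <= Kv + 1.
    by apply: (le_trans (H3 s0).2); rewrite lerDl.
  have := H1 s0 _ _ E (H2 s0) vE.
  by apply: filterS => x /le_trans; apply; rewrite lerDl.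
have [s [s0 ts st sM]] := ae_pos_near good t0 r0.
exists (w s); split=> //; first exact: (L1_dw2 hw (ltW s0) t0).
apply: le_trans (hr s (ltW s0) st).
by under eq_Rintegral do rewrite -sqrrN opprB.
Qed.
Let hv_rect (a b N : R) : 0 < a -> L1 mu2 (rect a b (- N) N) (fun z => `|v z.1 z.2| `^ (p + 1)).
Proof.
move=> a0; apply: (L1S _ _ _ (hv b a0)) => //; try exact: measurableX.
by move=> z [z1 _].
Qed.

Variables (B1 k0 : R).
Hypothesis hB1 : \int[mu]_x (w 0 x ^+ 2) <= B1.
Hypotheses (k00 : 0 <= k0) (hk0 : {ae mu, forall x, `|w 0 x| <= k0}).

Let max_w := maximum_principle p1 m0 supM0 df cf' hdx hdA heq hw hc sup_bound hv_rect hA K20 Kv0 hK2 hKv.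

Lemma w_mass_bound (t : R) : 0 <= t -> \int[mu]_x (w t x ^+ 2) <= 2 * B1 + 2.
Proof.
exact: (mass_bound p1 m0 supM0 df cf' hdx hdA heq hw hc sup_bound hv_rect hA K20 Kv0 hK2 hKv hB1).
Qed.

Let V (t : R) := \int[mu]_x (`|v t x| `^ (p + 1)).

(** Dominated convergence removes the window from [dissipation_bound]. *)
Lemma total_dissipation (s T : R) : 0 < s -> s <= T -> L1 mu `[s, T] V /\
  2 * m * \int[mu]_(tau in `[s, T]) V tau <= 2 * B1 + 2.
Proof.
move=> s0 sT; have mI : measurable (`[s, T]%classic : set (measurableTypeR R)) by exact: measurable_itv.
have iV : L1 mu `[s, T] V by exact: (rect_fubini_L1 mI measurableT (hv T s0)).
split=> //.
pose Vn n (t : R) := \int[mu]_(x in `[- n.+1%:R, n.+1%:R]) (`|v t x| `^ (p + 1)).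
have iVt : {ae mu, forall t, `[s, T]%classic t -> L1 mu setT (fun x => `|v t x| `^ (p + 1))}.
  exact: (rect_fubini_slice1 mI measurableT (hv T s0)).
have cV : \int[mu]_(t in `[s, T]) Vn n t @[n --> \oo] --> \int[mu]_(t in `[s, T]) V t.
  apply: (@Rint_dominated _ _ _ mu `[s, T]%classic Vn V V) => //.
  - move=> n; exact: (L1_measurable (leb2_L1 (hv_rect T n.+1%:R s0))).
  - exact: (L1_measurable iV).
  - by apply: filterS iVt => t it st; exact: Rint_exhaust (it st).
  - apply: filterS iVt => t it n st; rewrite ger0_norm.
      by apply: Rint_subset_le => //; exact: it.
    by apply: Rintegral_ge0 => x _; exact: powR_ge0.
have m2 : 0 < 2 * m by rewrite mulr_gt0.
rewrite -ler_pdivlMl//.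
apply: (@ler_cvg_to _ _ _ _ _ (cst ((2 * m)^-1 * (2 * B1 + 2))) _ _ cV).
  exact: cvg_cst.
apply: nearW => n; rewrite ler_pdivlMl//.
exact: (dissipation_bound p1 m0 supM0 df cf' hdx hdA heq hw hc sup_bound hv_rect hA K20 Kv0
  hK2 hKv hB1 n s0 sT).
Qed.

(* The total dissipation on [[t / 2, t]] is at most [(2 * B1 + 2) / (2 * m)]. *)
Lemma good_time (t : R) (P : R -> Prop) : 0 < t -> {ae mu, forall s, 0 < s -> P s} ->
  exists s, [/\ 0 < s, s <= t, P s & V s <= (2 * B1 + 3) / m / t].
Proof.
move=> t0 hP; apply: contrapT => nex.
have s0 : 0 < t / 2 by rewrite divr_gt0.
have st : t / 2 <= t by lra.
have [iV hV] := total_dissipation s0 st.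
(* If [V] exceeded this threshold at almost every time of [t/2, t], integrating over the length t/2
   and multiplying by 2 m would give 2 B1 + 3 <= 2 B1 + 2; hence the 3. *)
have : \int[mu]_(tau in `[t / 2, t]) ((2 * B1 + 3) / m / t) <= \int[mu]_(tau in `[t / 2, t]) V tau.
  apply: ae_le_Rint => //; first by apply: L1_cst => //; exact: leb_cc_fin.
  apply: filterS hP => s Ps; rewrite /= in_itv/= => /andP[h1 h2].
  have sp : 0 < s by exact: lt_le_trans h1.
  rewrite leNgt; apply/negP => /ltW Vs; apply: nex; exists s; split=> //; exact: Ps.
rewrite Rint_cst_cc// => H.
have : 2 * B1 + 3 <= 2 * B1 + 2.
  apply: le_trans hV; apply: le_trans (_ : 2 * m * ((2 * B1 + 3) / m / t * (t - t / 2)) <= _).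
    rewrite [leRHS](_ : _ = 2 * B1 + 3)//.
    by field; rewrite !gt_eqF.
  by rewrite ler_pM2l// mulr_gt0.
by lra.
Qed.

Lemma sup_decay_pos (t : R) : 0 < t -> {ae mu, forall x, `|w t x| <=
  ((16 * (2 * B1 + 2)) `^ p * (4 * ((2 * B1 + 3) / m / t))) `^ (3 * p + 1)^-1}.
Proof.
move=> t0; have [s [s0 st Hs Vs]] := good_time t0 slice_morrey.
have B10 : 0 <= B1 by apply: le_trans hB1; apply: Rintegral_ge0 => x _; exact: sqr_ge0.
apply: (max_w (ltW s0) st (powR_ge0 _ _)).
apply: Hs => //; last exact: (w_mass_bound (ltW s0)).
by rewrite divr_gt0// divr_gt0//; lra.
Qed.

Lemma sup_decay (t : R) : 0 <= t -> {ae mu, forall x, `|w t x| <=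
  sup_const p m B1 k0 * (1 + t) `^ (- (3 * p + 1)^-1)}.
Proof.
move=> t0; have B10 : 0 <= B1 by apply: le_trans hB1; apply: Rintegral_ge0 => x _; exact: sqr_ge0.
have a0 : 0 < (3 * p + 1)^-1 by rewrite invr_gt0; move: p1; lra.
have t1 : 0 < 1 + t by lra.
rewrite /sup_const; set al := (3 * p + 1)^-1 in a0 *.
have q0 : 0 <= (1 + t) `^ (- al) by exact: powR_ge0.
have [tl|tg] := leP t 1.
  have := max_w (lexx 0) t0 k00 hk0; apply: filterS => x /le_trans; apply.
  rewrite mulrDl ler_wpDl ?mulr_ge0 ?powR_ge0// -mulrA ler_peMr//.
  rewrite powRN ler_pdivlMr ?powR_gt0// mul1r ge0_ler_powR ?nnegrE ?(ltW a0)//; lra.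
have tp : 0 < t by lra.
have := sup_decay_pos tp; apply: filterS => x /le_trans; apply.
rewrite -/al [leRHS]mulrDl ler_wpDr ?mulr_ge0 ?powR_ge0//.
set X := (16 * (2 * B1 + 2)) `^ p; have X0 : 0 <= X by exact: powR_ge0.
set Y := (2 * B1 + 3) / m; have Y0 : 0 <= Y by apply: divr_ge0; [lra|exact: ltW].
clearbody X Y.
have E : (1 + t) `^ (- al) = ((1 + t)^-1) `^ al by rewrite -mulN1r powRrM powR_inv1 ?(ltW t1).
rewrite E -powRM ?mulr_ge0 ?invr_ge0 ?(ltW t1)//.
have XY : 0 <= X * (4 * Y) by rewrite !mulr_ge0.
apply: ge0_ler_powR; rewrite ?nnegrE ?(ltW a0) ?mulr_ge0 ?invr_ge0 ?(ltW t1) ?(ltW tp)//.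
have -> : X * (4 * (Y / t)) = X * (4 * Y) * t^-1 by rewrite !mulrA.
rewrite (mulrC 2) -[leRHS]mulrA ler_wpM2l// ler_pdivlMr// ler_pdivrMl//; lra.
Qed.
End decay.

(** * Interpolation between L^2 and the supremum *)

Section interpolation.
Context (R : realType).
Notation mu := (leb R).
Variable h : R -> R.
Hypothesis mh : measurable_fun (setT : set (measurableTypeR R)) h.

(** Almost everywhere |h|^q <= S^(q-2) h^2, and the q-th root turns q - 2 into 1 - 2 / q. *)
Lemma Lq_norm_interpolation (q S B : R) : 2 <= q -> 0 < S ->
  L1 mu setT (fun x => h x ^+ 2) -> \int[mu]_x (h x ^+ 2) <= B ->
  {ae mu, forall x, `|h x| <= S} ->
  (Lq_norm q%:E h <= (S `^ (1 - 2 / q) * B `^ q^-1)%:E)%E.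
Proof.
move=> q2 S0 ih hB hS; have q0 : 0 < q by lra.
pose F x := `|h x| `^ q; pose G x := S `^ (q - 2) * h x ^+ 2.
have iG : L1 mu setT G by exact: L1Z.
have G0 x : 0 <= G x by rewrite mulr_ge0 ?powR_ge0 ?sqr_ge0.
have F0 x : 0 <= F x by exact: powR_ge0.
have mF : measurable_fun (setT : set (measurableTypeR R)) F.
  apply: (measurableT_comp (measurable_powR q)); exact: measurableT_comp.
have FG : {ae mu, forall x, F x <= G x}.
  apply: filterS hS => x xS; rewrite /F /G -powR_sqr.
  have {1}-> : q = (q - 2) + 2 by rewrite subrK.
  rewrite powRD; last by rewrite subrK gt_eqF.
  rewrite ler_wpM2r ?powR_ge0// ge0_ler_powR ?nnegrE ?subr_ge0 ?(ltW S0)//.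
have iF : L1 mu setT F.
  (* [F <= G] holds only almost everywhere, while [le_L1] asks for domination at every point; the
     minimum of the two is the intermediate function. *)
  apply: (@ae_eq_L1 _ _ _ mu _ (fun x => Num.min (F x) (G x))) => //.
  - by apply: filterS FG => x /min_idPl.
  - apply: (@le_L1 _ _ _ mu _ _ G) => //.
      by apply: measurable_minr => //; exact: L1_measurable iG.
    by move=> x _; rewrite !ger0_norm// ?ge_min ?lexx ?orbT// le_min F0 G0.
rewrite /Lq_norm Lnorm_fin// lee_fin.
have I0 : 0 <= \int[mu]_x F x by apply: Rintegral_ge0 => x _; exact: F0.
have IB : \int[mu]_x F x <= S `^ (q - 2) * B.
  apply: le_trans (_ : \int[mu]_x G x <= _).
    by apply: ae_le_Rint => //; apply: filterS FG.
  by rewrite RintegralZl// ler_wpM2l ?powR_ge0.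
have B0 : 0 <= B by apply: le_trans hB; apply: Rintegral_ge0 => x _; exact: sqr_ge0.
have -> : S `^ (1 - 2 / q) = (S `^ (q - 2)) `^ q^-1.
  by rewrite -powRrM mulrBl mulfV ?gt_eqF.
rewrite -powRM ?powR_ge0//.
by apply: ge0_ler_powR; rewrite ?nnegrE ?invr_ge0 ?(ltW q0)// mulr_ge0 ?powR_ge0.
Qed.

Lemma Loo_norm_le (S : R) : 0 <= S -> {ae mu, forall x, `|h x| <= S} -> (Lq_norm +oo h <= S%:E)%E.
Proof.
move=> S0 hS; rewrite /Lq_norm unlock; case: ifPn => _; last by rewrite lee_fin.
by apply/ess_supP; apply: filterS hS => x xS; rewrite /= lee_fin.
Qed.
End interpolation.

(** [morrey] applied to the datum itself, with 1 added to the energy to make [E] positive. It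
    supplies the [k0] used for t <= 1. *)
Lemma initial_sup_bound (R : realType) (p ut : R) (u0 du0 : R -> R) : 1 < p ->
  (fun x => u0 x - ut) \in Lfun (leb R) 2%:E -> weak_derivative u0 du0 ->
  du0 \in Lfun (leb R) (p + 1)%:E ->
  exists2 k0 : R, 0 <= k0 & {ae leb R, forall x, `|u0 x - ut| <= k0}.
Proof.
move=> p1 /Lfun2_L1[_ iu] hu /Lfun_L1[|_ iv]; first by lra.
pose E := \int[leb R]_x (`|du0 x| `^ (p + 1)) + 1.
have E0 : 0 < E by rewrite ltr_wpDl//; apply: Rintegral_ge0 => x _; exact: powR_ge0.
exists (((16 * \int[leb R]_x ((u0 x - ut) ^+ 2)) `^ p * (4 * E)) `^ (3 * p + 1)^-1).
  exact: powR_ge0.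
have vE : \int[leb R]_x (`|du0 x| `^ (p + 1)) <= E by rewrite lerDl.
have hAC (n : nat) : exists W, AC (- n.+1%:R) n.+1%:R W du0 /\
    {ae leb R, forall x, `[- n.+1%:R, n.+1%:R]%classic x -> u0 x - ut = W x}.
  have [W [[ik HW] hW]] := initial_AC hu n; exists (fun x => W x - ut); split.
    by split=> // x ax xb; rewrite HW// addrAC.
  by apply: filterS hW => x hx xn; rewrite hx.
have := @morrey _ (fun x => u0 x - ut) du0 p _ E p1 E0 hAC iu (lexx _) iv vE.
by apply: filterS => x; apply: powR_le_root => //; lra.
Qed.

(** The bounds [K2] and [Kv] extracted from the solution stay inside the proof; the constants of the
    conclusion involve only [p], [m], [B1] and [k0]. *)
Lemma solution_decay (R : realType) (p m : R) (f : R -> R) (ut : R) (u0 : R -> R) (k0 : R)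
  (u : R -> R -> R) : 1 < p -> 0 < m -> Ck 3 f -> 0 <= k0 ->
  {ae leb R, forall x, `|u0 x - ut| <= k0} -> global_weak_solution p m f ut u0 u ->
  measurable_fun (setT : set (measurableTypeR R)) (fun x => u0 x - ut) ->
  forall t : R, 0 <= t -> let B1 := \int[leb R]_x ((u0 x - ut) ^+ 2) in
  [/\ measurable_fun (setT : set (measurableTypeR R)) (fun x => u t x - ut),
    L1 (leb R) setT (fun x => (u t x - ut) ^+ 2),
    \int[leb R]_x ((u t x - ut) ^+ 2) <= 2 * B1 + 2 &
    {ae leb R, forall x, `|u t x - ut| <= sup_const p m B1 k0 * (1 + t) `^ (- (3 * p + 1)^-1)}].
Proof.
move=> p1 m0 /Ck_derive[df cf'] k00 hk0 [v [A [hdx hdA [[heq init _] [hC hK2 hKv [hv _] hA]]]]] mu0 t t0 B1.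
have hw := C0_L2_measurable hC; have hc := C0_L2_continuous hC.
have [K2 K20 hK2'] := Linfty_Lq_bound (ler1n _ 2) hK2.
have [|Kv Kv0 hKv'] := @Linfty_Lq_bound _ (p + 1) v _ hKv; first by lra.
have K2b : {ae leb R, forall t, 0 < t -> \int[leb R]_x ((u t x - ut) ^+ 2) <= K2}.
  apply: filterS hK2' => s H s0; apply: le_trans (H s0).2.
  by under [leRHS]eq_Rintegral do rewrite powR_sqr.
have hv' (a b : R) : 0 < a ->
  L1 (leb2 R) ((`[a, b] : set (measurableTypeR R)) `*` (setT : set (measurableTypeR R)))
    (fun z => `|v z.1 z.2| `^ (p + 1)).
  move=> a0; apply: space_time_L1 hv; [lra|exact: measurableX|].
  by move=> z [/= + _]; rewrite in_itv/= => /andP[h _]; exact: lt_le_trans h.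
have hA' (a b N : R) : 0 < a -> L1 (leb2 R) (rect a b (- N) N) (fun z => A z.1 z.2 ^+ 2).
  move=> a0; have : L1 (leb2 R) (rect a b (- N) N) (fun z => `|A z.1 z.2| `^ 2).
    apply: space_time_L1 hA; [lra|exact: measurable_rect|].
    by move=> z [/= + _]; rewrite in_itv/= => /andP[h _]; exact: lt_le_trans h.
  by apply: eq_L1; [exact: measurable_rect|move=> z _; exact: powR_sqr].
have e0 : \int[leb R]_x ((u 0 x - ut) ^+ 2) <= B1.
  rewrite le_eqVlt; apply/orP; left; apply/eqP; apply: ae_eq_Rint => //.
  - exact: (L1_measurable (hw 0 (lexx 0)).2).
  - exact: measurable_funX.
  - by apply: filterS init => x -> _.
have k0' : {ae leb R, forall x, `|u 0 x - ut| <= k0}.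
  by apply: filterS2 init hk0 => x ->.
have [mw iw] := hw t t0; split=> //.
  exact: (w_mass_bound p1 m0 df cf' hdx hdA heq hw hc hv' hA' K20 Kv0 K2b hKv' e0 t0).
exact: (sup_decay p1 m0 df cf' hdx hdA heq hw hc hv' hA' K20 Kv0 K2b hKv' e0 k00 k0' t0).
Qed.

Theorem theorem1p1 (R : realType) (p mu : R) (hp : 1 < p) (hmu : 0 < mu)
    (f : R -> R) (hf : Ck 3 f) (hf0 : f 0 = 0) (hf'0 : derive1 f 0 = 0)
    (hf'' : forall y : R, 0 < derive1n 2 f y)
    (ut : R) (u0 du0 : R -> R)
    (hu0 : (fun x => u0 x - ut) \in Lfun (leb R) 2%:E)
    (hdu0 : weak_derivative u0 du0)
    (hdu0p : du0 \in Lfun (leb R) (p + 1)%:E)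
    (q : R) (hq : 2 <= q) :
  (exists2 C : R, 0 < C &
    forall u : R -> R -> R, global_weak_solution p mu f ut u0 u ->
    forall t : R, 0 <= t ->
      (Lq_norm q%:E (fun x => u t x - ut)%R <=
       (C * (1 + t) `^ (- (1 / (3 * p + 1)) * (1 - 2 / q)))%:E)%E) /\
  (forall eps : R, 0 < eps ->
   exists2 C : R, 0 < C &
    forall u : R -> R -> R, global_weak_solution p mu f ut u0 u ->
    forall t : R, 0 <= t ->
      (Lq_norm +oo (fun x => u t x - ut)%R <=
       (C * (1 + t) `^ (- (1 / (3 * p + 1)) + eps))%:E)%E).

Proof.
have [mu0 _] := Lfun2_L1 hu0.
(* [k0] and [B1] are fixed before any solution is introduced, so the constants are the same for all
   weak solutions. *)
have [k0 k00 hk0] := initial_sup_bound hp hu0 hdu0 hdu0p.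
pose B1 := \int[leb R]_x ((u0 x - ut) ^+ 2).
have B10 : 0 <= B1 by apply: Rintegral_ge0 => x _; exact: sqr_ge0.
have C0 := sup_const_gt0 p hmu B10 k00.
have dec (u : R -> R -> R) (hu : global_weak_solution p mu f ut u0 u) (t : R) (t0 : 0 <= t) :=
  solution_decay hp hmu hf k00 hk0 hu mu0 t0.
rewrite div1r; split.
  (* Interpolation raises the sup bound, decay factor included, to the power 1 - 2 / q; the mass
     bound enters with power 1 / q. *)
  exists (sup_const p mu B1 k0 `^ (1 - 2 / q) * (2 * B1 + 2) `^ q^-1).
    by rewrite mulr_gt0 ?powR_gt0//; move: B10; lra.
  move=> u hu t t0; have [mw iw hB hS] := dec u hu t t0.
  have t1 : 0 < 1 + t by lra.
  have S0 : 0 < sup_const p mu B1 k0 * (1 + t) `^ (- (3 * p + 1)^-1).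
    by rewrite mulr_gt0 ?powR_gt0.
  apply: le_trans (Lq_norm_interpolation mw hq S0 iw hB hS) _.
  by rewrite lee_fin powRM ?powR_ge0 ?(ltW C0)// -powRrM mulrAC.
move=> eps eps0; exists (sup_const p mu B1 k0) => // u hu t t0.
have [_ _ _ hS] := dec u hu t t0.
apply: Loo_norm_le; first by rewrite mulr_ge0 ?powR_ge0 ?(ltW C0).
apply: filterS hS => x /le_trans; apply.
rewrite ler_pM2l// ler_powR//; first by rewrite lerDl.
by rewrite lerDl ltW.
Qed.
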